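(* Fix $d\ge1$. For each $n\ge1$, let $$V_n:=\{x\in\mathbb Z^d\colon x_1^2+\cdots+x_d^2\le n^2\},$$ let $K_n=P_{\mathbb Z^d}[V_n]$ be the restriction to $V_n^2$ of the transition matrix of simple random walk on the lattice $\mathbb Z^d$, let $\nu_n$ be the uniform law on $V_n$, and let $\lambda_n\in(0,\infty)$. Let $$g_d(n):=\begin{cases}1&\text{if }d=1,\\ n\log n&\text{if }d=2,\\ n^{d-1}&\text{if }d\ge3.\end{cases}$$ Then, as $n\to\infty$, the $\mathrm{ARW}(K_n,\lambda_n,\nu_n)$ chain satisfies $$t_{\mathrm{rel}}^{(n)}=O(g_d(n)),\qquad t_{\mathrm{sep}}^{(n)}=|V_n|+o(|V_n|),$$ and there is a separation cutoff with window $O\big(\sqrt{n^dg_d(n)}\big)$.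
   Context: $P_{\mathbb Z^d}(x,y)=\frac1{2d}$ if $x,y$ are nearest neighbors in $\mathbb Z^d$ and $0$ otherwise. Given a finite set $V$ and a sub-stochastic matrix $K\colon V^2\to[0,1]$ (i.e. $\sum_{y}K(x,y)\le1$) having no stochastic principal sub-matrix, a $K$-walk is the killed random walk which, when alive at $x$, jumps to $y\in V$ at rate $K(x,y)$ and is killed at rate $1-\sum_yK(x,y)$. ARW dynamics with sleeping rate $\lambda\in(0,\infty)$: a configuration is $\eta\in\{0,\mathrm s,1,2,\ldots\}^V$; the site $x$ is empty if $\eta(x)=0$, holds one sleeping particle if $\eta(x)=\mathrm s$, and holds $k\ge1$ active particles if $\eta(x)=k$. In continuous time, active particles perform independent $K$-walks (a killed particle is removed), but fall asleep at rate $\lambda$ when alone on a site; sleeping particles do not move, but become active upon contact with another particle. Configurations in $\{0,\mathrm s\}^V$ are stable, and from any configuration with finitely many particles the process is almost surely absorbed in a stable configuration. The $\mathrm{ARW}(K,\lambda,\nu)$ chain is the discrete-time Markov chain on $\mathcal X=\{0,\mathrm s\}^V$ which at each step adds one active particle to the current state at an independent $\nu$-distributed random site and then runs the ARW dynamics until a stable configuration is obtained; the latter is the new state. Its transition matrix $P$ is irreducible and aperiodic, with unique invariant distribution $\pi$. $t_{\mathrm{rel}}:=\frac1{1-\rho}$ with $\rho:=\max\{|z|\colon z\in\mathbb C\setminus\{1\}\text{ is an eigenvalue of }P\}$; $d_{\mathrm{sep}}(t):=\max_{\eta,\eta'\in\mathcal X}\big(1-\frac{P^t(\eta,\eta')}{\pi(\eta')}\big)$;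 $t_{\mathrm{sep}}(\varepsilon):=\inf\{t\in\mathbb N\colon d_{\mathrm{sep}}(t)\le\varepsilon\}$, $t_{\mathrm{sep}}:=t_{\mathrm{sep}}(1/2)$, with $\mathbb N=\{0,1,2,\dots\}$. Quantities of the $n$-th chain carry the superscript $(n)$. A sequence of chains exhibits separation cutoff if for any fixed $\alpha\ge0$, $d_{\mathrm{sep}}^{(n)}(\lfloor\alpha t_{\mathrm{sep}}^{(n)}\rfloor)$ tends to $1$ if $\alpha<1$ and to $0$ if $\alpha>1$. The cutoff has window $O(w_n)$ if moreover, for every fixed $\varepsilon\in(0,1/2)$, $t_{\mathrm{sep}}^{(n)}(\varepsilon)-t_{\mathrm{sep}}^{(n)}(1-\varepsilon)=O(w_n)$. *)

(* Defs.v *)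
From HB Require Import structures.
From mathcomp Require Import all_boot all_order all_algebra.
From mathcomp Require Import finmap.
From mathcomp Require Import all_classical all_reals all_analysis.
From mathcomp.real_closed Require Import complex.

Set Implicit Arguments.
Unset Strict Implicit.
Unset Printing Implicit Defensive.

Import Order.TTheory GRing.Theory Num.Theory.
Import numFieldNormedType.Exports.

Local Open Scope classical_set_scope.
Local Open Scope ring_scope.

Section Dynamics.
Context {R : realType} {V : finType}.

(* The state of a site, in {0, s, 1, 2, ...}: [None] is s (one sleeping
   particle) and [Some k] means k active particles ([Some 0] is empty). *)
Definition config := {ffun V -> option nat}.

Definition nb_active (eta : config) (x : V) : nat := odflt 0%N (eta x).

Definition set_site (eta : config) (x : V) (s : option nat) : config :=
  [ffun y => if y == x then s else eta y].

(* Arrival of an active particle at x; a sleeping particle at x wakes up, so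
   that x then holds two active particles. *)
Definition arrive (x : V) (eta : config) : config :=
  set_site eta x (if eta x is Some k then Some k.+1 else Some 2).

(* Removal of an active particle from x; only meaningful, and only used, when
   [nb_active eta x > 0]. *)
Definition depart (x : V) (eta : config) : config :=
  set_site eta x (omap predn (eta x)).

Definition fall_asleep (x : V) (eta : config) : config := set_site eta x None.

(* The Markov generator of the continuous-time ARW dynamics. *)
Definition ARW_generator (K : V -> V -> R) (lambda : R) (f : config -> R)
    (eta : config) : R :=
  \sum_(x : V)
    ((nb_active eta x)%:R *
       (\sum_(y : V) K x y * (f (arrive y (depart x eta)) - f eta)
        + (1 - \sum_(y : V) K x y) * (f (depart x eta) - f eta))
     + (if eta x == Some 1%N then lambda * (f (fall_asleep x eta) - f eta)
        else 0)).

(* P(eta_t = zeta | eta_0 = eta) = (exp (t L) 1_zeta) (eta), with L the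
   generator. The number of particles never increases, so only finitely many
   configurations can be reached from eta and the exponential series is that
   of a finite matrix. *)
Definition ARW_transition (K : V -> V -> R) (lambda t : R)
    (eta zeta : config) : R :=
  limn (series (fun k : nat =>
    t ^+ k / k`!%:R *
    iter k (ARW_generator K lambda) (fun xi => (xi == zeta)%:R) eta)).

(* Stable configurations, in {0, s}^V: [true] stands for s. *)
Definition stable_config := {ffun V -> bool}.

Definition of_stable (eta : stable_config) : config :=
  [ffun x => if eta x then None else Some 0%N].

(* Stable configurations are absorbing, so the law of the absorbed
   configuration is the limit of the law at time t. *)
Definition stabilization_prob (K : V -> V -> R) (lambda : R)
    (eta : config) (zeta : stable_config) : R :=
  lim (ARW_transition K lambda t eta (of_stable zeta) @[t --> +oo]).

Definition ARW_kernel (K : V -> V -> R) (lambda : R) (nu : V -> R)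
    (eta zeta : stable_config) : R :=
  \sum_(x : V)
    nu x * stabilization_prob K lambda (arrive x (of_stable eta)) zeta.

Definition ARW_chain (K : V -> V -> R) (lambda : R) (nu : V -> R) :
    'M[R]_#|{: stable_config}| :=
  \matrix_(i, j) ARW_kernel K lambda nu (enum_val i) (enum_val j).

End Dynamics.

Arguments config : clear implicits.
Arguments stable_config : clear implicits.

Section FiniteChains.
Context {R : realType} {N : nat}.
Implicit Types (P : 'M[R]_N) (mu : 'rV[R]_N).

Definition invariant_law P mu : Prop :=
  [/\ forall i, 0 <= mu 0 i, \sum_i mu 0 i = 1 & mu *m P = mu].

(* The invariant law of P, for P having a unique one. *)
Definition invariant_dist P : 'rV[R]_N := xget 0 [set mu | invariant_law P mu].

(* The sets in [rho] and [d_sep] are finite, so that [sup] is a maximum. *)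
Definition rho P : R :=
  sup [set ComplexField.Normc.normc z | z in
       [set z : R[i] | eigenvalue (map_mx (real_complex R) P) z /\ z <> 1]].

Definition t_rel P : R := (1 - rho P)^-1.

Definition d_sep P (t : nat) : R :=
  sup [set 1 - (P ^+ t) ij.1 ij.2 / invariant_dist P 0 ij.2
      | ij in [set: 'I_N * 'I_N]].

Definition t_sep P (eps : R) : R :=
  inf [set t%:R | t in [set t : nat | d_sep P t <= eps]].

End FiniteChains.

Section Cutoff.
Context {R : realType} {N : nat -> nat}.
Implicit Types (P : forall n, 'M[R]_(N n)) (w : nat -> R).

Definition separation_cutoff P : Prop :=
  forall alpha : R, 0 <= alpha ->
    (alpha < 1 ->
       d_sep (P n) (Num.truncn (alpha * t_sep (P n) 2^-1)) @[n --> \oo]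
         --> (1 : R))
    /\
    (1 < alpha ->
       d_sep (P n) (Num.truncn (alpha * t_sep (P n) 2^-1)) @[n --> \oo]
         --> (0 : R)).

Definition separation_cutoff_window P w : Prop :=
  separation_cutoff P /\
  forall eps : R, 0 < eps -> eps < 2^-1 ->
    (fun n => t_sep (P n) eps - t_sep (P n) (1 - eps)) =O_\oo w.

End Cutoff.

Definition ball_set (d n : nat) : set 'rV[int]_d :=
  [set x | \sum_(i < d) x 0 i ^+ 2 <= n%:Z ^+ 2].

Arguments ball_set : clear implicits.

Definition lattice_ball (d n : nat) : {fset 'rV[int]_d} :=
  fset_set (ball_set d n).

Arguments lattice_ball : clear implicits.

(* [fset_set] is the empty set on infinite sets, hence this check. *)
Lemma mem_lattice_ball (d n : nat) (x : 'rV[int]_d) :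
  (x \in lattice_ball d n) = (\sum_(i < d) x 0 i ^+ 2 <= n%:Z ^+ 2).
Proof.
have fin : finite_set (ball_set d n).
  pose f (u : 'rV['I_(n.*2.+1)]_d) : 'rV[int]_d :=
    \row_i ((u 0 i)%:Z - n%:Z).
  apply: (@sub_finite_set _ _ (f @` setT)); last first.
    exact/finite_image/finite_finset.
  move=> y /= Hy.
  have Hi i : - n%:Z <= y 0 i <= n%:Z.
    rewrite -ler_norml -(@ler_pXn2r _ 2) ?nnegrE// real_normK ?num_real//.
    apply: le_trans Hy; rewrite (bigD1 i)//= lerDl.
    by apply: sumr_ge0 => j _; exact: sqr_ge0.
  exists (\row_i inord (absz (y 0 i + n%:Z))) => //.
  apply/rowP => i; rewrite !mxE; have /andP[h1 h2] := Hi i.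
  rewrite inordK; first by rewrite gez0_abs ?addrK// -lerBlDr sub0r.
  rewrite ltnS -lez_nat gez0_abs; last by rewrite -lerBlDr sub0r.
  by rewrite -addnn PoszD lerD2r.
by rewrite /lattice_ball in_fset_set// /ball_set; apply/idP/idP; rewrite inE.
Qed.

Section Lattice.
Context {R : realType}.

Definition lattice_srw (d : nat) (x y : 'rV[int]_d) : R :=
  if \sum_(i < d) `|x 0 i - y 0 i| == 1 then (2 * d)%:R^-1 else 0.

Definition ball_srw (d n : nat) (x y : lattice_ball d n) : R :=
  lattice_srw (val x) (val y).

Definition uniform_law (V : finType) (x : V) : R := #|V|%:R^-1.

Definition ball_ARW (d n : nat) (lambda : R) :=
  ARW_chain (@ball_srw d n) lambda (@uniform_law (lattice_ball d n)).

Definition gd (d n : nat) : R :=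
  if d == 1%N then 1
  else if d == 2%N then n%:R * ln n%:R
  else n%:R ^+ d.-1.

End Lattice.

(* Main.v *)
Require Import Defs.
From HB Require Import structures.
From mathcomp Require Import all_boot all_order all_algebra.
From mathcomp Require Import finmap.
From mathcomp Require Import all_classical all_reals all_analysis.
From mathcomp.real_closed Require Import complex.
From mathcomp Require Import ring lra zify.

Set Implicit Arguments.
Unset Strict Implicit.
Unset Printing Implicit Defensive.

Import Order.TTheory GRing.Theory Num.Theory.
Import numFieldNormedType.Exports.

Local Open Scope classical_set_scope.
Local Open Scope ring_scope.

(** The chain is compared with internal DLA: particles released one by one from
    [nu] perform killed K-walks and settle at the first vacant site.

    By the abelian property, the law of the final state does not depend on the
    order of the topplings: a function on configurations that is harmonic for one
    toppling order is harmonic for all of them, and the stabilization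
    probabilities of the continuous-time dynamics are such functions. A particle
    added to the fully occupied configuration can be walked out of the system,
    so that stabilizing this configuration produces the stationary law; and
    particles can first be spread as in IDLA. Hence the filling time T of IDLA
    satisfies d_sep(t) = P(T > t), with equality attained between the empty and
    the full state.

    Let h_z be the probability that a walk from nu hits z, and c = min h_z. The
    product over occupied y of 1 - theta P_y(hit z), killed when z is filled, is
    a supermartingale up to the factor 1 - theta h_z. For uniform nu this gives
    P(T > (1 + delta) |V|) <= |V| exp(- delta^2 c |V| / 8), and a bound of order
    1/c for the relaxation time, while T >= |V| trivially. Occupying one more site
    decreases the mean filling time by at most 1/c, which yields
    Var T <= E T / c and the window.

    On the ball, |V| h_z is the mean exit time from z divided by the Green
    function at z; explicit sub- and superharmonic functions bound it below. *)

(** * Linear algebra and minimum principle *)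

Section LinearOnFiniteSets.
Context {R : realType} {S : eqType}.
Implicit Types (X : seq S) (f g : S -> R).

(** No probability space is built: each probability or mean is the solution of a finite linear
    system, and positivity, comparison, uniqueness and solvability come from minimum principles. For
    topplings and walks, strictness is due to a killing or to a jump that lowers a rank r, whence
    the form of [killed_walk K r]. The exception is [stabilization_prob], a limit of exponential
    series, which has to be matched with such a solution.

    The function g_d is the order of the bound on 1/c. Next to the boundary the mean exit time is
    still at least of order n, and the Green function is at most of order log n if d = 2 and bounded
    if d >= 3; thus |V| h_z is at least of order n^d / g_d(n) at every z. If d = 1, a uniform bound
    on the Green function would lose a factor n near the endpoints, and exact formulas are used. As
    E T is at most of order n^d, the deviation sqrt(E T / c) has the order of the window. *)

Lemma seq_argmin d (T : orderType d) X (f : S -> T) s0 : s0 \in X ->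
  exists2 s, s \in X & forall s', s' \in X -> (f s <= f s')%O.
Proof.
elim: X s0 => [//|a X IH] s0 _.
case: X IH => [|b X] IH.
  by exists a; [rewrite inE|move=> s'; rewrite inE => /eqP ->].
have [|s sX sP] := IH b; first by rewrite inE eqxx.
case: (leP (f a) (f s)) => h.
  exists a; first by rewrite inE eqxx.
  move=> s'; rewrite inE => /orP[/eqP -> //|/sP]; exact: le_trans.
exists s; first by rewrite inE sX orbT.
by move=> s'; rewrite inE => /orP[/eqP ->|/sP //]; exact: ltW.
Qed.

(** Among the points where f attains a negative minimum, take one of least rank r. There the weights
    must sum to 1 and every target of positive weight is again a minimum, which contradicts the last
    alternative. *)
Lemma minimum_principle (I : finType) X (r : S -> nat) f :
  (forall s, s \in X -> f s < 0 -> exists (w : I -> R) (tgt : I -> S),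
     [/\ forall i, 0 <= w i,
         forall i, 0 < w i -> tgt i \in X,
         \sum_i w i <= 1,
         \sum_i w i * f (tgt i) <= f s &
         \sum_i w i < 1 \/ exists2 i, 0 < w i & (r (tgt i) < r s)%N]) ->
  forall s, s \in X -> 0 <= f s.
Proof.
move=> H s0 s0X.
have [s1 s1X s1P] := seq_argmin f s0X.
apply: le_trans (s1P _ s0X); rewrite leNgt; apply/negP => fneg.
pose Y := [seq s <- X | f s == f s1].
have s1Y : s1 \in Y by rewrite mem_filter eqxx.
have [s sY sP] := seq_argmin r s1Y.
move: sY; rewrite mem_filter => /andP[/eqP fs sX].
have [|w [tgt [w0 wX w1 wf wr]]] := H s sX; first by rewrite fs.
have le1 : f s1 * (\sum_i w i) <= \sum_i w i * f (tgt i).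
  rewrite mulr_sumr; apply: ler_sum => i _; rewrite mulrC.
  have := w0 i; rewrite le_eqVlt => /orP[/eqP <-|wi]; first by rewrite !mul0r.
  by rewrite ler_pM2l// s1P// wX.
have sw1 : \sum_i w i = 1.
  by apply/eqP; rewrite eq_le w1 /=; rewrite -(ler_nM2l fneg); lra.
case: wr => [|[i wi ri]]; first by rewrite sw1 ltxx.
have tX := wX _ wi.
have : f (tgt i) = f s1.
  apply/eqP; rewrite eq_le s1P// andbT.
  rewrite -(ler_pM2l wi) -(lerD2r (\sum_(j | j != i) w j * f (tgt j))).
  have <- := bigD1 (P := xpredT) (F := fun j => w j * f (tgt j)) i isT.
  apply: le_trans wf _; rewrite fs -{1}[f s1]mul1r -sw1 (bigD1 i)//= mulrDl.
  rewrite lerD2l mulr_suml; apply: ler_sum => j _.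
  have := w0 j; rewrite le_eqVlt => /orP[/eqP <-|wj]; first by rewrite !mul0r.
  by rewrite ler_pM2l// s1P// wX.
move=> ft; have := sP (tgt i); rewrite mem_filter ft eqxx tX => /(_ isT).
by rewrite leEnat leqNgt ri.
Qed.

Lemma linear_sum (T : (S -> R) -> S -> R) :
  (forall a f g s, T (fun s => a * f s + g s) s = a * T f s + T g s) ->
  forall (J : finType) (c : J -> R) (F : J -> S -> R) s,
  T (fun s => \sum_j c j * F j s) s = \sum_j c j * T (F j) s.
Proof.
move=> linT J c F s.
have T0 u : T (fun=> 0) u = 0.
  have := linT (-1) (fun=> 0) (fun=> 0) u.
  have -> : (fun s : S => -1 * 0 + 0 : R) = (fun=> 0).
    by apply/funext => ?; rewrite mulr0 addr0.
  by lra.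
elim: (index_enum J) => [|j r IH].
  rewrite big_nil -[RHS](T0 s); congr T.
  by apply/funext => u; rewrite big_nil.
rewrite big_cons -IH -linT; congr T.
by apply/funext => u; rewrite big_cons.
Qed.

(** S may be infinite (configurations), so the system is restricted to functions supported by X,
    where T acts as a square matrix; [undup] makes the indicators of the points a basis. *)
Lemma injective_surjective X (T : (S -> R) -> S -> R) :
  (forall a f g s, T (fun s => a * f s + g s) s = a * T f s + T g s) ->
  (forall f, (forall s, s \notin X -> f s = 0) ->
     (forall s, s \in X -> T f s = 0) -> forall s, s \in X -> f s = 0) ->
  forall b : S -> R,
  exists2 f, (forall s, s \notin X -> f s = 0) &
             (forall s, s \in X -> T f s = b s).
Proof.
move=> linT injT b.
pose x (i : 'I_(size (undup X))) := tnth (in_tuple (undup X)) i.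
have xX i : x i \in X by rewrite -mem_undup; exact: mem_tnth.
have xinj i j : (x i == x j) = (i == j).
  have /tuple_uniqP xi : uniq (in_tuple (undup X)) by exact: undup_uniq.
  by apply/eqP/eqP => [/xi|->].
have xsurj s : s \in X -> exists i, s = x i.
  rewrite -mem_undup => sX; pose t := in_tuple (undup X).
  by have /tnthP[i ->] : s \in t := sX; exists i.
pose ext (u : 'cV[R]_(size (undup X))) s := \sum_j u j 0 * (s == x j)%:R.
have extE u i : ext u (x i) = u i 0.
  rewrite /ext (bigD1 i)//= eqxx mulr1 big1 ?addr0// => j ji.
  by rewrite xinj eq_sym (negPf ji) mulr0.
have ext0 u s : s \notin X -> ext u s = 0.
  move=> sX; rewrite /ext big1// => j _.
  by case: eqP => [sx|]; rewrite ?mulr0//; rewrite sx xX in sX.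
pose M := \matrix_(i, j) T (fun s => (s == x j)%:R) (x i).
have ME u i : (M *m u) i 0 = T (ext u) (x i).
  rewrite /ext linear_sum// mxE; apply: eq_bigr => j _.
  by rewrite mxE mulrC.
have Mu : M \in unitmx.
  rewrite -unitmx_tr -row_free_unit; apply: inj_row_free => v /(congr1 trmx).
  rewrite trmx_mul trmxK trmx0 => Mv.
  have v0 : v^T = 0.
    apply/colP => i; rewrite -extE [RHS]mxE; apply: injT (xX i).
      by move=> s; exact: ext0.
    by move=> s /xsurj[j ->]; rewrite -ME Mv mxE.
  by rewrite -[v]trmxK v0 trmx0.
exists (ext (invmx M *m \col_i b (x i))); first by move=> s; exact: ext0.
by move=> s /xsurj[i ->]; rewrite -ME mulKVmx// mxE.
Qed.

End LinearOnFiniteSets.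

(** * Abelian property *)

Lemma big_option (R : nmodType) (T : finType) (F : option T -> R) :
  \sum_i F i = F None + \sum_j F (Some j).
Proof.
rewrite (bigD1 None)//=; congr (_ + _).
rewrite (reindex_omap Some id)/=; last by case.
by apply: eq_bigl => j; rewrite eqxx.
Qed.

Section Instructions.
Context {V : finType}.
Implicit Types (x y z : V) (eta : config V).

Definition active x eta := (0 < nb_active eta x)%N.

Definition doze x eta :=
  if eta x == Some 1%N then fall_asleep x eta else eta.

(* [None] is a sleep instruction, [Some None] a killing, and [Some (Some y)] a
   jump to [y]. A sleep instruction has no effect on a site that does not hold
   exactly one particle. *)
Definition perform x (i : option (option V)) eta : config V :=
  match i with
  | None => doze x eta
  | Some None => depart x eta
  | Some (Some y) => arrive y (depart x eta)
  end.

Lemma set_site_id x eta : set_site eta x (eta x) = eta.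
Proof. by apply/ffunP => u; rewrite ffunE; case: eqP => [->|]. Qed.

Lemma set_siteK x eta s t : set_site (set_site eta x s) x t = set_site eta x t.
Proof. by apply/ffunP => u; rewrite !ffunE; case: eqP. Qed.

Lemma set_siteC x y eta s t : x != y ->
  set_site (set_site eta x s) y t = set_site (set_site eta y t) x s.
Proof.
move=> xy; apply/ffunP => u; rewrite !ffunE.
by case: (eqVneq u y) => [->|//]; rewrite eq_sym (negPf xy).
Qed.

Lemma set_siteE x eta s : set_site eta x s x = s.
Proof. by rewrite ffunE eqxx. Qed.

Lemma set_site_neq x y eta s : y != x -> set_site eta x s y = eta y.
Proof. by move=> yx; rewrite ffunE (negPf yx). Qed.

Lemma doze_site x eta :
  doze x eta = set_site eta x (if eta x == Some 1%N then None else eta x).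
Proof. by rewrite /doze; case: ifP => //; rewrite set_site_id. Qed.

Lemma arriveC x y eta : arrive x (arrive y eta) = arrive y (arrive x eta).
Proof.
have [->//|xy] := eqVneq x y.
by rewrite /arrive set_siteC 1?eq_sym// !set_site_neq// eq_sym.
Qed.

(** Activity matters when x = y: [predn] truncates at an empty site, and a departure from a sleeping
    site changes nothing. *)
Lemma depart_arrive x y eta : active x eta ->
  depart x (arrive y eta) = arrive y (depart x eta).
Proof.
have [->|xy] := eqVneq x y; last first.
  by rewrite /arrive/depart set_siteC 1?eq_sym// !set_site_neq// eq_sym.
rewrite /arrive /depart !set_siteE !set_siteK /active/nb_active.
by case: (eta y) => [[|k]|].
Qed.

(** When x = y, a lone particle that falls asleep is woken by the arrival, and in the other order
    the sleep instruction is void on two particles: both give two active ones. This is the source of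
    the abelian property. *)
Lemma doze_arrive x y eta : active x eta ->
  doze x (arrive y eta) = arrive y (doze x eta).
Proof.
have [->|xy] := eqVneq x y; last first.
  by rewrite !doze_site /arrive set_siteC 1?eq_sym// !set_site_neq// eq_sym.
rewrite !doze_site /arrive !set_siteE !set_siteK /active/nb_active.
by case: (eta y) => [[|[|k]]|].
Qed.

Lemma doze_depart x y eta : x != y ->
  doze x (depart y eta) = depart y (doze x eta).
Proof.
by move=> xy; rewrite !doze_site /depart set_siteC 1?eq_sym// !set_site_neq// eq_sym.
Qed.

Lemma departC x y eta : depart x (depart y eta) = depart y (depart x eta).
Proof.
have [->//|xy] := eqVneq x y.
by rewrite /depart set_siteC 1?eq_sym// !set_site_neq// eq_sym.
Qed.

Lemma dozeC x y eta : doze x (doze y eta) = doze y (doze x eta).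
Proof.
have [->//|xy] := eqVneq x y.
by rewrite !doze_site set_siteC 1?eq_sym// !set_site_neq// eq_sym.
Qed.

Lemma active_arrive x y eta : active x eta -> active x (arrive y eta).
Proof.
rewrite /active /nb_active /arrive ffunE; case: eqP => // <-.
by case: (eta x) => [[|k]|].
Qed.

Lemma active_depart x y eta : x != y -> active x eta -> active x (depart y eta).
Proof. by move=> xy; rewrite /active /nb_active /depart set_site_neq. Qed.

Lemma active_doze x y eta : x != y -> active x eta -> active x (doze y eta).
Proof. by move=> xy; rewrite doze_site /active /nb_active set_site_neq. Qed.

Lemma active_perform x y i eta : x != y -> active x eta ->
  active x (perform y i eta).
Proof.
move=> xy ax; case: i => [[z|]|] /=; last exact: active_doze.
  by apply: active_arrive; exact: active_depart.
exact: active_depart.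
Qed.

Lemma perform_arrive x i y eta : active x eta ->
  perform x i (arrive y eta) = arrive y (perform x i eta).
Proof.
move=> ax; case: i => [[z|]|] /=; last exact: doze_arrive.
  by rewrite depart_arrive// arriveC.
exact: depart_arrive.
Qed.

Lemma performC x y i j eta : x != y -> active x eta -> active y eta ->
  perform x i (perform y j eta) = perform y j (perform x i eta).
Proof.
move=> xy ax ay; have yx : y != x by rewrite eq_sym.
case: j => [[w|]|] /=.
- rewrite perform_arrive; last exact: active_depart.
  congr arrive; case: i => [[z|]|] /=; last exact: doze_depart.
    rewrite departC depart_arrive//; exact: active_depart.
  exact: departC.
- case: i => [[z|]|] /=; last exact: doze_depart.
    rewrite departC depart_arrive//; exact: active_depart.
  exact: departC.
- case: i => [[z|]|] /=; last exact: dozeC.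
    by rewrite -doze_depart// doze_arrive//; exact: active_depart.
  by rewrite doze_depart.
Qed.

Definition nb_particles eta x := odflt 1%N (eta x).

(** With weights [(r x).+1] this is the rank of a configuration in the minimum principle: a killing
    lowers it, and so does a jump to a site of smaller r. *)
Definition mass (r : V -> nat) eta := (\sum_x nb_particles eta x * r x)%N.

Definition particles eta := (\sum_x nb_particles eta x)%N.

Lemma mass1 eta : mass (fun=> 1%N) eta = particles eta.
Proof. by apply: eq_bigr => x _; rewrite muln1. Qed.

Lemma mass_set_site r eta x s :
  (mass r (set_site eta x s) + nb_particles eta x * r x =
   mass r eta + odflt 1 s * r x)%N.
Proof.
rewrite /mass (bigD1 x)//= [in RHS](bigD1 x)//= {1 3}/nb_particles ffunE eqxx.
under eq_bigr => y /negPf yx do rewrite /nb_particles ffunE yx -/(nb_particles _ _).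
rewrite -/(nb_particles eta x); lia.
Qed.

Lemma mass_arrive r x eta : (mass r (arrive x eta) = mass r eta + r x)%N.
Proof.
have := mass_set_site r eta x (if eta x is Some k then Some k.+1 else Some 2).
rewrite /arrive /nb_particles; case: (eta x) => [k|] /=; lia.
Qed.

Lemma mass_depart r x eta : active x eta ->
  (mass r (depart x eta) + r x = mass r eta)%N.
Proof.
have := mass_set_site r eta x (omap predn (eta x)).
rewrite /depart /active /nb_active /nb_particles; case: (eta x) => [[|k]|] //=; lia.
Qed.

Lemma mass_doze r x eta : mass r (doze x eta) = mass r eta.
Proof.
rewrite /doze; case: eqP => // ex.
have := mass_set_site r eta x None; rewrite /nb_particles ex /=.
rewrite /fall_asleep; lia.
Qed.

Lemma particles_perform x i eta : active x eta ->
  (particles (perform x i eta) <= particles eta)%N.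
Proof.
move=> ax; rewrite -!mass1; case: i => [[y|]|] /=.
- by have := mass_depart (fun=> 1%N) ax; rewrite mass_arrive; lia.
- by have := mass_depart (fun=> 1%N) ax; lia.
- by rewrite mass_doze.
Qed.

Definition stable eta := [forall x, ~~ active x eta].

Lemma stable_of_stable zeta : stable (of_stable zeta).
Proof.
by apply/forallP => x; rewrite /active /nb_active ffunE; case: (zeta x).
Qed.

Lemma stableP eta : stable eta -> exists zeta, eta = of_stable zeta.
Proof.
move=> /forallP st; exists [ffun x => eta x == None]; apply/ffunP => x.
rewrite !ffunE; have := st x; rewrite /active /nb_active.
by case: (eta x) => [[|k]|].
Qed.

Lemma of_stable_inj : injective (@of_stable V).
Proof.
move=> z z' /ffunP e; apply/ffunP => x; have := e x; rewrite !ffunE.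
by case: (z x); case: (z' x).
Qed.

Lemma particles_of_stable zeta : particles (of_stable zeta) = #|[pred x | zeta x]|.
Proof.
rewrite /particles -sum1_card [RHS]big_mkcond; apply: eq_bigr => x _.
by rewrite /nb_particles ffunE inE; case: (zeta x).
Qed.

Definition configs_upto N : seq (config V) :=
  [seq [ffun x => omap (@nat_of_ord N.+1) (f x)] | f : {ffun V -> option 'I_N.+1}].

Lemma configs_uptoP N eta : (particles eta <= N)%N -> eta \in configs_upto N.
Proof.
move=> le; apply/fintype.imageP; exists [ffun x => omap inord (eta x)] => //.
apply/ffunP => x; rewrite !ffunE; case ex: (eta x) => [k|] //=.
rewrite inordK// ltnS; apply: leq_trans le.
by rewrite /particles (bigD1 x)//= /nb_particles ex /= leq_addr.
Qed.

End Instructions.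

(** The rank r certifies that no principal sub-matrix is stochastic: allowed jumps of decreasing r
    lead from any site to one where the walk may be killed. *)
Definition killed_walk {R : realType} {V : finType} (K : V -> V -> R)
    (r : V -> nat) : Prop :=
  [/\ forall x y, 0 <= K x y, forall x, \sum_y K x y <= 1 &
      forall x, \sum_y K x y < 1 \/ exists2 y, 0 < K x y & (r y < r x)%N].

Section Toppling.
Context {R : realType} {V : finType} (K : V -> V -> R) (r : V -> nat).
Context (lambda : R).
Hypothesis walkK : killed_walk K r.
Hypothesis lambda_gt0 : 0 < lambda.
Implicit Types (x y : V) (eta : config V) (F : config V -> R).

(** The law of one instruction: an active particle reads jumps and killings at total rate 1 and
    sleep instructions at rate lambda. *)
Definition weight x (i : option (option V)) : R :=
  match i with
  | None => lambda / (1 + lambda)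
  | Some None => (1 - \sum_y K x y) / (1 + lambda)
  | Some (Some y) => K x y / (1 + lambda)
  end.

Definition topple x F eta := \sum_i weight x i * F (perform x i eta).

Lemma lambda1_gt0 : 0 < 1 + lambda.
Proof. by rewrite addr_gt0. Qed.

Lemma weight_ge0 x i : 0 <= weight x i.
Proof.
case: walkK => K0 K1 _; have l1 := ltW lambda1_gt0.
case: i => [[y|]|] /=; apply: divr_ge0 => //; last exact: ltW.
by rewrite subr_ge0.
Qed.

Lemma weight_sum x : \sum_i weight x i = 1.
Proof.
rewrite !big_option /= -mulr_suml -!mulrDl subrK addrC divff//.
exact/lt0r_neq0/lambda1_gt0.
Qed.

Lemma topple_linear x a F G eta :
  topple x (fun s => a * F s + G s) eta = a * topple x F eta + topple x G eta.
Proof.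
rewrite /topple mulr_sumr -big_split; apply: eq_bigr => i _ /=.
by rewrite mulrDr mulrCA.
Qed.

Lemma toppleB x F G eta :
  topple x (fun s => F s - G s) eta = topple x F eta - topple x G eta.
Proof. by rewrite /topple -sumrB; apply: eq_bigr => i _; rewrite mulrBr. Qed.

Lemma eq_topple x F G eta : (forall i, F (perform x i eta) = G (perform x i eta)) ->
  topple x F eta = topple x G eta.
Proof. by move=> FG; apply: eq_bigr => i _; rewrite FG. Qed.

Lemma toppleC x y F eta : x != y -> active x eta -> active y eta ->
  topple x (topple y F) eta = topple y (topple x F) eta.
Proof.
move=> xy ax ay; rewrite /topple.
under eq_bigr do rewrite mulr_sumr.
under [RHS]eq_bigr do rewrite mulr_sumr.
rewrite exchange_big; apply: eq_bigr => i _; apply: eq_bigr => j _ /=.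
by rewrite performC// 1?eq_sym// mulrCA.
Qed.

Lemma topple_arrive x y F eta : active x eta ->
  topple x F (arrive y eta) = topple x (F \o arrive y) eta.
Proof.
by move=> ax; apply: eq_bigr => i _; rewrite perform_arrive.
Qed.

(** The toppled site may depend on the configuration, and D has to be kept by these topplings only.
    Sleep instructions leave [mass] unchanged; strictness comes from the killing or the jump
    provided by r. *)
Lemma superharmonic_ge0 (D : pred (config V)) N F :
  (forall eta, D eta -> (particles eta <= N)%N -> F eta < 0 ->
     exists2 x, active x eta &
       topple x F eta <= F eta /\ forall i, D (perform x i eta)) ->
  forall eta, D eta -> (particles eta <= N)%N -> 0 <= F eta.
Proof.
move=> H eta De Ne; have [K0 K1 Kr] := walkK.
pose X := [seq e <- configs_upto N | D e && (particles e <= N)%N].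
apply: (@minimum_principle _ _ (option (option V)) X (mass (fun x => (r x).+1))).
  move=> s; rewrite mem_filter => /andP[/andP[Ds Ns] _] Fs.
  have [x ax [Fx Dx]] := H s Ds Ns Fs.
  exists (weight x), (fun i => perform x i s); split => //.
  - exact: weight_ge0.
  - move=> i _; rewrite mem_filter Dx /= configs_uptoP//.
      by rewrite andbT; apply: leq_trans Ns; exact: particles_perform.
    by apply: leq_trans Ns; exact: particles_perform.
  - by rewrite weight_sum.
  right; have md := mass_depart (fun x => (r x).+1) ax.
  have [Kx|[y Kxy rxy]] := Kr x.
    exists (Some None) => /=; last by lia.
    by rewrite divr_gt0 ?lambda1_gt0// subr_gt0.
  exists (Some (Some y)) => /=; last by rewrite mass_arrive; lia.
  by rewrite divr_gt0 ?lambda1_gt0.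
by rewrite mem_filter De Ne configs_uptoP.
Qed.

Definition harmonic_upto N F := forall eta x,
  (particles eta <= N)%N -> active x eta -> F eta = topple x F eta.

Lemma eq_harmonic_on (D : pred (config V)) N F G :
  (forall eta, D eta -> (particles eta <= N)%N -> F eta != G eta ->
     exists2 x, active x eta &
       [/\ F eta = topple x F eta, G eta = topple x G eta &
           forall i, D (perform x i eta)]) ->
  forall eta, D eta -> (particles eta <= N)%N -> F eta = G eta.
Proof.
move=> H eta De Ne; apply/eqP; rewrite eq_le -[X in X && _]subr_ge0.
rewrite -[X in _ && X]subr_ge0; apply/andP; split.
  apply: (superharmonic_ge0 (D := D) (F := fun e => G e - F e) (N := N)) => //.
  move=> e De' Ne' neg; have [|x ax [Fx Gx Dx]] := H e De' Ne'.
    by apply/eqP => FG; rewrite FG subrr ltxx in neg.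
  by exists x => //; rewrite toppleB -Fx -Gx.
apply: (superharmonic_ge0 (D := D) (F := fun e => F e - G e) (N := N)) => //.
move=> e De' Ne' neg; have [|x ax [Fx Gx Dx]] := H e De' Ne'.
  by apply/eqP => FG; rewrite FG subrr ltxx in neg.
by exists x => //; rewrite toppleB -Fx -Gx.
Qed.

Lemma eq_harmonic N F G : harmonic_upto N F -> harmonic_upto N G ->
  (forall zeta, F (of_stable zeta) = G (of_stable zeta)) ->
  forall eta, (particles eta <= N)%N -> F eta = G eta.
Proof.
move=> hF hG FG eta Ne; apply: (@eq_harmonic_on predT N) => // e _ Ne' ne.
have [/forallP st|] := boolP (stable e).
  have [z ez] := stableP (introT forallP st).
  by rewrite ez FG eqxx in ne.
rewrite negb_forall => /existsP[x]; rewrite negbK => ax.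
by exists x => //; split => //; [exact: hF|exact: hG].
Qed.

(* Induction on the rank of the toppled site z: on the set of configurations
   that are active at z, the function [topple z F] is harmonic for the sites
   before z and agrees with F where these sites are inactive. *)
Lemma abelian_property N F :
  (forall eta x, (particles eta <= N)%N -> active x eta ->
     (forall y, (enum_rank y < enum_rank x)%N -> ~~ active y eta) ->
     F eta = topple x F eta) ->
  harmonic_upto N F.
Proof.
move=> H eta z; move: {2}(enum_rank z).+1 (ltnSn (enum_rank z)) => m.
elim: m z eta => [//|m IH] z eta; rewrite ltnS leq_eqVlt => /orP[/eqP zm|]; last first.
  exact: IH.
move=> Ne az; apply: (@eq_harmonic_on (active z) N) => // e aze Nex ne.
have [/existsP[y /andP[ym ay]]|] :=
    boolP [exists y, (enum_rank y < m)%N && active y e]; last first.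
  rewrite negb_exists => /forallP st; case/eqP: ne; apply: H => // y yz.
  by have := st y; rewrite -zm yz.
have zy : z != y by apply: contraTneq ym => <-; rewrite zm ltnn.
exists y => //; split.
- exact: IH.
- rewrite toppleC// 1?eq_sym//; apply: eq_topple => i; apply: IH => //.
    by apply: leq_trans Nex; exact: particles_perform.
  by apply: active_perform => //; rewrite eq_sym.
- by move=> i; exact: active_perform.
Qed.

(** One equation per configuration gives a square system, so only the toppling of the first active
    site is imposed; [abelian_property] then yields the equations of all other active sites. *)
Lemma harmonic_extension N (f : stable_config V -> R) : exists2 F,
  harmonic_upto N F &
  forall zeta, (particles (of_stable zeta) <= N)%N -> F (of_stable zeta) = f zeta.
Proof.
pose first eta := [pick x | active x eta &
  [forall y, (enum_rank y < enum_rank x)%N ==> ~~ active y eta]].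
have firstP eta : ~~ stable eta -> exists x, first eta = Some x.
  rewrite negb_forall => /existsP[x0]; rewrite negbK => ax0.
  rewrite /first; case: pickP => [x _|none]; first by exists x.
  case: (@arg_minnP V x0 (active^~ eta) (fun x => enum_rank x) ax0) => x ax xmin.
  have := none x; rewrite ax /= => /negP[]; apply/forallP => y.
  by apply/implyP => yx; apply/negP => /xmin; rewrite leqNgt yx.
have first_active eta x : first eta = Some x -> active x eta.
  by rewrite /first; case: pickP => // y /andP[ay _] [<-].
pose T F eta := if first eta is Some x then F eta - topple x F eta else F eta.
pose X := [seq e <- @configs_upto V N | (particles e <= N)%N].
have inX e : (particles e <= N)%N -> e \in X.
  by move=> Ne; rewrite mem_filter Ne configs_uptoP.
pose b eta := if stable eta then f [ffun x => eta x == None] else 0.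
have [||F _ FX] := @injective_surjective _ _ X T _ _ b.
- move=> a F G eta; rewrite /T; case: (first eta) => // x.
  by rewrite topple_linear; ring.
- move=> F _ TF eta; rewrite mem_filter => /andP[Ne _].
  apply: (@eq_harmonic_on predT N F (fun=> 0)) => // e _ Nex ne.
  have := TF e (inX _ Nex); rewrite /T.
  case ef: (first e) => [x|]; last by move=> F0; rewrite F0 eqxx in ne.
  move/eqP; rewrite subr_eq0 => /eqP Fe; exists x; first exact: first_active.
  by split=> //; rewrite /topple big1// => i _; rewrite mulr0.
have fst_stable zeta : first (of_stable zeta) = None.
  case ef: first => [x|//]; have /forallP/(_ x) := stable_of_stable zeta.
  by rewrite (first_active _ _ ef).
exists F; last first.
  move=> zeta Nz; have := FX _ (inX _ Nz); rewrite /T /b.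
  rewrite fst_stable stable_of_stable => ->; congr f.
  by apply/ffunP => x; rewrite !ffunE; case: (zeta x).
apply: abelian_property => eta x Ne ax xmin.
have nst : ~~ stable eta.
  by rewrite negb_forall; apply/existsP; exists x; rewrite negbK.
have := FX _ (inX _ Ne); rewrite /T /b (negPf nst).
have [y ey] := firstP _ nst; rewrite ey => /eqP; rewrite subr_eq0 => /eqP ->.
suff -> : x = y by [].
move: ey; rewrite /first; case: pickP => // u /andP[au /forallP umin] [uy].
rewrite -uy; apply/enum_rank_inj/val_inj/eqP; rewrite eqn_leq.
rewrite leqNgt; apply/andP; split.
  by apply/negP => ux; have := xmin _ ux; rewrite au.
by rewrite leqNgt; apply/negP => xu; have := umin x; rewrite xu ax.
Qed.

End Toppling.

(** * Absorption in continuous time *)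

Section ExponentialSeries.
Context {R : realType}.
Implicit Types (a u v : nat -> R) (k n : nat) (s q C : R).

(** The k-th finite difference of a at 0, that is, (J - 1)^k expanded with [a j] in place of J^j. *)
Definition alternating_binomial_sum a k :=
  \sum_(j < k.+1) (-1) ^+ (k - j) * a j *+ 'C(k, j).

Local Notation absum := alternating_binomial_sum.

Lemma alternating_binomial_sumS a k :
  absum a k.+1 = absum (a \o S) k - absum a k.
Proof.
rewrite /absum big_ord_recl /= bin0 subn0.
under eq_bigr => i _ do rewrite /bump /= add1n subSS binS mulrnDr.
rewrite big_split /= addrA addrC; congr (_ + _).
rewrite big_ord_recr /= bin_small// mulr0n addr0.
rewrite [in RHS]big_ord_recl /= bin0 subn0 exprS opprD !mulN1r !mulr1n mulNr.
congr (_ + _); rewrite -sumrN; apply: eq_bigr => i _.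
rewrite /bump /= add1n.
have -> : (k - i)%N = (k - i.+1).+1 by have := ltn_ord i; lia.
by rewrite exprS mulN1r !mulNr mulNrn.
Qed.

Lemma exp_coeff_alternating s a k :
  s ^+ k / k`!%:R * absum a k =
  \sum_(j < k.+1) exp_coeff (- s) (k - j)%N * (exp_coeff s j * a j).
Proof.
rewrite /absum mulr_sumr; apply: eq_bigr => j _.
have jk : (j <= k)%N by rewrite -ltnS.
rewrite /exp_coeff /= -[(_ * a j) *+ _]mulr_natr.
have f0 n : n`!%:R != 0 :> R by rewrite pnatr_eq0 -lt0n fact_gt0.
have -> : k`!%:R = ('C(k, j))%:R * (j`!%:R * (k - j)`!%:R) :> R.
  by rewrite -!natrM bin_fact.
have c0 : ('C(k, j))%:R != 0 :> R by rewrite pnatr_eq0 -lt0n bin_gt0.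
rewrite -{1}(subnK jk) exprD [(- s) ^+ _]exprNn.
by field; rewrite f0 c0 f0.
Qed.

Lemma exp_coeff_double s k :
  exp_coeff (s + s) k = \sum_(j < k.+1) exp_coeff s (k - j)%N * exp_coeff s j.
Proof.
rewrite /exp_coeff /= exprDn mulr_suml; apply: eq_bigr => j _.
have jk : (j <= k)%N by rewrite -ltnS.
have f0 n : n`!%:R != 0 :> R by rewrite pnatr_eq0 -lt0n fact_gt0.
have -> : k`!%:R = ('C(k, j))%:R * (j`!%:R * (k - j)`!%:R) :> R.
  by rewrite -!natrM bin_fact.
have c0 : ('C(k, j))%:R != 0 :> R by rewrite pnatr_eq0 -lt0n bin_gt0.
rewrite -mulr_natr.
by field; rewrite f0 c0 f0.
Qed.

Definition convolution u v k := \sum_(j < k.+1) u (k - j)%N * v j.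

Lemma series_mul u v n : series u n * series v n - series (convolution u v) n =
  \sum_(0 <= j < n) \sum_(n - j <= i < n) u i * v j.
Proof.
have -> : series (convolution u v) n =
    \sum_(0 <= j < n) \sum_(0 <= i < n - j) u i * v j.
  rewrite /series /=.
  transitivity (\sum_(0 <= k < n) \sum_(0 <= j < n | (j <= k)%N) u (k - j)%N * v j).
    rewrite big_nat_cond [RHS]big_nat_cond; apply: eq_bigr => k /andP[/andP[_ kn] _].
    rewrite /convolution -(big_mkord xpredT (fun j => u (k - j)%N * v j)).
    rewrite (big_cat_nat (leq0n k.+1) kn) /= [X in _ + X]big_nat_cond [X in _ + X]big1.
      rewrite addr0 big_nat_cond [RHS]big_nat_cond.
      by apply: eq_bigl => j; rewrite ltnS; case: (j <= k)%N; rewrite ?andbF.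
    by move=> j /andP[/andP[kj _]]; rewrite leqNgt kj.
  rewrite (exchange_big_dep_nat xpredT) //=.
  rewrite big_nat_cond [RHS]big_nat_cond; apply: eq_bigr => j /andP[/andP[_ jn] _].
  rewrite (big_cat_nat (leq0n j) (ltnW jn)) /= big_nat_cond big1 ?add0r.
    rewrite -{1}(add0n j) big_addn big_nat_cond [RHS]big_nat_cond.
    apply: eq_big => i; first by rewrite leq_addl !andbT.
    by move=> _; rewrite addnK.
  by move=> i /andP[/andP[_ ij]]; rewrite leqNgt ij.
rewrite /series /= mulr_sumr -sumrB.
apply: eq_big_nat => j /andP[_ jn].
rewrite mulr_suml (big_cat_nat (leq0n (n - j)) (leq_subr j n)) /=.
by rewrite addrAC subrr add0r.
Qed.

(** The difference is the sum over the indices i, j < n with i + j >= n, hence is dominated by that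
    of the majorants. This proves convergence of the Cauchy product without a general theorem. *)
Lemma convolution_le u v (U W : nat -> R) n :
  (forall i, `|u i| <= U i) -> (forall i, `|v i| <= W i) ->
  `|series u n * series v n - series (convolution u v) n| <=
  series U n * series W n - series (convolution U W) n.
Proof.
move=> uU vW; rewrite !series_mul; apply: le_trans (ler_norm_sum _ _ _) _.
apply: ler_sum => j _; apply: le_trans (ler_norm_sum _ _ _) _.
by apply: ler_sum => i _; rewrite normrM; exact: ler_pM.
Qed.

Lemma cvg_series_exp_coeff s : series (exp_coeff s) n @[n --> \oo] --> expR s.
Proof. exact: is_cvg_series_exp_coeff. Qed.

(** This is exp(s (J - 1)) = exp(- s) exp(s J): the second factor is at most C exp(q s). The error
    of the Cauchy product is dominated by that of exp(s) exp(s) = exp(2 s), which vanishes in the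
    limit. *)
Lemma alternating_series_bound s q C a : 0 <= s -> 0 <= q <= 1 ->
  (forall j, `|a j| <= C * q ^+ j) ->
  let S := series (fun k => s ^+ k / k`!%:R * absum a k) in
  cvgn S /\ `|limn S| <= C * expR (- ((1 - q) * s)).
Proof.
move=> s0 /andP[q0 q1] aC S.
have C0 : 0 <= C.
  by have := aC 0%N; rewrite expr0 mulr1; apply: le_trans.
pose U := exp_coeff s; pose v j := exp_coeff s j * a j.
have U0 j : 0 <= U j by exact: exp_coeff_ge0.
have SE : S = series (convolution (exp_coeff (- s)) v).
  by congr series; apply/funext => k; exact: exp_coeff_alternating.
have nU j : `|exp_coeff (- s) j| <= U j.
  by rewrite /U /exp_coeff /= normf_div normrX normrN ger0_norm// ger0_norm.
have vU j : `|v j| <= C * exp_coeff (q * s) j.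
  rewrite normrM ger0_norm; last exact: U0.
  have -> : C * exp_coeff (q * s) j = exp_coeff s j * (C * q ^+ j).
    by rewrite /exp_coeff /= exprMn; set f := _^-1; ring.
  by apply: ler_wpM2l; [exact: U0|exact: aC].
have vW j : `|v j| <= C * U j.
  apply: le_trans (vU j) _; apply: ler_wpM2l => //.
  apply: ler_wpM2r; first by rewrite invr_ge0.
  have qs : q * s <= s by rewrite -[leRHS]mul1r ler_wpM2r.
  by rewrite lerXn2r ?nnegrE ?mulr_ge0.
have convE k : convolution U (fun j => C * U j) k = C * exp_coeff (s + s) k.
  rewrite exp_coeff_double mulr_sumr; apply: eq_bigr => j _; exact: mulrCA.
have serC c u : series (fun j => c * u j) = (fun n => c * series u n).
  by apply/funext => n; rewrite /series /= mulr_sumr.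
have cS : cvgn S.
  apply: normed_cvg; apply: (@series_le_cvg _ _ (fun k => C * exp_coeff (s + s) k)).
  - by move=> k /=.
  - by move=> k; rewrite mulr_ge0// exp_coeff_ge0// addr_ge0.
  - move=> k /=; rewrite exp_coeff_alternating -convE.
    apply: le_trans (ler_norm_sum _ _ _) _; apply: ler_sum => j _.
    by rewrite normrM; apply: ler_pM; [..|exact: nU|exact: vW].
  - by rewrite serC; apply: is_cvgMr; exact: is_cvg_series_exp_coeff.
split=> //.
have Sn n : `|S n| <= `|series (exp_coeff (- s)) n| * (C * series (exp_coeff (q * s)) n)
   + (series U n * (C * series U n) - C * series (exp_coeff (s + s)) n).
  have le1 := @convolution_le _ _ _ _ n nU vW.
  have le2 : `|series v n| <= C * series (exp_coeff (q * s)) n.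
    apply: le_trans (ler_norm_sum _ _ _) _; rewrite /series /= mulr_sumr.
    by apply: ler_sum => j _; exact: vU.
  rewrite !serC in le1.
  have e1 : series (convolution U (fun j => C * U j)) n = C * series (exp_coeff (s + s)) n.
    rewrite -[RHS]/((fun n => C * series (exp_coeff (s + s)) n) n) -serC.
    by congr (series _ n); apply/funext => k; exact: convE.
  rewrite e1 -SE in le1.
  rewrite -[S n](subKr (series (exp_coeff (- s)) n * series v n)).
  apply: le_trans (ler_normB _ _) _; apply: lerD => //.
  by rewrite normrM; apply: ler_wpM2l.
have -> : C * expR (- ((1 - q) * s)) =
    `|expR (- s)| * (C * expR (q * s)) + (expR s * (C * expR s) - C * expR (s + s)).
  rewrite ger0_norm ?expR_ge0// expRD.
  rewrite (_ : - ((1 - q) * s) = - s + q * s); last by ring.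
  by rewrite expRD; ring.
have nS : `|S n| @[n --> \oo] --> `|limn S| by exact: cvg_norm.
apply: ler_cvg_to nS _ (nearW _ Sn).
have ce := cvg_series_exp_coeff.
have cC x : C * series (exp_coeff x) n @[n --> \oo] --> C * expR x.
  by apply: cvgM; [exact: cvg_cst|exact: ce].
apply: cvgD; last by apply: cvgB; [apply: cvgM; [exact: ce|exact: cC]|exact: cC].
by apply: cvgM; [apply: cvg_norm; exact: ce|exact: cC].
Qed.

End ExponentialSeries.

(** * Convergence of the continuous-time dynamics to the harmonic solution *)

Section Stabilization.
Context {R : realType} {V : finType} (K : V -> V -> R) (r : V -> nat).
Context (lambda : R).
Hypothesis walkK : killed_walk K r.
Hypothesis lambda_gt0 : 0 < lambda.
Implicit Types (x y : V) (eta : config V) (F G : config V -> R) (N : nat).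

Local Notation topple := (topple K lambda).
Local Notation L := (ARW_generator K lambda).

Lemma toppleE x F eta : topple x F eta = (1 + lambda)^-1 *
  (lambda * F (doze x eta) + (1 - \sum_y K x y) * F (depart x eta) +
   \sum_y K x y * F (arrive y (depart x eta))).
Proof.
rewrite /topple !big_option /= !mulrDr mulr_sumr addrA; congr (_ + _ + _).
- by rewrite mulrAC mulrC.
- by rewrite mulrAC mulrC.
- by apply: eq_bigr => y _; rewrite mulrAC mulrC.
Qed.

(** Every active particle may be given sleep instructions at rate lambda: on a site with several
    particles they are void and contribute 0. *)
Lemma generatorE F eta : L F eta = (1 + lambda) *
  \sum_x (nb_active eta x)%:R * (topple x F eta - F eta).
Proof.
rewrite mulr_sumr; apply: eq_bigr => x _; rewrite toppleE.
under eq_bigr do rewrite mulrBr.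
rewrite sumrB -mulr_suml.
have l0 : 1 + lambda != 0 by rewrite gt_eqF// lambda1_gt0.
set S := \sum_y K x y * F _; set k := \sum_y _.
rewrite /doze /nb_active; case: eqP => [->|] /=; first by field.
by move=> _; field.
Qed.

Lemma generator_linear a F G eta :
  L (fun e => a * F e + G e) eta = a * L F eta + L G eta.
Proof.
rewrite !generatorE mulrCA -mulrDr; congr (_ * _).
rewrite mulr_sumr -big_split; apply: eq_bigr => x _ /=.
by rewrite topple_linear; ring.
Qed.

Lemma generator0 eta : L (fun=> 0) eta = 0.
Proof.
rewrite generatorE big1 ?mulr0// => x _.
by rewrite /topple big1 ?subr0 ?mulr0// => i _; rewrite mulr0.
Qed.

Lemma generatorZ a F eta : L (fun e => a * F e) eta = a * L F eta.
Proof.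
rewrite -[RHS]addr0 -[in RHS](generator0 eta) -generator_linear.
by congr (L _ _); apply/funext => e; rewrite addr0.
Qed.

Lemma generator_harmonic N F eta : harmonic_upto K lambda N F ->
  (particles eta <= N)%N -> L F eta = 0.
Proof.
move=> hF Ne; rewrite generatorE big1 ?mulr0// => x _.
have [->|n0] := eqVneq (nb_active eta x) 0%N; first by rewrite mul0r.
by rewrite -hF// ?subrr ?mulr0// /active lt0n.
Qed.

Lemma eq_generator N F G eta :
  (forall e, (particles e <= N)%N -> F e = G e) ->
  (particles eta <= N)%N -> L F eta = L G eta.
Proof.
move=> FG Ne; rewrite !generatorE; congr (_ * _); apply: eq_bigr => x _.
have [->|n0] := eqVneq (nb_active eta x) 0%N; first by rewrite !mul0r.
rewrite FG//; congr (_ * (_ - _)); apply: eq_topple => i; apply: FG.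
by apply: leq_trans Ne; apply: particles_perform; rewrite /active lt0n.
Qed.

Lemma generator_le0 F eta : ~~ stable eta -> L F eta <= 0 ->
  exists2 x, active x eta & topple x F eta <= F eta.
Proof.
move=> nst LF; apply: contrapT => none.
have pos x : active x eta -> F eta < topple x F eta.
  by move=> ax; rewrite ltNge; apply/negP => le; apply: none; exists x.
move: nst; rewrite negb_forall => /existsP[x]; rewrite negbK => ax.
move: LF; rewrite generatorE pmulr_rle0 ?lambda1_gt0// leNgt => /negP[].
rewrite (bigD1 x)//= ltr_pwDl//.
  by rewrite mulr_gt0 ?ltr0n// subr_gt0 pos.
apply: sumr_ge0 => y _.
have [->|n0] := eqVneq (nb_active eta y) 0%N; first by rewrite mul0r.
by rewrite mulr_ge0// subr_ge0 ltW// pos// /active lt0n.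
Qed.

(* The generator is [unif_rate N * (jump N - id)], and [jump N] is positive on
   configurations with at most N particles. *)
Definition unif_rate N : R := (1 + lambda) * N.+1%:R.

Definition jump N F eta : R := F eta + (unif_rate N)^-1 * L F eta.

Lemma unif_rate_gt0 N : 0 < unif_rate N.
Proof. by rewrite mulr_gt0 ?lambda1_gt0. Qed.

Lemma jump_linear N a F G :
  jump N (fun e => a * F e + G e) = (fun e => a * jump N F e + jump N G e).
Proof. by apply/funext => e; rewrite /jump generator_linear; ring. Qed.

Lemma iter_jumpB N j a F G : iter j (jump N) (fun e => a * (F e - G e)) =
  (fun e => a * (iter j (jump N) F e - iter j (jump N) G e)).
Proof.
elim: j => [//|j IH]; rewrite iterS IH; apply/funext => e.
have -> : (fun e => a * (iter j (jump N) F e - iter j (jump N) G e)) =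
  (fun e => a * iter j (jump N) F e + ((- a) * iter j (jump N) G e + 0)).
  by apply/funext => u; ring.
have j0 : jump N (fun=> 0) = (fun=> 0).
  apply/funext => u; rewrite /jump generatorE big1 ?mulr0 ?addr0// => x _.
  by rewrite /topple big1 ?subr0 ?mulr0// => i _; rewrite mulr0.
by rewrite jump_linear jump_linear j0 !iterS; ring.
Qed.

Lemma iter_generator N k F eta : iter k L F eta =
  unif_rate N ^+ k * alternating_binomial_sum (fun j => iter j (jump N) F eta) k.
Proof.
elim: k F => [|k IH] F.
  by rewrite /alternating_binomial_sum big_ord1 /= expr0 !mul1r mulr1n.
have LF : L F = (fun e => unif_rate N * (jump N F e - F e)).
  apply/funext => e; rewrite /jump addrAC subrr add0r mulrA divff ?mul1r//.
  by rewrite gt_eqF// unif_rate_gt0.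
rewrite iterSr IH alternating_binomial_sumS exprSr -mulrA; congr (_ * _).
rewrite {1}LF /alternating_binomial_sum -sumrB mulr_sumr.
apply: eq_bigr => j _; rewrite iter_jumpB /= -iterSr iterS.
by rewrite -[in RHS]mulrnBl mulrnAr; congr (_ *+ _); ring.
Qed.

Lemma jump_le N F G eta :
  (forall e, (particles e <= N)%N -> F e <= G e) ->
  (particles eta <= N)%N -> jump N F eta <= jump N G eta.
Proof.
move=> FG Ne.
have jE H : jump N H eta =
    (1 - \sum_x (nb_active eta x)%:R / N.+1%:R) * H eta +
    \sum_x (nb_active eta x)%:R / N.+1%:R * topple x H eta.
  rewrite /jump generatorE /unif_rate invfM mulrA mulrAC -mulrA -mulrA.
  rewrite [X in _ + X](_ : _ = N.+1%:R^-1 * \sum_x (nb_active eta x)%:R * (topple x H eta - H eta)).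
    rewrite mulrBl mul1r -addrA; congr (_ + _).
    rewrite mulr_suml -sumrN -big_split mulr_sumr; apply: eq_bigr => x _ /=.
    by ring.
  rewrite mulrC -!mulrA mulfV ?mulr1; last by rewrite gt_eqF// lambda1_gt0.
  by rewrite mulrC.
rewrite !jE lerD//.
  apply: ler_wpM2l; last exact: FG.
  rewrite subr_ge0 -mulr_suml ler_pdivrMr// mul1r -natr_sum ler_nat.
  apply: leq_trans (leqW Ne); apply: leq_sum => x _.
  by rewrite /nb_active /nb_particles; case: (eta x).
apply: ler_sum => x _.
have [->|n0] := eqVneq (nb_active eta x) 0%N; first by rewrite !mul0r.
apply: ler_wpM2l; first by rewrite divr_ge0.
apply: ler_sum => i _; apply: ler_wpM2l; first exact: weight_ge0 walkK _ _ _.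
apply: FG; apply: leq_trans Ne; apply: particles_perform.
by rewrite /active lt0n.
Qed.

Lemma generator_stable F eta : stable eta -> L F eta = 0.
Proof.
move=> /forallP st; rewrite generatorE big1 ?mulr0// => x _.
by have := st x; rewrite /active lt0n negbK => /eqP ->; rewrite mul0r.
Qed.

(* In the proof, w is the mean absorption time, up to a constant factor; it is
   contracted by [jump] and dominates g. *)
Lemma jump_decay N g :
  (forall eta, stable eta -> (particles eta <= N)%N -> g eta = 0) ->
  exists2 q, 0 <= q < 1 & forall eta, (particles eta <= N)%N ->
    exists C, forall j, `|iter j (jump N) g eta| <= C * q ^+ j.
Proof.
move=> g0.
pose X := [seq e <- @configs_upto V N | (particles e <= N)%N].
have inX e : (particles e <= N)%N -> e \in X.
  by move=> Ne; rewrite mem_filter Ne configs_uptoP.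
pose T F eta := if stable eta then F eta else - L F eta.
have [||w _ wX] := @injective_surjective _ _ X T _ _
  (fun e => if stable e then 0 else 1).
- move=> a F G e; rewrite /T; case: ifP => // _.
  by rewrite generator_linear; ring.
- have ge F : (forall s, s \in X -> T F s = 0) ->
      forall e, (particles e <= N)%N -> 0 <= F e.
    move=> TF e Ne; apply: (superharmonic_ge0 (D := predT) walkK lambda_gt0 (N := N)) => //.
    move=> e' _ Ne' neg; have := TF e' (inX _ Ne'); rewrite /T.
    case: ifP => [_ F0|st]; first by rewrite F0 ltxx in neg.
    move/eqP; rewrite oppr_eq0 => /eqP LF.
    have [|x ax xF] := @generator_le0 F e' (negbT st); first by rewrite LF.
    by exists x.
  move=> F _ TF e; rewrite mem_filter => /andP[Ne _].
  apply/eqP; rewrite eq_le ge// andbT -oppr_ge0.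
  apply: (ge (fun e => - F e)) => // s sX; have := TF s sX; rewrite /T.
  case: ifP => [_ ->|_ /eqP]; first by rewrite oppr0.
  rewrite oppr_eq0 => /eqP LF.
  have -> : (fun e => - F e) = (fun e => -1 * F e).
    by apply/funext => u; rewrite mulN1r.
  by rewrite generatorZ LF mulr0 oppr0.
have w0 e : stable e -> (particles e <= N)%N -> w e = 0.
  by move=> st Ne; have := wX e (inX _ Ne); rewrite /T st.
have Lw e : ~~ stable e -> (particles e <= N)%N -> L w e = -1.
  move=> st Ne; have := wX e (inX _ Ne); rewrite /T (negPf st) => <-.
  by rewrite opprK.
have wge0 e : (particles e <= N)%N -> 0 <= w e.
  move=> Ne; apply: (superharmonic_ge0 (D := predT) walkK lambda_gt0 (N := N)) => //.
  move=> e' _ Ne' neg; have st : ~~ stable e'.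
    by apply/negP => st; rewrite w0// ltxx in neg.
  have [|x ax xF] := @generator_le0 w e' st; first by rewrite Lw// oppr_le0.
  by exists x.
have cu := unif_rate_gt0 N.
have iu : 0 < (unif_rate N)^-1 by rewrite invr_gt0.
have jw e : ~~ stable e -> (particles e <= N)%N -> jump N w e = w e - (unif_rate N)^-1.
  by move=> st Ne; rewrite /jump Lw// mulrN1.
have wlow e : ~~ stable e -> (particles e <= N)%N -> (unif_rate N)^-1 <= w e.
  move=> st Ne; rewrite -subr_ge0 -jw//.
  have <- : jump N (fun=> 0) e = 0.
    by rewrite /jump generator0 mulr0 addr0.
  exact: jump_le.
pose M := (unif_rate N)^-1 + \sum_(e <- X) w e.
have wM e : (particles e <= N)%N -> w e <= M.
  move=> Ne; apply: (@le_trans _ _ (\sum_(e <- X) w e)); last by rewrite lerDr ltW.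
  rewrite (big_rem e (inX _ Ne)) /= lerDl big_seq.
  by apply: sumr_ge0 => u /mem_rem; rewrite mem_filter => /andP[Nu _]; exact: wge0.
have M0 : 0 < M.
  rewrite ltr_pwDl// big_seq; apply: sumr_ge0 => u.
  by rewrite mem_filter => /andP[Nu _]; exact: wge0.
(* Off the stable configurations [jump] lowers w by the inverse rate, which is at least the fraction
   (inverse rate) / M of w. The inverse rate is a summand of M, so that M > 0 and q >= 0. *)
pose q := 1 - (unif_rate N)^-1 / M.
have q01 : 0 <= q < 1.
  rewrite subr_ge0 ler_pdivrMr// mul1r lerDl gtrBl divr_gt0// andbT.
  rewrite big_seq; apply: sumr_ge0 => u.
  by rewrite mem_filter => /andP[Nu _]; exact: wge0.
exists q => // eta Ne; have [q0 q1] := andP q01.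
have jwq e : (particles e <= N)%N -> jump N w e <= q * w e.
  move=> Ne'; have [st|st] := boolP (stable e).
    by rewrite /jump generator_stable// w0// !mulr0 addr0.
  rewrite jw// mulrBl mul1r lerB// mulrAC ler_pdivrMr//.
  by apply: ler_wpM2l; [exact: ltW|exact: wM].
pose B := \sum_(e <- X) `|g e|.
have gB e : (particles e <= N)%N -> `|g e| <= B.
  move=> Ne'; rewrite /B (big_rem e (inX _ Ne')) /= lerDl.
  by apply: sumr_ge0.
have B0 : 0 <= B by apply: sumr_ge0.
have main j e : (particles e <= N)%N ->
    `|iter j (jump N) g e| <= (unif_rate N * B * q ^+ j) * w e.
  elim: j e => [|j IH] e Ne'.
    have [st|st] := boolP (stable e); first by rewrite /= g0// w0// normr0 mulr0.
    rewrite expr0 mulr1 /=; apply: le_trans (gB _ Ne') _.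
    rewrite mulrAC -[leLHS]mul1r; apply: ler_wpM2r => //.
    by rewrite -ler_pdivrMl// mulr1 wlow.
  set c := unif_rate N * B * q ^+ j in IH.
  have c0 : 0 <= c.
    by apply: mulr_ge0; [apply: mulr_ge0 => //; exact: ltW|exact: exprn_ge0].
  have cw a e' : jump N (fun e => a * w e) e' = a * jump N w e'.
    by rewrite /jump generatorZ; ring.
  rewrite iterS ler_norml; apply/andP; split.
    rewrite -mulNr; apply: (@le_trans _ _ (jump N (fun e => - c * w e) e)).
      rewrite cw exprSr mulrA -/c !mulNr lerN2 -[leRHS]mulrA.
      by apply: ler_wpM2l => //; exact: jwq.
    apply: jump_le => // u Nu; have := IH u Nu; rewrite ler_norml mulNr.
    by case/andP.
  apply: (@le_trans _ _ (jump N (fun e => c * w e) e)).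
    by apply: jump_le => // u Nu; have := IH u Nu; rewrite ler_norml; case/andP.
  rewrite cw exprSr mulrA -/c -[leRHS]mulrA.
  by apply: ler_wpM2l => //; exact: jwq.
exists (unif_rate N * B * w eta) => j; apply: le_trans (main j _ Ne) _.
by rewrite mulrAC.
Qed.


(** The function g = F - 1_zeta vanishes on stable configurations and L F = 0, so that exp(t L)
    1_zeta = F - exp(t L) g, and the last term decays exponentially in t. *)
Lemma stabilization_probE N F eta zeta : harmonic_upto K lambda N F ->
  (forall z, (particles (of_stable z) <= N)%N ->
     F (of_stable z) = (z == zeta)%:R) ->
  (particles eta <= N)%N ->
  stabilization_prob K lambda eta zeta = F eta.
Proof.
move=> hF Fst Ne.
pose one (xi : config V) : R := (xi == of_stable zeta)%:R.
pose g xi := F xi - one xi.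
have g0 e : stable e -> (particles e <= N)%N -> g e = 0.
  move=> /stableP[z ->] Nz; rewrite /g Fst// /one (inj_eq (@of_stable_inj V)).
  by rewrite subrr.
have [q /andP[q0 q1] gq] := jump_decay g0.
have [C gC] := gq _ Ne.
pose s t := unif_rate N * t.
pose S t := series (fun k => s t ^+ k / k`!%:R *
   alternating_binomial_sum (fun j => iter j (jump N) g eta) k).
have iterL k G e : (forall e, (particles e <= N)%N -> G e = 0) ->
    (particles e <= N)%N -> iter k L G e = 0.
  move=> G0; elim: k e => [|k IH] e Ne'; first exact: G0.
  by rewrite iterS (eq_generator (G := fun=> 0) (N := N))// generator0.
have LF k : iter k.+1 L F eta = 0.
  by rewrite iterSr; apply: iterL => // e; exact: generator_harmonic.
have iterB k : iter k L one eta = iter k L F eta - iter k L g eta.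
  rewrite -[in RHS]mulN1r addrC; have -> : one = (fun e => -1 * g e + F e).
    by apply/funext => e; rewrite /g; ring.
  elim: k eta {Ne gC S LF} => [//|k IH] e; rewrite !iterS.
  by rewrite -generator_linear; congr (L _ _); apply/funext.
have trE t : 0 <= t -> ARW_transition K lambda t eta (of_stable zeta) = F eta - limn (S t).
  move=> t0; have st : 0 <= s t by rewrite mulr_ge0// ltW// unif_rate_gt0.
  have [cS _] := alternating_series_bound st (introT andP (conj q0 (ltW q1))) gC.
  (* After the shift every partial sum contains the term k = 0, the only one to which F
     contributes. *)
  apply/cvg_lim => //; rewrite -(cvg_shiftS).
  have -> : [sequence series (fun k => t ^+ k / k`!%:R * iter k L one eta) n.+1]_n =
      (fun n => F eta - S t n.+1).
    apply/funext => n /=; rewrite /S /series /=.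
    under eq_bigr do rewrite iterB mulrBr.
    rewrite sumrB [X in X - _]big_nat_recl//= big1 ?addr0.
      rewrite expr0 fact0 divr1 mul1r; congr (_ - _); apply: eq_bigr => k _.
      rewrite (iter_generator N) mulrA /s [(unif_rate N * t) ^+ k]exprMn.
      by rewrite [t ^+ k / _ * _]mulrAC [t ^+ k * _]mulrC.
    by move=> k _; rewrite [L _ _](LF k) mulr0.
  apply: cvgB; first exact: cvg_cst.
  by rewrite (cvg_shiftS (S t)).
have bound t : 0 <= t -> `|limn (S t)| <= C * expR (- ((1 - q) * s t)).
  move=> t0; have st : 0 <= s t by rewrite mulr_ge0// ltW// unif_rate_gt0.
  by have [_] := alternating_series_bound st (introT andP (conj q0 (ltW q1))) gC.
have sy : (1 - q) * unif_rate N * t @[t --> +oo] --> +oo.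
  by apply: gt0_cvgMry; [rewrite mulr_gt0 ?subr_gt0// unif_rate_gt0|exact: cvg_id].
have e0 : C * expR (- ((1 - q) * s t)) @[t --> +oo] --> C * 0.
  apply: cvgM; first exact: cvg_cst.
  under eq_fun do rewrite /s mulrA.
  exact: cvg_comp sy (@cvgr_expR R).
rewrite mulr0 in e0.
apply/cvg_lim => //.
apply: (squeeze_cvgr (f := fun t => F eta - C * expR (- ((1 - q) * s t)))
                     (h := fun t => F eta + C * expR (- ((1 - q) * s t)))).
- near=> t; have t0 : 0 <= t by near: t; exact: nbhs_pinfty_ge.
  rewrite trE//; have := bound t t0; rewrite ler_norml => /andP[h1 h2].
  by apply/andP; split; lra.
- by rewrite -[X in _ --> X]subr0; apply: cvgB => //; exact: cvg_cst.
- by rewrite -[X in _ --> X]addr0; apply: cvgD => //; exact: cvg_cst.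
Unshelve. all: by end_near. Qed.

End Stabilization.

(** * Internal DLA *)

Section Dirichlet.
Context {R : realType} {V : finType} (K : V -> V -> R) (r : V -> nat).
Hypothesis walkK : killed_walk K r.
Implicit Types (A B : {set V}) (x y z : V) (f phi : V -> R).

Lemma walk_superharmonic_ge0 A f : (forall x, x \notin A -> 0 <= f x) ->
  (forall x, x \in A -> \sum_y K x y * f y <= f x) -> forall x, 0 <= f x.
Proof.
move=> f0 fA x; have [K0 K1 Kr] := walkK.
apply: (@minimum_principle _ _ V (enum V) r) (mem_enum _ x) => s _ fs.
have sA : s \in A by apply: contraTT fs => /f0; rewrite leNgt.
exists (K s), id; split=> //; first by move=> i _; rewrite mem_enum.
exact: fA.
Qed.

(* The solution of phi = K phi + c on A and phi = b outside A. *)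
Definition dirichlet A (b c : V -> R) : V -> R := xget (fun=> 0) [set phi |
  forall x, phi x = if x \in A then \sum_y K x y * phi y + c x else b x].

Lemma dirichletE A b c x : dirichlet A b c x =
  if x \in A then \sum_y K x y * dirichlet A b c y + c x else b x.
Proof.
rewrite {1 2}/dirichlet; set P := [set _ | _]; move: x.
apply: (@xgetPex _ (fun=> 0) P); rewrite /P /=.
pose T phi x := phi x - (if x \in A then \sum_y K x y * phi y else 0).
have [||phi _ phiE] := @injective_surjective _ _ (enum V) T _ _
  (fun x => if x \in A then c x else b x).
- move=> a f g x; rewrite /T; case: ifP => _; last by rewrite !subr0.
  under eq_bigr do rewrite mulrDr mulrCA.
  by rewrite big_split /= -mulr_sumr; ring.
- move=> f _ Tf x _; apply/eqP; rewrite eq_le -[X in X && _]oppr_ge0.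
  apply/andP; split.
    apply: (walk_superharmonic_ge0 (A := A) (f := fun x => - f x)).
      move=> y yA; have := Tf y (mem_enum _ y).
      by rewrite /T (negPf yA) subr0 => ->; rewrite oppr0.
    move=> y yA; have := Tf y (mem_enum _ y); rewrite /T yA => /eqP.
    rewrite subr_eq0 => /eqP ->; rewrite -sumrN.
    by under eq_bigr do rewrite mulrN.
  apply: (walk_superharmonic_ge0 (A := A)).
    by move=> y yA; have := Tf y (mem_enum _ y); rewrite /T (negPf yA) subr0 => ->.
  move=> y yA; have := Tf y (mem_enum _ y); rewrite /T yA => /eqP.
  by rewrite subr_eq0 => /eqP <-.
exists phi => x; have := phiE x (mem_enum _ x); rewrite /T.
by case: ifP => _ e; rewrite -e; ring.
Qed.

Lemma dirichlet_in A b c x : x \in A ->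
  dirichlet A b c x = \sum_y K x y * dirichlet A b c y + c x.
Proof. by move=> xA; rewrite dirichletE xA. Qed.

Lemma dirichlet_out A b c x : x \notin A -> dirichlet A b c x = b x.
Proof. by move=> xA; rewrite dirichletE (negPf xA). Qed.

Lemma le_dirichlet A b c f : (forall x, x \notin A -> f x <= b x) ->
  (forall x, x \in A -> f x <= \sum_y K x y * f y + c x) ->
  forall x, f x <= dirichlet A b c x.
Proof.
move=> fb fA x; rewrite -subr_ge0; move: x.
apply: (walk_superharmonic_ge0 (A := A)) => x xA.
  by rewrite dirichlet_out// subr_ge0 fb.
under eq_bigr do rewrite mulrBr.
by rewrite sumrB (dirichlet_in _ _ xA); have := fA x xA; lra.
Qed.

Lemma dirichlet_le A b c f : (forall x, x \notin A -> b x <= f x) ->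
  (forall x, x \in A -> \sum_y K x y * f y + c x <= f x) ->
  forall x, dirichlet A b c x <= f x.
Proof.
move=> fb fA x; rewrite -subr_ge0; move: x.
apply: (walk_superharmonic_ge0 (A := A)) => x xA.
  by rewrite dirichlet_out// subr_ge0 fb.
under eq_bigr do rewrite mulrBr.
by rewrite sumrB (dirichlet_in _ _ xA); have := fA x xA; lra.
Qed.

Lemma dirichlet_unique A b c f : (forall x, x \notin A -> f x = b x) ->
  (forall x, x \in A -> f x = \sum_y K x y * f y + c x) ->
  forall x, f x = dirichlet A b c x.
Proof.
move=> fb fA x; apply/eqP; rewrite eq_le; apply/andP; split; move: x.
  by apply: le_dirichlet => x xA; [rewrite fb|rewrite -fA].
by apply: dirichlet_le => x xA; [rewrite fb|rewrite -fA].
Qed.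

End Dirichlet.

Section IDLA.
Context {R : realType} {V : finType} (K : V -> V -> R) (r : V -> nat).
Hypothesis walkK : killed_walk K r.
Implicit Types (A B : {set V}) (x y z : V) (p : {set V} -> R).

Local Notation full := (finset.setTfor V).

Definition kill x : R := 1 - \sum_y K x y.

(* The expectation of [p] at the occupied set obtained from [A] by releasing at
   [x] a K-walk that settles at the first site outside [A]; the set is still [A]
   if the walk is killed before. *)
Definition release p A : V -> R :=
  dirichlet K A (fun x => p (x |: A)) (fun x => kill x * p A).

Lemma kill_ge0 x : 0 <= kill x.
Proof. by case: walkK => _ K1 _; rewrite subr_ge0. Qed.

Lemma sumK_const x (a : R) : \sum_y K x y * a + kill x * a = a.
Proof. by rewrite -mulr_suml /kill; ring. Qed.

Lemma release_out p A x : x \notin A -> release p A x = p (x |: A).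
Proof. exact: dirichlet_out walkK _ _ _ _. Qed.

Lemma release_in p A x : x \in A ->
  release p A x = \sum_y K x y * release p A y + kill x * p A.
Proof. exact: dirichlet_in walkK _ _ _ _. Qed.

Lemma release_ge p A (a : R) x : a <= p A ->
  (forall s, s \notin A -> a <= p (s |: A)) -> a <= release p A x.
Proof.
move=> aA aS; apply: (le_dirichlet walkK (f := fun=> a)) => // y yA.
by rewrite -{1}(sumK_const y a) lerD2l ler_wpM2l// kill_ge0.
Qed.

Lemma release_le p p' A x : p A <= p' A ->
  (forall s, s \notin A -> p (s |: A) <= p' (s |: A)) ->
  release p A x <= release p' A x.
Proof.
move=> pA pS; apply: (le_dirichlet walkK) => y yA.
  by rewrite release_out// pS.
by rewrite release_in// lerD2l ler_wpM2l// kill_ge0.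
Qed.

Lemma release_linear (J : finType) (c : J -> R) (F : J -> {set V} -> R) A x :
  release (fun B => \sum_j c j * F j B) A x = \sum_j c j * release (F j) A x.
Proof.
apply/esym; move: x; apply: (dirichlet_unique walkK) => x xA.
  by apply: eq_bigr => j _; rewrite release_out.
under eq_bigr => j _ do rewrite release_in// mulrDr.
rewrite big_split /=; congr (_ + _).
  under [RHS]eq_bigr do rewrite mulr_sumr.
  rewrite exchange_big /=; apply: eq_bigr => j _; rewrite mulr_sumr.
  by apply: eq_bigr => y _; rewrite mulrCA.
by rewrite mulr_sumr; apply: eq_bigr => j _; rewrite mulrCA.
Qed.

Lemma release_linear2 (a : R) p p' A x :
  release (fun B => a * p B + p' B) A x = a * release p A x + release p' A x.
Proof.
have := release_linear (fun b : bool => if b then a else 1)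
  (fun b : bool => if b then p else p') A x.
rewrite !big_bool /= mul1r => <-; congr release.
by apply/funext => B; rewrite big_bool /= mul1r.
Qed.

Lemma releaseT p x : release p full x = p full.
Proof.
apply/esym; move: x; apply: (dirichlet_unique walkK) => x; first by rewrite inE.
by move=> _; rewrite sumK_const.
Qed.

(** If one start is outside A, both sides solve the same Dirichlet problem in the other start. If x
    lies in A, let Z be the defect of the equation that [D y x] should satisfy in x: as a function
    of y it is harmonic on A and null outside, hence 0. *)
Lemma releaseC p A x y :
  release (fun B => release p B y) A x = release (fun B => release p B x) A y.
Proof.
pose D x y := release (fun B => release p B y) A x.
rewrite -/(D x y) -/(D y x).
have D_out u v : u \notin A -> D u v = release p (u |: A) v.
  by move=> uA; rewrite /D release_out.
have D_in u v : u \in A ->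
    D u v = \sum_w K u w * D w v + kill u * release p A v.
  by move=> uA; rewrite /D release_in.
have sym_out_out u v : u \notin A -> v \notin A -> D u v = D v u.
  move=> uA vA; rewrite !D_out//; have [->//|uv] := eqVneq u v.
  rewrite !release_out ?inE ?negb_or ?uA ?vA ?andbT//; last by rewrite eq_sym.
  by rewrite !finset.setUA [[set v]%SET :|: _]finset.setUC.
have sym_out u v : u \notin A -> D u v = D v u.
  move=> uA; have [vA|] := boolP (v \in A); last exact: sym_out_out.
  rewrite (D_out u v)//; apply/esym; move: v vA.
  suff H v : D v u = dirichlet K A (fun v => D u v)
      (fun v => kill v * p (u |: A)) v.
    move=> v vA; rewrite H; apply/esym; move: {vA} v.
    apply: (dirichlet_unique walkK) => v vA; first by rewrite D_out.
    by rewrite release_in// inE vA orbT.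
  move: v; apply: (dirichlet_unique walkK) => v vA; first exact: sym_out_out.
  by rewrite D_in// release_out.
have [xA|/sym_out //] := boolP (x \in A).
move: x xA; suff H x : x \in A ->
    D y x = \sum_w K x w * D y w + kill x * release p A y.
  suff E x : D y x = dirichlet K A (fun x => D x y)
      (fun x => kill x * release p A y) x.
    move=> x xA; rewrite E; move: {xA} x.
    by apply: (dirichlet_unique walkK) => x xA //; rewrite D_in.
  move: x; apply: (dirichlet_unique walkK) => x xA; last exact: H.
  exact: esym (sym_out _ _ xA).
move=> xA; apply/eqP; rewrite -subr_eq0; apply/eqP.
pose Z v := D v x - (\sum_w K x w * D v w + kill x * release p A v).
rewrite -/(Z y).
have Z_out v : v \notin A -> Z v = 0.
  move=> vA; rewrite /Z D_out// release_in; last by rewrite inE xA orbT.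
  under [X in _ - (X + _)]eq_bigr do rewrite D_out//.
  by rewrite (release_out p vA) subrr.
have Z_in v : v \in A -> Z v = \sum_w K v w * Z w.
  move=> vA; rewrite /Z.
  under [RHS]eq_bigr do rewrite mulrBr mulrDr.
  rewrite sumrB big_split /= (D_in v x)// (release_in p xA) (release_in p vA).
  under [X in _ - (X + _) = _]eq_bigr do rewrite D_in// mulrDr.
  rewrite big_split /=.
  have -> : \sum_w K x w * (\sum_u K v u * D u w) =
            \sum_u K v u * (\sum_w K x w * D u w).
    under eq_bigr do rewrite mulr_sumr.
    under [RHS]eq_bigr do rewrite mulr_sumr.
    rewrite exchange_big /=; apply: eq_bigr => u _; apply: eq_bigr => w _.
    exact: mulrCA.
  have -> : \sum_w K x w * (kill v * release p A w) =
      kill v * \sum_w K x w * release p A w.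
    by rewrite mulr_sumr; apply: eq_bigr => w _; rewrite mulrCA.
  have -> : \sum_w K v w * (kill x * release p A w) =
      kill x * \sum_w K v w * release p A w.
    by rewrite mulr_sumr; apply: eq_bigr => w _; rewrite mulrCA.
  by ring.
have Z0 v : Z v = dirichlet K A (fun=> 0) (fun=> 0) v.
  by apply: (dirichlet_unique walkK) => u uA; [rewrite Z_out|rewrite addr0 -Z_in].
rewrite Z0; apply/esym.
apply: (dirichlet_unique walkK (f := fun=> 0)) => // x0 _.
by rewrite addr0 big1// => u _; rewrite mulr0.
Qed.

End IDLA.

(** * Internal DLA with random starts and the exponential supermartingale *)

Section IDLAChain.
Context {R : realType} {V : finType} (K : V -> V -> R) (r : V -> nat).
Context (nu : V -> R).
Hypothesis walkK : killed_walk K r.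
Hypothesis nu_ge0 : forall x, 0 <= nu x.
Hypothesis nu_sum : \sum_x nu x = 1.
Implicit Types (A B : {set V}) (x y z : V) (p : {set V} -> R) (t : nat).

Local Notation full := (finset.setTfor V).
Local Notation release := (release K).

Definition idla p A : R := \sum_x nu x * release p A x.

Definition unfilled A : R := (A != full)%:R.

(* The probability that t particles do not fill V when A is occupied at first. *)
Definition survival t A : R := iter t idla unfilled A.

Lemma idla_le p p' A : p A <= p' A ->
  (forall s, s \notin A -> p (s |: A) <= p' (s |: A)) -> idla p A <= idla p' A.
Proof.
move=> pA pS; apply: ler_sum => x _; apply: ler_wpM2l => //.
exact: release_le walkK _ _ _ _ _ _.
Qed.

Lemma idla_homo p p' : (forall A, p A <= p' A) -> forall A, idla p A <= idla p' A.
Proof. by move=> pp A; apply: idla_le. Qed.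

Lemma idla_linear a p p' A :
  idla (fun B => a * p B + p' B) A = a * idla p A + idla p' A.
Proof.
rewrite /idla mulr_sumr -big_split /=; apply: eq_bigr => x _.
by rewrite (release_linear2 walkK); ring.
Qed.

Lemma idla_cst a A : idla (fun=> a) A = a.
Proof.
rewrite /idla -[RHS]mul1r -nu_sum mulr_suml; apply: eq_bigr => x _.
congr (_ * _); apply/esym; move: x.
by apply: (dirichlet_unique walkK) => x _ //; rewrite sumK_const.
Qed.

Lemma idlaZ a p A : idla (fun B => a * p B) A = a * idla p A.
Proof.
rewrite -[RHS]addr0 -[in RHS](idla_cst 0 A) -idla_linear.
by congr idla; apply/funext => B; rewrite addr0.
Qed.

Lemma idlaD p p' A : idla (fun B => p B + p' B) A = idla p A + idla p' A.
Proof.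
rewrite -[idla p A]mul1r -idla_linear.
by congr idla; apply/funext => B; rewrite mul1r.
Qed.

Lemma idlaB p p' A : idla (fun B => p B - p' B) A = idla p A - idla p' A.
Proof.
rewrite -[- _]mulN1r addrC -idla_linear.
by congr idla; apply/funext => B; rewrite mulN1r addrC.
Qed.

Lemma idla_sum (J : finType) (F : J -> {set V} -> R) A :
  idla (fun B => \sum_j F j B) A = \sum_j idla (F j) A.
Proof.
rewrite /idla exchange_big /=; apply: eq_bigr => x _.
rewrite -mulr_sumr; congr (_ * _).
under [RHS]eq_bigr do rewrite -[release _ _ _]mul1r.
rewrite -(release_linear walkK); congr release.
by apply/funext => B; apply: eq_bigr => j _; rewrite mul1r.
Qed.

Lemma idla_full p : idla p full = p full.
Proof.
rewrite /idla; under eq_bigr do rewrite (releaseT walkK).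
by rewrite -mulr_suml nu_sum mul1r.
Qed.

Lemma release_idla p A x :
  release (idla p) A x = idla (fun B => release p B x) A.
Proof.
rewrite /idla (release_linear walkK); apply: eq_bigr => y _.
by rewrite (releaseC walkK).
Qed.

Lemma idla_iter_le p p' t : (forall A, p A <= p' A) ->
  forall A, iter t idla p A <= iter t idla p' A.
Proof. by move=> pp; elim: t => [//|t IH] A; rewrite !iterS; exact: idla_homo. Qed.

Lemma survival_ge0 t A : 0 <= survival t A.
Proof.
have e0 : iter t idla (fun=> 0) A = 0.
  by elim: t A => [//|t IH] A; rewrite iterS (_ : iter _ _ _ = fun=> 0) ?idla_cst//;
    apply/funext => B.
by rewrite -e0; apply: idla_iter_le => B.
Qed.

Lemma survival_le1 t A : survival t A <= 1.
Proof.
have e1 : iter t idla (fun=> 1) A = 1.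
  by elim: t A => [//|t IH] A; rewrite iterS (_ : iter _ _ _ = fun=> 1) ?idla_cst//;
    apply/funext => B.
by rewrite -e1; apply: idla_iter_le => B; rewrite /unfilled; case: eqP.
Qed.

Lemma survivalS t A : survival t.+1 A = idla (survival t) A.
Proof. by []. Qed.

Lemma unfilled_release_le x A : release unfilled A x <= unfilled A.
Proof.
rewrite /unfilled; case: eqP => [->|_]; first by rewrite (releaseT walkK) eqxx.
apply: (dirichlet_le walkK (f := fun=> 1)) => y _ /=; first by case: eqP.
by rewrite -[leRHS](sumK_const K y) lerD2l ler_wpM2l ?(kill_ge0 walkK)//; case: eqP.
Qed.

(** The extra particle commutes with the t random ones, so it may be released last, where it cannot
    turn a filled set into an unfilled one. *)
Lemma survival_release_le t x A : release (survival t) A x <= survival t A.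
Proof.
elim: t A => [|t IH] A; first exact: unfilled_release_le.
by rewrite survivalS release_idla; apply: idla_homo => B; exact: IH.
Qed.

Lemma survival_decr t A : survival t.+1 A <= survival t A.
Proof.
rewrite survivalS -[leRHS]mul1r -nu_sum mulr_suml.
by apply: ler_sum => x _; apply: ler_wpM2l => //; exact: survival_release_le.
Qed.

Lemma survival_add s t A : survival (t + s) A <= survival t A.
Proof.
elim: s => [|s IH]; first by rewrite addn0.
by rewrite addnS; apply: le_trans IH; exact: survival_decr.
Qed.

Lemma survival_eq1 t A : (#|A| + t < #|V|)%N -> survival t A = 1.
Proof.
move=> At; apply/eqP; rewrite eq_le survival_le1 /=; move: A At.
elim: t => [|t IH] A At.
  rewrite /survival /unfilled /=; case: eqP => // Ae.
  by move: At; rewrite Ae cardsT addn0 ltnn.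
rewrite survivalS -[leLHS](idla_cst 1 A); apply: idla_le; first by apply: IH; lia.
by move=> s sA; apply: IH; rewrite cardsU1 sA; lia.
Qed.

(* The probability that a K-walk hits z. *)
Definition hit z : V -> R := dirichlet K (finset.setC (finset.set1 z)) (fun=> 1) (fun=> 0).

Definition mean_hit z : R := \sum_x nu x * hit z x.

Lemma hit_self z : hit z z = 1.
Proof. by rewrite /hit (dirichlet_out walkK)// !inE eqxx. Qed.

Lemma hit_neq z x : x != z -> hit z x = \sum_y K x y * hit z y.
Proof.
by move=> xz; rewrite {1}/hit (dirichlet_in walkK) ?addr0// !inE.
Qed.

Lemma hit_ge0 z x : 0 <= hit z x.
Proof.
apply: (le_dirichlet walkK (f := fun=> 0)) => // y _.
by rewrite addr0 big1// => u _; rewrite mulr0.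
Qed.

Lemma hit_le1 z x : hit z x <= 1.
Proof.
apply: (dirichlet_le walkK (f := fun=> 1)) => // y _.
by rewrite addr0 -mulr_suml mulr1; case: walkK.
Qed.

Lemma mean_hit_ge0 z : 0 <= mean_hit z.
Proof. by apply: sumr_ge0 => x _; rewrite mulr_ge0// hit_ge0. Qed.

Lemma mean_hit_le1 z : mean_hit z <= 1.
Proof.
rewrite -nu_sum; apply: ler_sum => x _; rewrite -[leRHS]mulr1.
by apply: ler_wpM2l => //; exact: hit_le1.
Qed.

Definition avoid theta z A : R := (z \notin A)%:R * \prod_(y in A) (1 - theta * hit z y).

(* A particle settling at s multiplies [avoid theta z] by [1 - theta * hit K z s],
   and a walk that hits z has to settle, at z at the latest. *)
Lemma avoid_idla theta z A : 0 <= theta <= 1 ->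
  idla (avoid theta z) A <= (1 - theta * mean_hit z) * avoid theta z A.
Proof.
move=> /andP[t0 t1].
have f0 y : 0 <= 1 - theta * hit z y.
  by rewrite subr_ge0 mulr_ile1// ?hit_ge0 ?hit_le1.
have av0 B : 0 <= avoid theta z B by rewrite mulr_ge0// prodr_ge0.
have [zA|zA] := boolP (z \in A).
  have a0 B : z \in B -> avoid theta z B = 0 by rewrite /avoid => ->; rewrite mul0r.
  rewrite a0// mulr0 -[leRHS](idla_cst 0 A); apply: idla_le; first by rewrite a0.
  by move=> s _; rewrite a0// !inE zA orbT.
have -> : (1 - theta * mean_hit z) * avoid theta z A =
    \sum_x nu x * (avoid theta z A * (1 - theta * hit z x)).
  rewrite /mean_hit -[X in X - _]nu_sum mulr_sumr -sumrB mulr_suml.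
  by apply: eq_bigr => x _; ring.
apply: ler_sum => x _; apply: ler_wpM2l => //; move: x.
apply: (dirichlet_le walkK) => x xA.
  rewrite /avoid zA mul1r !inE (negPf zA) orbF.
  have [_|_] := eqVneq z x; rewrite /=.
    by rewrite mul0r mulr_ge0 ?prodr_ge0.
  by rewrite mul1r big_setU1//= mulrC.
have xz : x != z by apply: contraNneq zA => <-.
rewrite (hit_neq xz) /kill.
rewrite (eq_bigr (fun y => avoid theta z A * K x y - avoid theta z A * theta * (K x y * hit z y))).
  by rewrite sumrB -!mulr_sumr; set a := avoid _ _ _; rewrite le_eqVlt; apply/orP; left; apply/eqP; ring.
by move=> y _; ring.
Qed.

(** A union bound over the vacant sites z. When z is vacant, [avoid theta z] is at least the product
    over all of V, which is positive since theta < 1; dividing by it gives a majorant of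
    [unfilled]. *)
Lemma survival_le_sum theta t : 0 <= theta < 1 -> survival t finset.set0 <=
  \sum_z (\prod_y (1 - theta * hit z y))^-1 * (1 - theta * mean_hit z) ^+ t.
Proof.
move=> /andP[t0 t1].
have f0 z y : 0 < 1 - theta * hit z y.
  rewrite subr_gt0; apply: le_lt_trans t1; rewrite -[leRHS]mulr1.
  by apply: ler_wpM2l => //; exact: hit_le1.
have f1 z y : 1 - theta * hit z y <= 1.
  by rewrite gerBl mulr_ge0// hit_ge0.
have P0 z : 0 < \prod_y (1 - theta * hit z y) by apply: prodr_gt0.
have av0 z B : 0 <= avoid theta z B.
  by rewrite /avoid mulr_ge0// prodr_ge0// => y _; exact: ltW.
pose Phi (A : {set V}) := \sum_z (\prod_y (1 - theta * hit z y))^-1 * avoid theta z A.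
have le0 A : unfilled A <= Phi A.
  rewrite /unfilled; case: eqP => [_|/eqP].
    by apply: sumr_ge0 => z _; rewrite mulr_ge0 ?invr_ge0// ltW.
  rewrite -finset.subTset => /subsetPn[z _ zA].
  rewrite /Phi (bigD1 z)//= -[leLHS]addr0 lerD//; last first.
    by apply: sumr_ge0 => u _; rewrite mulr_ge0 ?invr_ge0// ltW.
  rewrite ler_pdivlMl// mulr1 /avoid zA mul1r.
  rewrite [leLHS](bigID (mem A))/=.
  rewrite -[leRHS]mulr1; apply: ler_pM; rewrite ?prodr_ge0//.
  - by move=> y _; exact: ltW.
  - by move=> y _; exact: ltW.
  by apply: prodr_ile1 => y; rewrite f1 ltW.
have main A : survival t A <= \sum_z (\prod_y (1 - theta * hit z y))^-1 *
    ((1 - theta * mean_hit z) ^+ t * avoid theta z A).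
  elim: t A => [|t IH] A.
    by apply: le_trans (le0 A) _; apply: ler_sum => z _; rewrite expr0 mul1r.
  rewrite survivalS; apply: le_trans (idla_homo IH A) _.
  rewrite idla_sum; apply: ler_sum => z _.
  rewrite idlaZ idlaZ exprSr -mulrA; apply: ler_wpM2l.
    by rewrite invr_ge0 ltW.
  apply: ler_wpM2l; last by apply: avoid_idla; rewrite t0 ltW.
  rewrite exprn_ge0// subr_ge0; apply: mulr_ile1 => //.
  - exact: mean_hit_ge0.
  - exact: ltW.
  - exact: mean_hit_le1.
apply: le_trans (main _) _; apply: ler_sum => z _; apply: ler_wpM2l.
  by rewrite invr_ge0 ltW.
by rewrite /avoid inE big_set0 !mulr1.
Qed.

End IDLAChain.

(** * Mean and fluctuations of the filling time *)

Section FillingTime.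
Context {R : realType} {V : finType} (K : V -> V -> R) (r : V -> nat).
Context (nu : V -> R) (c : R).
Hypothesis walkK : killed_walk K r.
Hypothesis nu_ge0 : forall x, 0 <= nu x.
Hypothesis nu_sum : \sum_x nu x = 1.
Hypothesis c_gt0 : 0 < c.
Hypothesis c_le : forall z, c <= mean_hit K nu z.
Implicit Types (A B : {set V}) (x y z : V) (p : {set V} -> R) (t : nat).

Local Notation full := (finset.setTfor V).
Local Notation release := (release K).
Local Notation idla := (idla K nu).
Local Notation survival := (survival K nu).
Local Notation unfilled := (@unfilled R V).

(** The function [1 - hit K z] is harmonic off z when a killed walk is given the value 1, so it
    dominates the released walk on A. *)
Lemma idla_avoid_le p A z : z \notin A -> p A <= 1 ->
  (forall s, s \notin A -> p (s |: A) <= 1 - hit K z s) ->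
  idla p A <= 1 - mean_hit K nu z.
Proof.
move=> zA pA pS; rewrite /mean_hit -[X in X - _]nu_sum -sumrB; apply: ler_sum => x _.
rewrite -[X in X - _]mulr1 -mulrBr; apply: ler_wpM2l => //; move: x.
apply: (dirichlet_le walkK) => x xA.
  exact: pS.
have xz : x != z by apply: contraNneq zA => <-.
under eq_bigr do rewrite mulrBr mulr1.
rewrite sumrB (hit_neq walkK xz).
have := ler_wpM2l (kill_ge0 walkK x) pA; rewrite /kill; lra.
Qed.

(** Induction on the number of vacant sites. A step leaves A unchanged with probability at most 1 -
    c < 1, so p cannot be negative at A when it is nonnegative on the larger sets. *)
Lemma idla_superharmonic_ge0 p : (forall A, A != full -> idla p A <= p A) ->
  0 <= p full -> forall A, 0 <= p A.
Proof.
move=> pA p1 A; move: {2}#|~: A|.+1 (ltnSn #|~: A|) => m.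
elim: m A => [//|m IH] A Am.
have [-> //|An] := eqVneq A full.
have : ~~ (full \subset A) by rewrite finset.subTset.
move=> /subsetPn[z _ zA]; rewrite leNgt; apply/negP => pneg.
have : p A * idla (fun B => (B == A)%:R) A <= p A.
  apply: le_trans _ (pA _ An); rewrite -(idlaZ walkK nu_sum); apply: (idla_le walkK nu_ge0).
    by rewrite eqxx mulr1.
  move=> s sA; have -> : (s |: A == A) = false.
    by apply/eqP => e; rewrite -e !inE eqxx in sA.
  rewrite mulr0; apply: IH; have := finset.cardsC A.
  by have := finset.cardsC (s |: A); rewrite cardsU1 sA; lia.
rewrite -[leRHS]mulr1 ler_nM2l// leNgt => /negP[].
apply: (@le_lt_trans _ _ (1 - mean_hit K nu z)).
  apply: idla_avoid_le => //; first by rewrite eqxx.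
  move=> s sA; have -> : (s |: A == A) = false.
    by apply/eqP => e; rewrite -e !inE eqxx in sA.
  by rewrite subr_ge0 (hit_le1 walkK).
by rewrite gtrBl; apply: lt_le_trans (c_le z).
Qed.

Lemma mean_filling_time : exists2 U, U full = 0 &
  forall A, U A = unfilled A + idla U A.
Proof.
pose T p A := if A == full then p A else p A - idla p A.
have [||U _ UE] := @injective_surjective _ _ (enum {set V}) T _ _ unfilled.
- by move=> a f g A; rewrite /T; case: ifP => // _; rewrite (idla_linear nu walkK); ring.
- have ge f : (forall A, T f A = 0) -> forall A, 0 <= f A.
    move=> Tf; apply: idla_superharmonic_ge0.
      move=> A An; have := Tf A; rewrite /T (negPf An) => /eqP.
      by rewrite subr_eq0 => /eqP <-.
    by have := Tf full; rewrite /T eqxx => ->.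
  move=> f _ Tf A _; have Tf0 B : T f B = 0 by rewrite Tf// mem_enum.
  apply/eqP; rewrite eq_le ge// andbT -oppr_ge0.
  apply: (ge (fun A => - f A)) => B; have := Tf0 B; rewrite /T.
  case: ifP => _; first by move=> ->; rewrite oppr0.
  have -> : (fun A => - f A) = (fun A => -1 * f A).
    by apply/funext => u; rewrite mulN1r.
  by rewrite (idlaZ walkK nu_sum) => /eqP; rewrite subr_eq0 => /eqP <-; ring.
exists U; first by have := UE full (mem_enum _ full); rewrite /T /unfilled eqxx.
move=> A; have := UE A (mem_enum _ A); rewrite /T.
case: eqP => [->|_ <-]; last by rewrite subrK.
by rewrite /unfilled eqxx (idla_full walkK nu_sum) add0r.
Qed.

Section Concentration.
Variable U : {set V} -> R.
Hypothesis UT : U full = 0.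
Hypothesis UE : forall A, U A = unfilled A + idla U A.

(** With two vacant sites, one particle cannot fill V and the left-hand side is not positive. With a
    single vacant site z, it is at most 1, while a random particle fills z with probability at least
    c. *)
Lemma unfilled_sub_release y A :
  unfilled A - release unfilled A y <= c^-1 * (unfilled A - idla unfilled A).
Proof.
have c0 : 0 <= c^-1 by rewrite invr_ge0 ltW.
have [->|An] := eqVneq A full.
  by rewrite (releaseT walkK) (idla_full walkK nu_sum) !subrr mulr0.
have : ~~ (full \subset A) by rewrite finset.subTset.
move=> /subsetPn[z _ zA].
have gA : unfilled A = 1 by rewrite /unfilled An.
have fullE s : s \notin A -> (s |: A == full) = (#|V| <= #|A|.+1)%N.
  by move=> sA; rewrite finset.eqEcard finset.subsetT cardsT cardsU1 sA.
have [Az|Az] := leqP #|V| #|A|.+1.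
  apply: (@le_trans _ _ 1).
    by rewrite gA gerBl; apply: release_ge walkK _ _ _ _ _ _ => //; rewrite ler0n.
  rewrite -(mulVf (lt0r_neq0 c_gt0)); apply: ler_wpM2l => //.
  apply: le_trans (c_le z) _; rewrite gA -lerN2 -(lerD2l 1) opprB addrC subrK.
  apply: idla_avoid_le => //; first by rewrite gA.
  move=> s sA; rewrite /unfilled fullE// Az subr_ge0; exact: hit_le1 walkK _ _.
apply: (@le_trans _ _ 0); last first.
  apply: mulr_ge0 => //; rewrite subr_ge0 -[leRHS]mul1r -nu_sum mulr_suml.
  apply: ler_sum => x _; apply: ler_wpM2l => //; exact: unfilled_release_le walkK _ _.
rewrite subr_le0 gA; apply: release_ge walkK _ _ _ _ _ _; first by rewrite gA.
by move=> s sA; rewrite /unfilled fullE// leqNgt Az.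
Qed.

(* Adding particles commutes with [idla], so that [U - release U _ y] solves the
   equation of [U] with source [unfilled - release unfilled _ y], which is
   supported by the sets that miss a single site. *)
Lemma filling_drop y A : 0 <= U A - release U A y <= c^-1 * unfilled A.
Proof.
pose D A := U A - release U A y.
have DE B : D B = (unfilled B - release unfilled B y) + idla D B.
  rewrite /D {1}UE (idlaB nu walkK) -(release_idla nu walkK).
  have -> : release U B y = release unfilled B y + release (idla U) B y.
    rewrite -[release unfilled B y]mul1r -(release_linear2 walkK).
    by congr release; apply/funext => E; rewrite mul1r.
  by ring.
have DT : D full = 0 by rewrite /D (releaseT walkK) subrr.
apply/andP; split; rewrite -/(D A).
  apply: idla_superharmonic_ge0; last by rewrite DT.
  by move=> B _; rewrite [leRHS]DE lerDr subr_ge0 (unfilled_release_le walkK).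
rewrite -subr_ge0.
apply: (idla_superharmonic_ge0 (p := fun A => c^-1 * unfilled A - D A)).
  move=> B _; rewrite (idlaB nu walkK) (idlaZ walkK nu_sum) [D B]DE.
  by have := unfilled_sub_release y B; lra.
by rewrite DT /unfilled eqxx mulr0 subr0.
Qed.

Lemma filling_time_ge0 A : 0 <= U A.
Proof.
apply: idla_superharmonic_ge0; last by rewrite UT.
by move=> B _; rewrite [leRHS]UE lerDr ler0n.
Qed.

Lemma filling_drop1 s A : s \notin A -> 0 <= U A - U (s |: A) <= c^-1.
Proof.
move=> sA; have := filling_drop s A; rewrite (release_out walkK)//.
move=> /andP[-> /le_trans]; apply; rewrite -[leRHS]mulr1; apply: ler_wpM2l.
  by rewrite invr_ge0 ltW.
by rewrite /unfilled; case: eqP.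
Qed.

(* (s + U(A) - a)^2 + U(A) / c dominates the conditional expectation given A
   at time s of (T - a)^2, with T the filling time: the decrease D of U in one
   step lies in [0, 1/c] and has mean 1, so that its variance is at most 1/c. *)
Definition lyapunov (a s : R) A := (s + U A - a) ^+ 2 + c^-1 * U A.

Lemma lyapunov_ge0 a s A : 0 <= lyapunov a s A.
Proof. by rewrite addr_ge0 ?sqr_ge0 ?mulr_ge0 ?filling_time_ge0 ?invr_ge0// ltW. Qed.

Lemma lyapunov_idla a s A : A != full ->
  idla (lyapunov a (s + 1)) A <= lyapunov a s A.
Proof.
move=> An; pose D B := U A - U B.
have QU : idla U A = U A - 1 by have := UE A; rewrite /unfilled An /=; lra.
set b := s + U A - a.
(* A decrease D in [0, 1/c] satisfies D^2 <= D / c; the square becomes affine in D and U, whose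
   means are known. *)
apply: (@le_trans _ _ (idla (fun B => (c^-1 + (- 2 * (b + 1))) * D B +
    ((b + 1) ^+ 2 + c^-1 * U B)) A)).
  apply: (idla_le walkK nu_ge0) => [|t tA]; rewrite /lyapunov.
    have -> : s + 1 + U A - a = b + 1 by rewrite /b; ring.
    by rewrite /D subrr mulr0 add0r.
  have /andP[D0 D1] := filling_drop1 tA; rewrite -/(D _) in D0 D1.
  have -> : s + 1 + U (t |: A) - a = b + 1 - D (t |: A) by rewrite /b /D; ring.
  have := ler_wpM2l D0 D1; set d := D _; rewrite -/d; nra.
rewrite (idla_linear nu walkK) /D (idlaB nu walkK) (idlaD nu walkK).
rewrite !(idla_cst walkK nu_sum) (idlaZ walkK nu_sum) QU /lyapunov -/b; lra.
Qed.

(** Chebyshev's inequality: if V is unfilled at time t then t + U - a >= t - a > 0, whereas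
    [lyapunov] starts from U / c because a is the mean. *)
Lemma survival_upper t : (U finset.set0 < t%:R) ->
  survival t finset.set0 <= c^-1 * U finset.set0 / (t%:R - U finset.set0) ^+ 2.
Proof.
set a := U finset.set0 => at_.
have ta : 0 < (t%:R - a) ^+ 2 by rewrite exprn_gt0// subr_gt0.
rewrite ler_pdivlMr// mulrC.
have : forall j A, (j <= t)%N -> (t%:R - a) ^+ 2 * survival j A <=
    unfilled A * lyapunov a (t - j)%N%:R A.
  elim=> [|j IH] A jt.
    rewrite subn0 /survival /= mulrC; apply: ler_wpM2l => //.
    rewrite /lyapunov -[leLHS]addr0; apply: lerD; last first.
      by rewrite mulr_ge0 ?filling_time_ge0// invr_ge0 ltW.
    have U0 := filling_time_ge0 A; have ta1 := ltW at_.
    by rewrite ler_sqr ?nnegrE; lra.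
  rewrite survivalS -(idlaZ walkK nu_sum).
  apply: le_trans (idla_homo walkK nu_ge0 (fun B => IH B (ltnW jt)) A) _.
  have [->|An] := eqVneq A full.
    by rewrite (idla_full walkK nu_sum) /unfilled eqxx !mul0r.
  have -> : unfilled A = 1 by rewrite /unfilled An.
  rewrite mul1r.
  apply: le_trans (lyapunov_idla _ _ An).
  apply: (idla_homo walkK nu_ge0) => B.
  have -> : (t - j.+1)%N%:R + 1 = (t - j)%N%:R :> R.
    by rewrite natr1; congr (_%:R); lia.
  by rewrite /unfilled; case: eqP; rewrite ?mul0r ?mul1r// lyapunov_ge0.
move=> /(_ t finset.set0 (leqnn t)) /le_trans; apply.
rewrite subnn /lyapunov -/a add0r subrr expr0n /= add0r.
rewrite -[leRHS]mul1r; apply: ler_wpM2r; first last.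
  by rewrite /unfilled; case: eqP.
by rewrite mulr_ge0 ?filling_time_ge0// invr_ge0 ltW.
Qed.

Lemma survival_lower t : (0 < #|V|)%N -> (t%:R < U finset.set0) ->
  1 - survival t finset.set0 <= c^-1 * U finset.set0 / (U finset.set0 - t%:R) ^+ 2.
Proof.
move=> V0; set a := U finset.set0 => ta.
have ta2 : 0 < (a - t%:R) ^+ 2 by rewrite exprn_gt0// subr_gt0.
rewrite ler_pdivlMr// mulrC.
(* The full set is absorbing, but [lyapunov] still varies with s there. It is frozen at (a - t)^2,
   which it dominates as long as s <= t < a. *)
pose W s A := if A == full then (a - t%:R) ^+ 2 else lyapunov a s A.
have : forall j A, (j <= t)%N -> (a - t%:R) ^+ 2 * (1 - survival j A) <=
    W (t - j)%N%:R A.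
  elim=> [|j IH] A jt.
    rewrite /W /survival /unfilled /=; case: eqP => _ /=.
      by rewrite subr0 mulr1.
    by rewrite subrr mulr0 lyapunov_ge0.
  have -> : (a - t%:R) ^+ 2 * (1 - survival j.+1 A) =
      idla (fun B => (a - t%:R) ^+ 2 * (1 - survival j B)) A.
    by rewrite (idlaZ walkK nu_sum) (idlaB nu walkK) (idla_cst walkK nu_sum).
  apply: le_trans (idla_homo walkK nu_ge0 (fun B => IH B (ltnW jt)) A) _.
  have [->|An] := eqVneq A full; first by rewrite (idla_full walkK nu_sum) /W eqxx.
  rewrite [leRHS]/W (negPf An); apply: le_trans (lyapunov_idla _ _ An).
  apply: (idla_homo walkK nu_ge0) => B.
  have -> : (t - j.+1)%N%:R + 1 = (t - j)%N%:R :> R.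
    by rewrite natr1; congr (_%:R); lia.
  rewrite /W; case: eqP => [->|//].
  rewrite /lyapunov UT addr0 mulr0 addr0 -[leRHS]sqrrN opprB.
  have tj : (t - j)%N%:R <= t%:R :> R by rewrite ler_nat leq_subr.
  by rewrite ler_sqr ?nnegrE; lra.
move=> /(_ t finset.set0 (leqnn t)) /le_trans; apply.
rewrite subnn /W; case: eqP => [e|_].
  by have := cardsT V; rewrite -e cards0 => V00; rewrite -V00 in V0.
by rewrite /lyapunov -/a add0r subrr expr0n /= add0r.
Qed.

End Concentration.
End FillingTime.

(** * Separation distance and filling time *)

Section ChainAndIDLA.
Context {R : realType} {V : finType} (K : V -> V -> R) (r : V -> nat).
Context (lambda : R) (nu : V -> R).
Hypothesis walkK : killed_walk K r.
Hypothesis lambda_gt0 : 0 < lambda.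
Hypothesis nu_ge0 : forall x, 0 <= nu x.
Hypothesis nu_sum : \sum_x nu x = 1.
Implicit Types (x y : V) (eta xi : config V) (zeta : stable_config V).
Implicit Types (G : config V -> R) (A : {set V}) (p : {set V} -> R).

Local Notation full := (finset.setTfor V).
Local Notation topple := (topple K lambda).
Local Notation release := (release K).
Local Notation idla := (idla K nu).
Local Notation survival := (survival K nu).
Local Notation stab := (fun zeta eta => stabilization_prob K lambda eta zeta).

Definition harmonic G := forall eta x, active x eta -> G eta = topple x G eta.

Lemma stab_harmonic zeta : harmonic (stab zeta).
Proof.
move=> eta x ax.
have [F hF Fst] := harmonic_extension walkK lambda_gt0 (particles eta)
  (fun z => (z == zeta)%:R).
have E e : (particles e <= particles eta)%N -> stabilization_prob K lambda e zeta = F e.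
  exact: stabilization_probE walkK lambda_gt0 _ _ _ _ hF Fst.
rewrite E// (hF _ _ (leqnn _) ax); apply: eq_topple => i; rewrite E//.
exact: particles_perform.
Qed.

Lemma stab_stable zeta zeta' : stab zeta (of_stable zeta') = (zeta' == zeta)%:R.
Proof.
have [F hF Fst] := harmonic_extension walkK lambda_gt0
  (particles (of_stable zeta')) (fun z => (z == zeta)%:R).
by rewrite (stabilization_probE walkK lambda_gt0 hF Fst)// Fst.
Qed.

Lemma stab_ge0 zeta eta : 0 <= stab zeta eta.
Proof.
apply: (superharmonic_ge0 walkK lambda_gt0 (D := predT) (N := particles eta)) => //.
move=> e _ _ neg; have [/stableP[z ez]|] := boolP (stable e).
  by move: neg; rewrite ez stab_stable ltNge ler0n.
rewrite negb_forall => /existsP[x]; rewrite negbK => ax; exists x => //.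
by split=> //; rewrite -stab_harmonic.
Qed.

Lemma eq_harmonic_stable G G' : harmonic G -> harmonic G' ->
  (forall zeta, G (of_stable zeta) = G' (of_stable zeta)) -> forall eta, G eta = G' eta.
Proof.
move=> hG hG' GG eta.
by apply: (eq_harmonic walkK lambda_gt0 (N := particles eta)) => // e x _; [exact: hG|exact: hG'].
Qed.

Lemma harmonic_sum (J : finType) (c : J -> R) (F : J -> config V -> R) :
  (forall j, harmonic (F j)) -> harmonic (fun eta => \sum_j c j * F j eta).
Proof.
move=> hF eta x ax; rewrite /topple.
under [RHS]eq_bigr do rewrite mulr_sumr.
rewrite exchange_big /=; apply: eq_bigr => j _; rewrite (hF j _ _ ax) mulr_sumr.
by apply: eq_bigr => i _; rewrite mulrCA.
Qed.

Lemma sum_stab G eta : harmonic G ->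
  \sum_zeta G (of_stable zeta) * stab zeta eta = G eta.
Proof.
move=> hG; move: eta; apply: eq_harmonic_stable => //.
  by apply: harmonic_sum => zeta; exact: stab_harmonic.
move=> zeta; rewrite (bigD1 zeta)//= stab_stable eqxx mulr1 big1 ?addr0// => z zz.
by rewrite stab_stable eq_sym (negPf zz) mulr0.
Qed.

Lemma harmonic_cst (a : R) : harmonic (fun=> a).
Proof.
move=> eta x _; rewrite /topple -mulr_suml.
by rewrite (weight_sum K lambda_gt0) mul1r.
Qed.

Lemma sum_stab1 eta : \sum_zeta stab zeta eta = 1.
Proof.
rewrite -[RHS](sum_stab eta (harmonic_cst 1)).
by apply: eq_bigr => z _; rewrite mul1r.
Qed.

Definition add_random G eta : R := \sum_x nu x * G (arrive x eta).

Lemma harmonic_add G : harmonic G -> harmonic (add_random G).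
Proof.
move=> hG; apply: harmonic_sum => y eta x ax.
by rewrite (hG _ _ (active_arrive y ax)) topple_arrive.
Qed.

Lemma harmonic_iter_add t G : harmonic G -> harmonic (iter t add_random G).
Proof. by move=> hG; elim: t => // t IH; exact: harmonic_add. Qed.

Local Notation P := (ARW_chain K lambda nu).

(** By harmonicity, the t particles may all be added before a single stabilization. *)
Lemma chain_pow t i j : (P ^+ t) i j =
  iter t add_random (stab (enum_val j)) (of_stable (enum_val i)).
Proof.
elim: t i => [|t IH] i.
  by rewrite expr0 !mxE /= stab_stable (inj_eq enum_val_inj).
rewrite exprS mxE iterS /add_random.
under eq_bigr do rewrite IH mxE.
set G := iter t _ _; rewrite /ARW_kernel.
have hG : harmonic G by apply: harmonic_iter_add; exact: stab_harmonic.
under eq_bigr do rewrite mulr_suml.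
rewrite exchange_big /=; apply: eq_bigr => x _.
rewrite -[in RHS](sum_stab _ hG) mulr_sumr.
rewrite [RHS](reindex (@enum_val _ {: stable_config V})) /=; last first.
  exact: onW_bij (enum_val_bij _).
by apply: eq_bigr => k _; rewrite -mulrA [G _ * _]mulrC.
Qed.

(* A site with at least two particles never falls asleep. *)
Lemma harmonic_crowded G eta x k : harmonic G -> eta x = Some k.+2 ->
  G eta = \sum_y K x y * G (arrive y (depart x eta)) + kill K x * G (depart x eta).
Proof.
move=> hG ex; have ax : active x eta by rewrite /active /nb_active ex.
have := hG _ _ ax; rewrite toppleE.
have -> : doze x eta = eta by rewrite /doze ex.
have l0 := lambda1_gt0 lambda_gt0; rewrite /kill.
set S := \sum_y K x y * _; set k1 := \sum_y _.
move/(congr1 (fun u => (1 + lambda) * u)); rewrite mulrA mulfV ?gt_eqF// mul1r.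
lra.
Qed.

Definition occupied A : config V := [ffun x => Some (x \in A : nat)].

Lemma depart_arrive_awake x eta : eta x != None -> depart x (arrive x eta) = eta.
Proof.
move=> ex; rewrite /depart /arrive set_siteE set_siteK.
by move: ex; case E: (eta x) => [k|//] _ /=; rewrite -E set_site_id.
Qed.

(** Only a site with two particles is toppled. It cannot fall asleep, so the extra particle performs
    a K-walk until it finds an empty site, and the others stay awake. *)
Lemma release_occupied G p : harmonic G -> (forall A, G (occupied A) = p A) ->
  forall A x, G (arrive x (occupied A)) = release p A x.
Proof.
move=> hG Gp A; apply: (dirichlet_unique walkK) => x xA.
  rewrite -Gp; congr G; apply/ffunP => y; rewrite !ffunE !inE.
  by have [->|] := eqVneq y x; rewrite ?(negPf xA).
rewrite (harmonic_crowded (x := x) (k := 0) hG); last by rewrite !ffunE eqxx xA.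
by rewrite depart_arrive_awake ?ffunE// Gp.
Qed.

Lemma idla_occupied G p : harmonic G -> (forall A, G (occupied A) = p A) ->
  forall A, add_random G (occupied A) = idla p A.
Proof. by move=> hG Gp A; apply: eq_bigr => x _; rewrite (release_occupied hG Gp). Qed.

Definition stationary zeta := stab zeta (occupied full).

Lemma stationary_sum : \sum_zeta stationary zeta = 1.
Proof. exact: sum_stab1. Qed.

Lemma add_random_full G : harmonic G -> add_random G (occupied full) = G (occupied full).
Proof.
move=> hG; rewrite (idla_occupied hG (fun A => erefl (G (occupied A)))).
by rewrite (idla_full walkK nu_sum).
Qed.

Definition all_asleep : stable_config V := [ffun=> true].

Lemma chain_from_empty t A : iter t add_random (stab all_asleep) (occupied A) =
  (1 - survival t A) * stationary all_asleep.
Proof.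
elim: t A => [|t IH] A.
  rewrite /= /survival /unfilled /=; have [->|An] := eqVneq A full.
    by rewrite subr0 mul1r.
  rewrite subrr mul0r.
  (* With at most #|A| < #|V| particles, no stable configuration within the bound is [all_asleep],
     and the null function has the required values. *)
  apply: (stabilization_probE (F := fun=> 0) walkK lambda_gt0 (N := #|A|)).
  - by move=> eta x _ _; rewrite /topple big1// => i _; rewrite mulr0.
  - move=> z; rewrite particles_of_stable; case: eqP => [->|//].
    rewrite [X in (X <= _)%N](_ : _ = #|V|); last first.
      by apply: eq_card => x; rewrite !inE ffunE.
    move=> VA; case/eqP: An; apply/eqP; rewrite finset.eqEcard finset.subsetT.
    by rewrite cardsT.
  - rewrite /particles -sum1_card [leqRHS]big_mkcond; apply: leq_sum => x _.
    by rewrite /nb_particles ffunE /=; case: (x \in A).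
rewrite iterS (idla_occupied (harmonic_iter_add t (@stab_harmonic _)) IH).
have -> : (fun A => (1 - survival t A) * stationary all_asleep) =
    (fun A => stationary all_asleep * (1 - survival t A)).
  by apply/funext => B; rewrite mulrC.
rewrite (idlaZ walkK nu_sum) (idlaB nu walkK) (idla_cst walkK nu_sum).
by rewrite mulrC survivalS.
Qed.

Definition compatible A xi := forall x,
  if x \in A then xi x = Some 1 else xi x = None \/ xi x = Some 0.

(* Sleeping particles are treated as absent by the IDLA: if the walk reaches such
   a particle, one of the two settles there and the other one is released. *)
Lemma release_le_harmonic G p : harmonic G ->
  (forall A xi, compatible A xi -> p A <= G xi) ->
  (forall A y, p A <= release p A y) ->
  forall A xi x, compatible A xi -> release p A x <= G (arrive x xi).
Proof.
move=> hG pG pr A; move: {2}#|~: A|.+1 (ltnSn #|~: A|) => m.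
elim: m A => [//|m IH] A Am xi x cA; move: x.
apply: (dirichlet_le walkK) => x xA; last first.
  have ex := cA x; rewrite xA in ex.
  rewrite [leRHS](harmonic_crowded (x := x) (k := 0) hG); last first.
    by rewrite !ffunE eqxx ex.
  rewrite depart_arrive_awake ?ex// lerD2l; apply: ler_wpM2l; last exact: pG.
  exact: kill_ge0 walkK _.
pose xi' := set_site xi x (Some 1%N).
have cA' : compatible (x |: A) xi'.
  move=> y; rewrite /xi' ffunE !inE; have [//|yx] := eqVneq y x; exact: cA.
have := cA x; rewrite (negPf xA) => -[ex|ex].
  have -> : arrive x xi = arrive x xi'.
    by rewrite /arrive /xi' ex set_siteE set_siteK.
  apply: le_trans (pr _ x) _; apply: IH => //.
  have := finset.cardsC A; have := finset.cardsC (x |: A).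
  by rewrite cardsU1 xA; lia.
by rewrite /arrive ex; exact: pG.
Qed.

(** Only an inequality, since a sleeping particle met outside A yields an additional release. It is
    used with A empty, with which every stable state is compatible. *)
Lemma chain_ge t A xi zeta : compatible A xi ->
  (1 - survival t A) * stationary zeta <= iter t add_random (stab zeta) xi.
Proof.
have s0 z : 0 <= stationary z by exact: stab_ge0.
elim: t A xi => [|t IH] A xi cA.
  rewrite /= /survival /unfilled /=; case: eqP cA => [->|_] cA.
    rewrite subr0 mul1r (_ : xi = occupied full)//.
    by apply/ffunP => x; have := cA x; rewrite !ffunE !inE.
  by rewrite subrr mul0r; exact: stab_ge0.
rewrite iterS.
pose p B := stationary zeta * (1 - survival t B).
have -> : (1 - survival t.+1 A) * stationary zeta = idla p A.
  rewrite (idlaZ walkK nu_sum) (idlaB nu walkK) (idla_cst walkK nu_sum).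
  by rewrite mulrC survivalS.
apply: ler_sum => x _; apply: ler_wpM2l => //.
apply: release_le_harmonic => //.
- exact/harmonic_iter_add/stab_harmonic.
- by move=> B xi' cB; rewrite /p mulrC; exact: IH.
move=> B y; have -> : p = (fun B => (- stationary zeta) * survival t B + stationary zeta).
  by apply/funext => E; rewrite /p; ring.
rewrite (release_linear2 walkK).
have -> : release (fun=> stationary zeta) B y = stationary zeta.
  apply/esym; move: y; apply: (dirichlet_unique walkK (f := fun=> stationary zeta)) => // y _.
  by rewrite sumK_const.
rewrite lerD2r !mulNr lerN2; apply: ler_wpM2l => //.
exact: survival_release_le walkK nu_ge0 _ _ _.
Qed.

(** The added particle can be led out along decreasing r. As no particle of xi sleeps, its passage
    leaves xi unchanged. *)
Lemma positive_arrive G xi y : harmonic G -> (forall eta, 0 <= G eta) ->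
  (forall x, xi x != None) -> 0 < G xi -> 0 < G (arrive y xi).
Proof.
move=> hG G0 xiN Gxi; have [K0 K1 Kr] := walkK.
have l1 := lambda1_gt0 lambda_gt0.
move: {2}(r y).+1 (ltnSn (r y)) => m; elim: m y => [//|m IH] y ym.
have ay : active y (arrive y xi).
  by rewrite /active /nb_active ffunE eqxx; case: (xi y).
rewrite (hG _ _ ay) toppleE mulr_gt0 ?invr_gt0// depart_arrive_awake//.
have [ky|[z Kz rz]] := Kr y.
  rewrite ltr_pwDl//; last by apply: sumr_ge0 => z _; rewrite mulr_ge0.
  apply: ltr_wpDl; first by rewrite mulr_ge0// ltW.
  by rewrite mulr_gt0// subr_gt0.
apply: ltr_wpDl.
  by apply: addr_ge0; apply: mulr_ge0 => //; [exact: ltW|rewrite subr_ge0].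
rewrite (bigD1 z)//= ltr_pwDl//; last by apply: sumr_ge0 => u _; rewrite mulr_ge0.
by rewrite mulr_gt0// IH//; apply: leq_trans rz _.
Qed.

(** From one active particle everywhere, those outside the support of zeta are walked out one by
    one; the remaining ones then fall asleep in turn, [mixed S] being the stage where S is still
    awake. *)
Lemma stationary_gt0 zeta : 0 < stationary zeta.
Proof.
have l1 := lambda1_gt0 lambda_gt0.
have [K0 K1 _] := walkK.
have G0 := @stab_ge0 zeta; have hG := @stab_harmonic zeta.
pose Z : {set V} := finset (fun x => zeta x).
pose mixed (S : {set V}) : config V :=
  [ffun x => if x \in S then Some 1%N else if zeta x then None else Some 0%N].
have mixed_gt0 (S : {set V}) : S \subset Z -> 0 < stab zeta (mixed S).
  move: {2}#|S|.+1 (ltnSn #|S|) => m; elim: m S => [//|m IH] S Sm SZ.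
  have [->|[x xS]] := set_0Vmem S.
    have -> : mixed finset.set0 = of_stable zeta.
      by apply/ffunP => x; rewrite !ffunE inE.
    by rewrite stab_stable eqxx.
  have ax : active x (mixed S) by rewrite /active /nb_active ffunE xS.
  rewrite (hG _ _ ax) toppleE mulr_gt0 ?invr_gt0//.
  have -> : doze x (mixed S) = mixed (S :\ x).
    rewrite /doze ffunE xS eqxx; apply/ffunP => y; rewrite !ffunE !inE.
    have [->|//] := eqVneq y x; rewrite /=.
    by move: (fintype.subsetP SZ _ xS); rewrite inE => ->.
  rewrite ltr_pwDl//; last by apply: sumr_ge0 => z _; rewrite mulr_ge0.
  rewrite ltr_pwDl//; last by rewrite mulr_ge0// subr_ge0.
  rewrite mulr_gt0// IH//; last by apply: fintype.subset_trans SZ; exact: finset.subsetDl.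
  by rewrite (cardsD1 x) xS add1n ltnS in Sm.
have occ_gt0 A : Z \subset A -> 0 < stab zeta (occupied A).
  move: {2}#|A|.+1 (ltnSn #|A|) => m; elim: m A => [//|m IH] A Am ZA.
  have [AZ|/subsetPn[x xA xZ]] := boolP (A \subset Z).
    have -> : occupied A = mixed Z.
      have -> : A = Z by apply/eqP; rewrite finset.eqEsubset AZ ZA.
      by apply/ffunP => x; rewrite !ffunE !inE; case: (zeta x).
    exact: mixed_gt0.
  have -> : occupied A = arrive x (occupied (A :\ x)).
    apply/ffunP => y; rewrite !ffunE !inE eqxx /=.
    by have [->|//] := eqVneq y x; rewrite xA.
  apply: (positive_arrive x hG G0); first by move=> y; rewrite ffunE.
  apply: IH; first by rewrite (cardsD1 x) xA add1n ltnS in Am.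
  by rewrite finset.subsetD1 ZA.
exact/occ_gt0/finset.subsetT.
Qed.

End ChainAndIDLA.

Lemma sum_enum_val (R : nmodType) (T : finType) (F : T -> R) :
  \sum_(j < #|T|) F (enum_val j) = \sum_u F u.
Proof.
by rewrite [RHS](reindex (@enum_val _ T)) //=; exact: onW_bij (enum_val_bij _).
Qed.

(** * Invariant law, separation and eigenvalues of the chain *)

Section ChainSeparation.
Context {R : realType} {V : finType} (K : V -> V -> R) (r : V -> nat).
Context (lambda : R) (nu : V -> R) (c : R).
Hypothesis walkK : killed_walk K r.
Hypothesis lambda_gt0 : 0 < lambda.
Hypothesis nu_ge0 : forall x, 0 <= nu x.
Hypothesis nu_sum : \sum_x nu x = 1.
Hypothesis c_gt0 : 0 < c.
Hypothesis c_le : forall z, c <= mean_hit K nu z.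

Local Notation P := (ARW_chain K lambda nu).
Local Notation S t := (survival K nu t finset.set0).
Local Notation pi j := (stationary K lambda (enum_val j)).
Let mu : 'rV[R]_#|{: stable_config V}| := \row_j pi j.

Lemma chain_pow_ge t i j : (1 - S t) * pi j <= (P ^+ t) i j.
Proof.
rewrite (chain_pow nu walkK lambda_gt0).
apply: (chain_ge walkK lambda_gt0 nu_ge0 nu_sum) => x.
by rewrite inE ffunE; case: (enum_val i x); [left|right].
Qed.

Lemma chain_row_sum t i : \sum_j (P ^+ t) i j = 1.
Proof.
elim: t i => [|t IH] i.
  rewrite expr0 (bigD1 i)//= mxE eqxx big1 ?addr0// => j ji.
  by rewrite mxE eq_sym (negPf ji).
under eq_bigr do rewrite exprS mxE.
rewrite exchange_big /=; under eq_bigr do rewrite -mulr_sumr IH mulr1.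
under eq_bigr do rewrite mxE /ARW_kernel.
rewrite (sum_enum_val (fun z => \sum_x nu x *
   stabilization_prob K lambda (arrive x (of_stable (enum_val i))) z)).
rewrite exchange_big /=; under eq_bigr do rewrite -mulr_sumr.
under eq_bigr do rewrite (sum_stab1 walkK lambda_gt0) mulr1.
exact: nu_sum.
Qed.

Lemma stationary_invariant : invariant_law P mu.
Proof.
split.
- by move=> i; rewrite mxE; exact: stab_ge0 walkK lambda_gt0 _ _.
- under eq_bigr do rewrite mxE.
  rewrite (sum_enum_val (stationary K lambda)).
  exact: stationary_sum walkK lambda_gt0.
apply/rowP => j; rewrite !mxE.
pose G := add_random nu (fun eta => stabilization_prob K lambda eta (enum_val j)).
have hG0 := stab_harmonic walkK lambda_gt0 (enum_val j).
have hG : harmonic K lambda G by exact: harmonic_add.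
rewrite -[RHS](add_random_full walkK lambda_gt0 nu_sum hG0) -/G.
rewrite -(sum_stab walkK lambda_gt0 _ hG).
rewrite -(sum_enum_val (fun z => G (of_stable z) * stabilization_prob K lambda _ z)).
by apply: eq_bigr => i _; rewrite !mxE mulrC.
Qed.

Lemma survival_small e : 0 < e -> exists t, S t < e.
Proof.
move=> e0.
have [U UT UE] := mean_filling_time walkK nu_ge0 nu_sum c_gt0 c_le.
set a := U finset.set0.
have a0 : 0 <= a.
  exact: (filling_time_ge0 walkK nu_ge0 nu_sum c_gt0 c_le UT UE).
have ca : 0 <= c^-1 * a by rewrite mulr_ge0// invr_ge0 ltW.
have [t] : exists t : nat, a + 1 + c^-1 * a / e < t%:R.
  by exists (Num.truncn (a + 1 + c^-1 * a / e)).+1; rewrite truncnS_gt.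
have ca2 : 0 <= c^-1 * a / e by rewrite divr_ge0// ltW.
move=> at_; exists t.
have at1 : a < t%:R by lra.
apply: le_lt_trans
  (survival_upper walkK nu_ge0 nu_sum c_gt0 c_le UT UE at1) _.
have ta1 : 1 <= t%:R - a by lra.
have ta2 : c^-1 * a / e < t%:R - a by lra.
rewrite ltr_pdivrMr ?exprn_gt0 ?subr_gt0//.
rewrite ltr_pdivrMr// in ta2; apply: lt_le_trans ta2 _.
rewrite -/a mulrC; apply: ler_wpM2l; first exact: ltW.
by rewrite expr2; nra.
Qed.

(** From m = m P^t >= (1 - S t) mu and S t -> 0 it follows that m >= mu, and both have mass 1. *)
Lemma invariant_unique m : invariant_law P m -> m = mu.
Proof.
move=> [m0 m1 mP].
have mPt t : m *m (P ^+ t) = m.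
  elim: t => [|t IH]; first by rewrite expr0 mulmx1.
  by rewrite exprSr mulmxA IH.
have mge j : mu 0 j <= m 0 j.
  rewrite leNgt; apply/negP => lt.
  have pj0 : 0 < pi j by exact: stationary_gt0 walkK lambda_gt0 _.
  rewrite mxE in lt.
  have [|t St] := @survival_small (1 - m 0 j / pi j).
    by rewrite subr_gt0 ltr_pdivrMr// mul1r.
  have : (1 - S t) * pi j <= m 0 j.
    have -> : (1 - S t) * pi j = \sum_i m 0 i * ((1 - S t) * pi j).
      by rewrite -mulr_suml m1 mul1r.
    rewrite -[in leRHS](mPt t) mxE.
    apply: ler_sum => i _; apply: ler_wpM2l => //; exact: chain_pow_ge.
  rewrite leNgt => /negP[]; rewrite -ltr_pdivrMr//; lra.
have [_ mu1 _] := stationary_invariant.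
apply/rowP => j; apply/eqP; rewrite -subr_eq0; apply/eqP.
have : \sum_i (m 0 i - mu 0 i) = 0 by rewrite sumrB m1 mu1 subrr.
move/eqP; rewrite psumr_eq0; last by move=> i _; rewrite subr_ge0.
by move/allP/(_ j (mem_index_enum _))/eqP.
Qed.

Lemma invariant_distE : invariant_dist P = mu.
Proof.
apply: invariant_unique; apply: (@xgetPex _ 0 [set m | invariant_law P m]).
by exists mu; exact: stationary_invariant.
Qed.

Lemma d_sepE t : d_sep P t = S t.
Proof.
have pj0 j : 0 < pi j by exact: stationary_gt0 walkK lambda_gt0 _.
rewrite /d_sep invariant_distE; apply/eqP; rewrite eq_le; apply/andP; split.
  apply: ge_sup.
    exists (1 - (P ^+ t) (enum_rank [ffun=> true]) (enum_rank [ffun=> true]) /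
      mu 0 (enum_rank [ffun=> true])).
    by exists (enum_rank [ffun=> true], enum_rank [ffun=> true]).
  move=> _ [[i j] _ <-] /=; rewrite [mu _ _]mxE.
  rewrite lerBlDl -lerBlDr ler_pdivlMr//; exact: chain_pow_ge.
apply: ub_le_sup.
  exists (S t) => _ [[i j] _ <-] /=; rewrite [mu _ _]mxE.
  rewrite lerBlDl -lerBlDr ler_pdivlMr//; exact: chain_pow_ge.
exists (enum_rank [ffun=> false], enum_rank (@all_asleep V)) => //=.
rewrite (chain_pow nu walkK lambda_gt0) [mu _ _]mxE !enum_rankK.
have -> : of_stable [ffun=> false] = occupied (finset.set0 : {set V}).
  by apply/ffunP => x; rewrite !ffunE inE.
rewrite (chain_from_empty walkK lambda_gt0 nu_sum) mulfK; first by ring.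
by rewrite gt_eqF// (stationary_gt0 walkK lambda_gt0).
Qed.

(** Write P^t as (1 - S t) times the matrix with all rows mu, plus a nonnegative E with row sums S
    t. A left eigenvector for z <> 1 has coordinates of sum 0, so only E acts on it; compare l^1
    norms. *)
Lemma eigenvalue_le z t : eigenvalue (map_mx (real_complex R) P) z -> z <> 1 ->
  ComplexField.Normc.normc z ^+ t <= S t.
Proof.
move=> /eigenvalueP[v vP v0] z1.
pose M := map_mx (real_complex R) P.
pose nc := @ComplexField.Normc.normc R.
have vt s : v *m map_mx (real_complex R) (P ^+ s) = z ^+ s *: v.
  elim: s => [|s IH]; first by rewrite expr0 map_mx1 mulmx1 expr0 scale1r.
  rewrite exprSr [map_mx _ _]map_mxM mulmxA IH -scalemxAl vP scalerA.
  by rewrite exprSr.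
have sv : \sum_j v 0 j = 0.
  have : \sum_j (v *m M) 0 j = z * \sum_j v 0 j.
    by rewrite vP mulr_sumr; apply: eq_bigr => j _; rewrite mxE.
  under eq_bigr do rewrite mxE.
  rewrite exchange_big /=.
  under eq_bigr => i _.
    rewrite -mulr_sumr (_ : \sum_j M i j = 1) ?mulr1; last first.
      under eq_bigr do rewrite mxE.
      by rewrite -rmorph_sum -[P]expr1 chain_row_sum rmorph1.
    over.
  move/eqP; rewrite -subr_eq0 -{1}[\sum_j _]mul1r -mulrBl mulf_eq0 subr_eq0.
  by move=> /orP[/eqP/esym //|/eqP].
pose E i j := (P ^+ t) i j - (1 - S t) * pi j.
have E0 i j : 0 <= E i j by rewrite subr_ge0; exact: chain_pow_ge.
have Esum i : \sum_j E i j = S t.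
  rewrite sumrB chain_row_sum -mulr_sumr.
  rewrite (sum_enum_val (stationary K lambda)).
  by rewrite (stationary_sum walkK lambda_gt0); ring.
have zv j : z ^+ t * v 0 j = \sum_i v 0 i * real_complex R (E i j).
  have := congr1 (fun m : 'rV_ _ => m 0 j) (vt t); rewrite !mxE => <-.
  under [RHS]eq_bigr do rewrite /E rmorphB mulrBr.
  rewrite sumrB -mulr_suml sv mul0r subr0.
  by apply: eq_bigr => i _; rewrite mxE.
have nc_ge0 w : 0 <= nc w by rewrite /nc /ComplexField.Normc.normc; case: w => a b; exact: sqrtr_ge0.
have ncR a : 0 <= a -> nc (real_complex R a) = a.
  by move=> a0; rewrite /nc /ComplexField.Normc.normc /= expr0n /= addr0 sqrtr_sqr ger0_norm.
have nc_sum (J : finType) (f : J -> R[i]) : nc (\sum_j f j) <= \sum_j nc (f j).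
  elim/big_ind2 : _ => //; first by rewrite /nc ComplexField.Normc.normc0.
  by move=> a1 b1 a2 b2 h1 h2; apply: le_trans (le_normcD _ _) _; exact: lerD.
have ncX s : nc (z ^+ s) = nc z ^+ s.
  elim: s => [|s IH]; first by rewrite !expr0 /nc ComplexField.Normc.normc1.
  by rewrite !exprS -IH /nc ComplexField.Normc.normcM.
have vpos : 0 < \sum_j nc (v 0 j).
  rewrite lt_neqAle sumr_ge0 ?andbT//; apply/negP => /eqP/esym/eqP.
  rewrite psumr_eq0// => /allP v00; case/eqP: v0; apply/rowP => j; rewrite mxE.
  by apply: ComplexField.Normc.eq0_normc; apply/eqP; exact: v00 (mem_index_enum _).
rewrite -(ler_pM2r vpos) -/(nc z) -ncX mulr_sumr.
apply: (@le_trans _ _ (\sum_j \sum_i nc (v 0 i) * E i j)).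
  apply: ler_sum => j _; rewrite -[nc _ * nc _]ComplexField.Normc.normcM zv.
  apply: le_trans (nc_sum _ _) _; apply: ler_sum => i _.
  by rewrite /nc ComplexField.Normc.normcM -/nc [X in _ * X]ncR.
rewrite exchange_big mulr_sumr; apply: ler_sum => i _.
by rewrite -mulr_sumr Esum mulrC.
Qed.

End ChainSeparation.

(** * Uniform starts: relaxation time, separation time and window *)

Section UniformNetwork.
Context {R : realType} {V : finType} (K : V -> V -> R) (r : V -> nat).
Context (lambda c : R).
Hypothesis walkK : killed_walk K r.
Hypothesis lambda_gt0 : 0 < lambda.
Hypothesis V_gt0 : (0 < #|V|)%N.
Hypothesis c_gt0 : 0 < c.
Hypothesis c_le : forall z, c <= mean_hit K (@uniform_law R V) z.

Local Notation nu := (@uniform_law R V).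
Local Notation P := (ARW_chain K lambda nu).
Local Notation S t := (survival K nu t finset.set0).
Local Notation N := (#|V|%:R : R).

Lemma uniform_law_ge0 x : 0 <= nu x.
Proof. by rewrite invr_ge0. Qed.

Lemma uniform_law_sum : \sum_x nu x = 1.
Proof.
by rewrite sumr_const -[_ *+ _]mulr_natr mulVf// pnatr_eq0 -lt0n.
Qed.

Local Notation nu0 := uniform_law_ge0.
Local Notation nu1 := uniform_law_sum.

(** For uniform nu, the total of [hit K z] over V is N times its mean, which places the threshold of
    the exponential bound at t = N. *)
Lemma mean_hit_uniform z : \sum_y hit K z y = N * mean_hit K nu z.
Proof.
rewrite /mean_hit -mulr_sumr mulrA mulfV ?mul1r// pnatr_eq0 -lt0n//.
Qed.

Lemma inv_subr_le_expR (x : R) : 0 <= x <= 2^-1 -> (1 - x)^-1 <= expR (x + 2 * x ^+ 2).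
Proof.
move=> /andP[x0 x1]; have x2 : 0 < 1 - x by lra.
apply: (@le_trans _ _ (expR (x / (1 - x)))).
  apply: le_trans (expR_ge1Dx _).
  have -> : 1 + x / (1 - x) = (1 - x)^-1 by field; rewrite gt_eqF.
  by [].
rewrite ler_expR ler_pdivrMr//; nra.
Qed.

Lemma survival_bound (delta : R) t : 0 < delta <= 1 -> (1 + delta) * N <= t%:R ->
  S t <= N * expR (- (delta ^+ 2 / 8 * (c * N))).
Proof.
(* The exponent is at most (2 th^2 - delta th) m N, least at th = delta / 4 with value - delta^2 m N
   / 8. *)
move=> /andP[d0 d1] tN; pose th := delta / 4.
have th0 : 0 < th by rewrite divr_gt0.
have th1 : th <= 2^-1 by rewrite /th; lra.
apply: le_trans (@survival_le_sum _ _ K r nu walkK nu0 nu1 th t _) _; first by rewrite ltW//=; lra.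
have sumE (e : R) : N * e = \sum_(z : V) e by rewrite sumr_const mulr_natl.
rewrite sumE; apply: ler_sum => z _.
set m := mean_hit K nu z.
have m0 : 0 < m by apply: lt_le_trans (c_le z).
have m1 : m <= 1 by exact: mean_hit_le1 walkK nu0 nu1 _.
have prodE : (\prod_y (1 - th * hit K z y))^-1 <= expR ((th + 2 * th ^+ 2) * (N * m)).
  rewrite -mean_hit_uniform mulr_sumr expR_sum -prodfV.
  apply: ler_prod => y _.
  have h0 := hit_ge0 walkK z y; have h1 := hit_le1 walkK z y.
  have x0 : 0 <= th * hit K z y by rewrite mulr_ge0// ltW.
  have x1 : th * hit K z y <= th by rewrite -[leRHS]mulr1 ler_wpM2l// ltW.
  rewrite invr_ge0 subr_ge0 (le_trans x1) ?(le_trans th1)//=; last by lra.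
  apply: le_trans (inv_subr_le_expR _) _; first by rewrite x0 (le_trans x1).
  rewrite ler_expR.
  have : (th * hit K z y) ^+ 2 <= th ^+ 2 * hit K z y.
    rewrite exprMn; apply: ler_wpM2l; first exact: sqr_ge0.
    by rewrite expr2 -[leRHS]mulr1; exact: ler_wpM2l.
  lra.
have powE : (1 - th * m) ^+ t <= expR (- (th * m * t%:R)).
  rewrite -[- (th * m * _)]mulNr expRM_natr; apply: lerXn2r; rewrite ?nnegrE ?expR_ge0//.
    by have := ler_pM (ltW th0) (ltW m0) th1 m1; lra.
  exact: expR_ge1Dx.
apply: (@le_trans _ _ (expR ((th + 2 * th ^+ 2) * (N * m)) * expR (- (th * m * t%:R)))).
  apply: ler_pM => //.
    rewrite invr_ge0 prodr_ge0// => y _.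
    have := hit_le1 walkK z y; have := hit_ge0 walkK z y; nra.
  by rewrite exprn_ge0//; have := ler_pM (ltW th0) (ltW m0) th1 m1; lra.
rewrite -expRD ler_expR.
have tm : th * m * ((1 + delta) * N) <= th * m * t%:R.
  by apply: ler_wpM2l => //; rewrite mulr_ge0// ltW.
have cm : c * N <= m * N by apply: ler_wpM2r => //; exact: c_le.
have dE : delta = 4 * th by rewrite /th; field.
have : 2 * th ^+ 2 * (c * N) <= 2 * th ^+ 2 * (m * N).
  by apply: ler_wpM2l => //; rewrite mulr_ge0// sqr_ge0.
rewrite dE in tm *; lra.
Qed.

Lemma t_rel_bound : 0 <= t_rel P <= 2 / c.
Proof.
have [z0 _] : exists z0 : V, true.
  by move: V_gt0; case/card_gt0P => z0 _; exists z0.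
have c1 : c <= 1 by apply: le_trans (c_le z0) _; exact: mean_hit_le1 walkK nu0 nu1 _.
(* The rate of [survival_le_sum] at theta = 1/2. Its prefactor C is harmless: a modulus nz > q would
   make (nz / q)^t unbounded in t. *)
pose q := 1 - c / 2.
have q0 : 0 < q by rewrite /q; lra.
have rhoq : rho P <= q.
  rewrite /rho; set E := [set _ | _ in _].
  (* Without an eigenvalue other than 1, [rho] is the [sup] of the empty set, that is 0. *)
  have [->|/set0P Ene] := eqVneq E set0; first by rewrite sup0 ltW.
  apply: ge_sup => // _ [z [ez z1] <-]; set nz := ComplexField.Normc.normc z.
  rewrite leNgt; apply/negP => qz.
  pose C := \sum_z (\prod_y (1 - 2^-1 * hit K z y))^-1.
  have C0 : 0 <= C.
    apply: sumr_ge0 => y _; rewrite invr_ge0 prodr_ge0// => u _.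
    by have := hit_le1 walkK y u; have := hit_ge0 walkK y u; lra.
  have bound t : nz ^+ t <= C * q ^+ t.
    apply: le_trans (eigenvalue_le walkK lambda_gt0 nu0 nu1 t ez z1) _.
    apply: le_trans (@survival_le_sum _ _ K r nu walkK nu0 nu1 2^-1 t _) _.
      by rewrite invr_ge0 ltW//= invf_lt1 ?ltr1n.
    rewrite mulr_suml; apply: ler_sum => y _; apply: ler_wpM2l.
      rewrite invr_ge0 prodr_ge0// => u _.
      by have := hit_le1 walkK y u; have := hit_ge0 walkK y u; lra.
    have m1 : mean_hit K nu y <= 1 by exact: mean_hit_le1 walkK nu0 nu1 _.
    have := c_le y => cy.
    by apply: lerXn2r; rewrite ?nnegrE /q; lra.
  pose b := nz / q - 1.
  have b0 : 0 < b by rewrite subr_gt0 ltr_pdivlMr// mul1r.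
  have bern t : 1 + t%:R * b <= (nz / q) ^+ t.
    have -> : nz / q = 1 + b by rewrite /b; ring.
    elim: t => [|t IH]; first by rewrite mul0r addr0 expr0.
    rewrite exprS -natr1; apply: (@le_trans _ _ ((1 + b) * (1 + t%:R * b))).
      by have t0 : 0 <= t%:R :> R by []; nra.
    by apply: ler_wpM2l => //; rewrite addr_ge0// ltW.
  pose t := (Num.truncn (C / b)).+1.
  have tC : C < t%:R * b by rewrite -ltr_pdivrMr// truncnS_gt.
  have := bound t; rewrite -ler_pdivrMr ?exprn_gt0// -expr_div_n => bt.
  have := bern t; lra.
rewrite /t_rel; have h : c / 2 <= 1 - rho P by rewrite /q in rhoq; lra.
have c2 : 0 < c / 2 by rewrite divr_gt0.
rewrite invr_ge0 (le_trans (ltW c2) h)/= -[2 / c]invf_div lef_pV2// posrE//.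
exact: lt_le_trans h.
Qed.

Lemma t_sepP eps : 0 < eps -> exists m : nat,
  [/\ t_sep P eps = m%:R, S m <= eps & forall k, (k < m)%N -> eps < S k].
Proof.
move=> e0.
have ex : exists t, S t <= eps.
  by have [t /ltW St] := survival_small walkK nu0 nu1 c_gt0 c_le e0; exists t.
case: (ex_minnP ex) => m Sm mmin; exists m; split=> //; last first.
  by move=> k km; rewrite ltNge; apply/negP => /mmin; rewrite leqNgt km.
have dE t : d_sep P t = S t := d_sepE walkK lambda_gt0 nu0 nu1 c_gt0 c_le t.
rewrite /t_sep; apply/eqP; rewrite eq_le; apply/andP; split.
  apply: ge_inf; last by exists m => //=; rewrite dE.
  by exists 0 => _ [t _ <-].
apply: lb_le_inf; first by exists m%:R, m => //=; rewrite dE.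
by move=> _ [t /= + <-]; rewrite dE ler_nat => /mmin.
Qed.

Lemma t_sep_ge eps : 0 < eps < 1 -> N <= t_sep P eps.
Proof.
move=> /andP[e0 e1]; have [m [-> Sm _]] := t_sepP e0.
rewrite ler_nat leqNgt; apply/negP => mN.
by move: Sm; rewrite (survival_eq1 walkK nu0 nu1) ?cards0 ?add0n// leNgt e1.
Qed.

Lemma t_sep_le (delta eps : R) : 0 < eps -> 0 < delta <= 1 ->
  N * expR (- (delta ^+ 2 / 8 * (c * N))) <= eps ->
  t_sep P eps <= (1 + delta) * N + 1.
Proof.
move=> e0 d01 Ne; have [m [-> _ mmin]] := t_sepP e0.
rewrite leNgt; apply/negP => lt.
have [d0 _] := andP d01.
have x0 : 0 <= (1 + delta) * N by rewrite mulr_ge0// addr_ge0// ltW.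
case: m mmin lt => [|m] mmin; first by rewrite ltNge addr_ge0.
rewrite -natr1 ltrD2r => /ltW lt.
have := mmin m (ltnSn m); rewrite ltNge => /negP[].
by apply: le_trans Ne; apply: survival_bound.
Qed.

Lemma t_sep_window eps t0 : 0 < eps < 2^-1 -> S t0 <= 2^-1 ->
  0 <= t_sep P eps - t_sep P (1 - eps) <=
  2 * Num.sqrt ((2 * t0%:R + 2 / c) / (c * eps)) + 1.
Proof.
move=> /andP[e0 e1] St0.
have [U UT UE] := mean_filling_time walkK nu0 nu1 c_gt0 c_le.
set a := U finset.set0.
have a0 : 0 <= a.
  exact: (filling_time_ge0 walkK nu0 nu1 c_gt0 c_le UT UE).
have up t := survival_upper walkK nu0 nu1 c_gt0 c_le UT UE (t := t).
have lo t := survival_lower walkK nu0 nu1 c_gt0 c_le UT UE (t := t) V_gt0.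
rewrite -/a in up lo.
have ic0 : 0 < c^-1 by rewrite invr_gt0.
(* A median controls the mean: [survival_lower] gives (a - t0)^2 <= 2 a / c, while a > 2 t0 + 2 / c
   would give (a - t0)^2 > (a / 2 + 1 / c)^2 >= 2 a / c. *)
have a_le : a <= 2 * t0%:R + 2 / c.
  rewrite leNgt; apply/negP => lt.
  have t00 : 0 <= t0%:R :> R by [].
  have at0 : t0%:R < a by lra.
  have := lo t0 at0; rewrite ler_pdivlMr ?exprn_gt0 ?subr_gt0// => h.
  have h2 : (a - t0%:R) ^+ 2 <= 2 * (c^-1 * a).
    have := sqr_ge0 (a - t0%:R); nra.
  have h3 : (a / 2 + c^-1) ^+ 2 < (a - t0%:R) ^+ 2.
    rewrite ltr_pXn2r ?nnegrE//; lra.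
  have := sqr_ge0 (a / 2 - c^-1); rewrite !expr2 in h3 *; lra.
(* At distance s from the mean both Chebyshev bounds are at most eps, so the two quantiles lie
   within s of a, up to 1 for integrality. *)
set s := Num.sqrt _.
have s0 : 0 <= s by exact: sqrtr_ge0.
have ce : 0 < c * eps by rewrite mulr_gt0.
have s2 : c^-1 * a / eps <= s ^+ 2.
  rewrite sqr_sqrtr; last by apply: divr_ge0; [exact: le_trans a_le|exact: ltW].
  have -> : c^-1 * a / eps = a / (c * eps) by field; rewrite !gt_eqF.
  by apply: ler_wpM2r => //; rewrite invr_ge0 ltW.
have [m [-> Sm mmin]] := t_sepP e0.
have e2 : 0 < 1 - eps by lra.
have [m' [-> Sm' mmin']] := t_sepP e2.
apply/andP; split.
  rewrite subr_ge0 ler_nat leqNgt; apply/negP => lt.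
  by have := mmin' _ lt; lra.
have hm : m%:R <= a + s + 1.
  rewrite leNgt; apply/negP => lt.
  case: m {Sm} mmin lt => [|m] mmin lt; first by lra.
  rewrite -natr1 in lt.
  have am : a < m%:R by lra.
  have := up m am; rewrite ler_pdivlMr ?exprn_gt0 ?subr_gt0// => h.
  have Sme := mmin m (ltnSn m).
  have h3 : s ^+ 2 < (m%:R - a) ^+ 2 by rewrite ltr_pXn2r ?nnegrE//; lra.
  have h4 : eps * (m%:R - a) ^+ 2 <= c^-1 * a.
    by apply: le_trans h; rewrite ler_wpM2r ?sqr_ge0 1?ltW.
  by move: s2; rewrite ler_pdivrMr//; nra.
have hm' : a - s <= m'%:R.
  rewrite leNgt; apply/negP => lt.
  have am : m'%:R < a by lra.
  have := lo m' am; rewrite ler_pdivlMr ?exprn_gt0 ?subr_gt0// => h.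
  have h3 : s ^+ 2 < (a - m'%:R) ^+ 2 by rewrite ltr_pXn2r ?nnegrE//; lra.
  have h4 : eps * (a - m'%:R) ^+ 2 <= c^-1 * a.
    by apply: le_trans h; rewrite ler_wpM2r ?sqr_ge0//; lra.
  by move: s2; rewrite ler_pdivrMr//; nra.
lra.
Qed.

End UniformNetwork.

(** * Walks in lattice balls *)

(* By symmetry of K, the sum of [hit K z] is the mean exit time from z divided by
   the Green function at z, for which v and u are lower and upper bounds. *)
Lemma hit_sum_ge {R : realType} {V : finType} (K : V -> V -> R) (r : V -> nat)
    (u v : V -> R) z :
  killed_walk K r -> (forall x y, K x y = K y x) ->
  (forall y, 0 <= u y) -> (forall y, \sum_w K y w * u w + (y == z)%:R <= u y) ->
  0 <= v z -> (forall y, v y <= 1 + \sum_w K y w * v w) ->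
  v z / u z <= \sum_y hit K z y.
Proof.
move=> walkK Ksym u0 uK vz vK; have [K0 K1 _] := walkK.
(* e is the probability of no return to z, hence the inverse of the Green function at z. *)
pose h := hit K z; pose e := 1 - \sum_w K z w * h w.
have uh y : u z * h y <= u y.
  rewrite -subr_ge0; move: y.
  apply: (walk_superharmonic_ge0 walkK (A := finset.setC (finset.set1 z))) => y.
    by rewrite !inE negbK => /eqP ->; rewrite /h (hit_self walkK) mulr1 subrr.
  rewrite !inE => yz; under eq_bigr do rewrite mulrBr mulrCA.
  rewrite sumrB -mulr_sumr -(hit_neq walkK yz).
  by rewrite lerD2r; have := uK y; rewrite (negPf yz) addr0.
have ue : 1 <= u z * e.
  have := uK z; rewrite eqxx /= => uz.
  have : u z * (\sum_w K z w * h w) <= \sum_w K z w * u w.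
    rewrite mulr_sumr; apply: ler_sum => w _; rewrite mulrCA.
    exact: ler_wpM2l.
  by rewrite /e; lra.
have uz0 : 0 < u z.
  by rewrite lt_neqAle u0 andbT; apply: contraTneq ue => <-; rewrite mul0r ler10.
apply: (@le_trans _ _ (v z * e)).
  by rewrite ler_wpM2l// -[_^-1]mul1r ler_pdivrMr// mulrC.
(* h - K h is e times the indicator of z; by symmetry of K it can be summed by parts against v. *)
have Kh w : h w - \sum_y K w y * h y = (w == z)%:R * e.
  have [->|wz] := eqVneq w z; first by rewrite /h (hit_self walkK) mul1r.
  by rewrite -(hit_neq walkK wz) subrr mul0r.
have -> : v z * e = \sum_w v w * (h w - \sum_y K w y * h y).
  rewrite (bigD1 z)//= Kh eqxx mul1r big1 ?addr0// => w wz.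
  by rewrite Kh (negPf wz) mul0r mulr0.
apply: (@le_trans _ _ (\sum_y h y * (v y - \sum_w K y w * v w))).
  rewrite le_eqVlt; apply/orP; left; apply/eqP.
  under eq_bigr do rewrite mulrBr; under [RHS]eq_bigr do rewrite mulrBr.
  rewrite !sumrB; congr (_ - _); first by apply: eq_bigr => w _; rewrite mulrC.
  under eq_bigr do rewrite mulr_sumr; under [RHS]eq_bigr do rewrite mulr_sumr.
  rewrite exchange_big /=; apply: eq_bigr => y _; apply: eq_bigr => w _.
  by rewrite (Ksym w y); ring.
apply: ler_sum => y _; rewrite -[leRHS]mulr1; apply: ler_wpM2l.
  exact: hit_ge0 walkK _ _.
by have := vK y; lra.
Qed.

Section LatticeBall.
Context {R : realType} (d n : nat).
Hypothesis d_gt0 : (0 < d)%N.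
Implicit Types (x y z : 'rV[int]_d) (p : 'I_d * bool) (f : 'rV[int]_d -> R).

Local Notation V := (lattice_ball d n).
Local Notation K := (@ball_srw R d n).

Definition pm (b : bool) : int := if b then 1 else -1.

Definition neighbor x p : 'rV[int]_d :=
  \row_j (x 0 j + (j == p.1)%:R * pm p.2).

Definition norm2 x : int := \sum_i x 0 i ^+ 2.

Lemma neighbor_inj x : injective (neighbor x).
Proof.
move=> [i b] [j c] /rowP e.
have ij : i = j.
  have := e i; rewrite !mxE /= eqxx mul1r => /addrI.
  by have [//|_] := eqVneq i j; rewrite mul0r; case: b {e}.
rewrite -{}ij in e *; congr pair; have := e i; rewrite !mxE /= eqxx !mul1r => /addrI.
by case: b {e}; case: c.
Qed.

Lemma dist1_neighbor x y :
  (\sum_(i < d) `|x 0 i - y 0 i| == 1) = [exists p, y == neighbor x p].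
Proof.
apply/eqP/existsP => [xy|[[i b] /eqP ->]]; last first.
  rewrite (bigD1 i)//= mxE eqxx mul1r big1 => [|j /negPf ji].
    by rewrite opprD addrA subrr add0r addr0 normrN; case: b.
  by rewrite mxE /= ji mul0r addr0 subrr normr0.
have [i xi] : exists i, x 0 i != y 0 i.
  apply: contrapT => none; move: xy; rewrite big1// => i _.
  have [->|ne] := eqVneq (x 0 i) (y 0 i); first by rewrite subrr normr0.
  by case: none; exists i.
move: xy; rewrite (bigD1 i)//=.
set S := \sum_(j | _) _ => xy.
have S0 : 0 <= S by apply: sumr_ge0.
have d1 : 1 <= `|x 0 i - y 0 i|.
  by rewrite -[1]add0r lezD1 normr_gt0 subr_eq0.
have Sz : S = 0 by lia.
exists (i, y 0 i == x 0 i + 1); apply/eqP/rowP => j; rewrite mxE /=.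
have [->|ji] := eqVneq j i; last first.
  rewrite mul0r addr0; move/eqP: Sz; rewrite psumr_eq0// => /allP.
  by move=> /(_ j (mem_index_enum _)); rewrite ji normr_eq0 subr_eq0 => /eqP ->.
rewrite mul1r /pm; case: eqP => [//|ne]; lia.
Qed.

Lemma lattice_srwE x y : lattice_srw x y =
  (2 * d)%:R^-1 * \sum_p (y == neighbor x p)%:R :> R.
Proof.
rewrite /lattice_srw dist1_neighbor; case: existsP => [[p /eqP yp]|none].
  rewrite (bigD1 p)//= yp eqxx big1 ?addr0 ?mulr1// => q qp.
  by rewrite (inj_eq (@neighbor_inj x)) eq_sym (negPf qp).
rewrite big1 ?mulr0// => p _; case: eqP => // yp.
by case: none; exists p; apply/eqP.
Qed.

Lemma srw_sum f (x : V) : \sum_y K x y * f (val y) =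
  (2 * d)%:R^-1 * \sum_p (neighbor (val x) p \in V)%:R * f (neighbor (val x) p).
Proof.
rewrite /ball_srw; under eq_bigr do rewrite lattice_srwE -mulrA mulr_suml.
rewrite -mulr_sumr exchange_big /=; congr (_ * _); apply: eq_bigr => p _.
case: (boolP (neighbor (val x) p \in V)) => [nV|nV]; last first.
  rewrite mul0r big1// => y _; case: eqP => [e|]; last by rewrite mul0r.
  by case/negP: nV; rewrite -e; exact: valP.
rewrite (bigD1 [` nV]%fset)//= eqxx big1 ?addr0// => y ny.
case: eqP => [e|]; last by rewrite mul0r.
by case/eqP: ny; apply: val_inj.
Qed.

Lemma ball_srw_sym (x y : V) : K x y = K y x.
Proof.
rewrite /ball_srw /lattice_srw.
by under eq_bigr do rewrite distrC.
Qed.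

Lemma norm2_neighbor x p :
  norm2 (neighbor x p) = norm2 x + 1 + 2 * pm p.2 * x 0 p.1.
Proof.
rewrite /norm2 (bigD1 p.1)//= [in RHS](bigD1 p.1)//= mxE eqxx mul1r.
rewrite (eq_bigr (fun i => x 0 i ^+ 2)); last first.
  by move=> i /negPf ip; rewrite mxE ip mul0r addr0.
by case: p => i [] /=; rewrite /pm; ring.
Qed.

Lemma memV x : (x \in V) = (norm2 x <= n%:Z ^+ 2).
Proof. exact: mem_lattice_ball. Qed.

Lemma coord_le x i : x \in V -> `|x 0 i| <= n%:Z.
Proof.
rewrite memV => xV; rewrite -(@ler_pXn2r _ 2) ?nnegrE// real_normK ?num_real//.
apply: le_trans xV; rewrite /norm2 (bigD1 i)//= lerDl.
by apply: sumr_ge0 => j _; exact: sqr_ge0.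
Qed.

Lemma card_neighbors : \sum_(p : 'I_d * bool) (1 : R) = (2 * d)%:R.
Proof. by rewrite sumr_const card_prod card_ord card_bool mulnC. Qed.

(** Steps in the positive first direction end up outside the ball, so the rank is the distance of
    the first coordinate to n. *)
Lemma ball_walk : killed_walk K
  (fun s => `|(n%:Z - val s 0 (Ordinal d_gt0))%R|%N).
Proof.
have d2 : 0 < (2 * d)%:R :> R by rewrite ltr0n muln_gt0.
have sumE (x : V) : \sum_y K x y =
    (2 * d)%:R^-1 * \sum_p (neighbor (val x) p \in V)%:R.
  transitivity (\sum_y K x y * (fun=> 1) (val y)).
    by apply: eq_bigr => y _; rewrite mulr1.
  rewrite (srw_sum (fun=> 1)).
  by congr (_ * _); apply: eq_bigr => p _; rewrite mulr1.
split.
- move=> x y; rewrite /ball_srw /lattice_srw; by case: ifP.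
- move=> x; rewrite sumE ler_pdivrMl// mulr1 -card_neighbors.
  by apply: ler_sum => p _; case: (_ \in _).
move=> x; pose p := (Ordinal d_gt0, true).
have [nV|nV] := boolP (neighbor (val x) p \in V); last first.
  left; rewrite sumE ltr_pdivrMl// mulr1 -card_neighbors (bigD1 p)//=.
  rewrite (negPf nV) add0r [ltRHS](bigD1 p)//=.
  rewrite -[ltLHS]add0r; apply: ltr_leD => //.
  by apply: ler_sum => q _; case: (_ \in _).
right; exists [` nV]%fset.
  rewrite /ball_srw lattice_srwE mulr_gt0 ?invr_gt0// (bigD1 p)//= eqxx.
  by rewrite ltr_pwDl// sumr_ge0.
have := coord_le (Ordinal d_gt0) nV; have := coord_le (Ordinal d_gt0) (valP x).
rewrite /= mxE eqxx mul1r /pm /=; lia.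
Qed.

Definition average f x : R := (2 * d)%:R^-1 * \sum_p f (neighbor x p).

(** The function u extends to the outer neighbours with nonnegative values, and dropping these only
    lowers the average; v must be used with value 0 there. *)
Lemma ball_hit_ge (u v : 'rV[int]_d -> R) (z : V) :
  (forall x, x \in V -> 0 <= u x /\ forall p, 0 <= u (neighbor x p)) ->
  (forall x, x \in V -> average u x + (x == val z)%:R <= u x) ->
  0 <= v (val z) ->
  (forall x, x \in V -> v x <= 1 + \sum_p (2 * d)%:R^-1 *
     ((neighbor x p \in V)%:R * v (neighbor x p))) ->
  v (val z) / u (val z) <= \sum_y hit K z y.
Proof.
move=> u0 uA vz vA.
apply: (@hit_sum_ge _ _ _ _ (u \o val) (v \o val) z ball_walk ball_srw_sym) => //.
- by move=> y; have [] := u0 _ (valP y).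
- move=> y; rewrite /= srw_sum; apply: le_trans (uA _ (valP y)).
  rewrite lerD2r; apply: ler_wpM2l; first by rewrite invr_ge0.
  apply: ler_sum => p _; rewrite -[leRHS]mul1r; apply: ler_wpM2r.
    by have [_] := u0 _ (valP y).
  by case: (_ \in _).
by move=> y; rewrite /= srw_sum mulr_sumr; exact: vA (valP y).
Qed.

End LatticeBall.

(** * Lower bound on the mean exit time *)

Section MeanExitTime.
Context {R : realType} (d n : nat).
Hypothesis d_gt0 : (0 < d)%N.
Hypothesis n_gt0 : (0 < n)%N.
Implicit Types (x z : 'rV[int]_d) (f : 'rV[int]_d -> R).

Local Notation V := (lattice_ball d n).

Lemma sum_neighbors (F : 'I_d * bool -> R) :
  \sum_p F p = \sum_i (F (i, true) + F (i, false)).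
Proof.
rewrite (eq_bigr (fun p => F (p.1, p.2))); last by case.
by rewrite -(pair_bigA _ (fun i b => F (i, b))); apply: eq_bigr => i _; rewrite big_bool.
Qed.

Definition ball_step f x : R := \sum_p (2 * d)%:R^-1 *
  ((neighbor x p \in V)%:R * f (neighbor x p)).

Definition gap x : R := (n%:Z ^+ 2 - norm2 x)%:~R.

Lemma gap_ge0 x : (0 <= gap x) = (x \in V).
Proof. by rewrite /gap ler0z subr_ge0 memV. Qed.

Lemma twod_gt0 : 0 < (2 * d)%:R :> R.
Proof. by rewrite ltr0n muln_gt0. Qed.

(** The squared norm increases by 1 in mean at each step, and [gap] is negative outside the ball,
    where killing replaces it by 0. *)
Lemma ball_step_gap x : gap x <= 1 + ball_step gap x.
Proof.
apply: (@le_trans _ _ (1 + (2 * d)%:R^-1 * \sum_p gap (neighbor x p))).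
  have -> : \sum_p gap (neighbor x p) = (2 * d)%:R * (gap x - 1).
    rewrite sum_neighbors (eq_bigr (fun=> 2 * (gap x - 1))).
      by rewrite sumr_const card_ord -mulr_natr natrM; ring.
    move=> i _; rewrite /gap !norm2_neighbor /pm /= !rmorphB !rmorphD /= !rmorphM /=.
    by rewrite !rmorphN /=; ring.
  by rewrite mulKf ?gt_eqF ?twod_gt0//; lra.
rewrite lerD2l mulr_sumr; apply: ler_sum => p _; apply: ler_wpM2l.
  by rewrite invr_ge0 ltW// twod_gt0.
by case: (boolP (_ \in V)) => [|/negPf]; rewrite -gap_ge0 ?mul1r// leNgt mul0r => /negbFE/ltW.
Qed.

Lemma ball_step_le f g x : (forall y, y \in V -> f y <= g y) ->
  ball_step f x <= ball_step g x.
Proof.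
move=> fg; apply: ler_sum => p _; apply: ler_wpM2l.
  by rewrite invr_ge0 ltW// twod_gt0.
case: (boolP (_ \in V)) => [nV|]; last by rewrite !mul0r.
by rewrite !mul1r fg.
Qed.

(* At distance of order n from the boundary [gap] is large; elsewhere a step
   towards the origin increases it by an amount of order n. *)
Lemma mean_exit_time_lower z : z \in V -> exists2 v : 'rV[int]_d -> R,
  forall x, x \in V -> v x <= 1 + ball_step v x &
  n%:R / (2 * d%:R ^+ 2) <= v z.
Proof.
move=> zV.
have d1 : 1 <= d%:R :> R by rewrite ler1n.
have n1 : 1 <= n%:R :> R by rewrite ler1n.
have dd : 0 < 2 * d%:R ^+ 2 :> R by rewrite mulr_gt0// exprn_gt0// ltr0n.
have [small|big] := ltP (4 * norm2 z) (n%:Z ^+ 2).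
  exists gap; first by move=> x _; exact: ball_step_gap.
  have : (3 * n%:Z ^+ 2 <= 4 * (n%:Z ^+ 2 - norm2 z)) by lia.
  rewrite -(ler_int R) intrM [leRHS]intrM rmorphXn /= -/(gap z) => h.
  have n2 : n%:R <= (n%:R : R) ^+ 2 by rewrite expr2; nra.
  rewrite ler_pdivrMr//.
  have d2 : 1 <= d%:R ^+ 2 :> R by rewrite expr2; nra.
  have g1 : 3 / 4 * n%:R <= gap z by move: h n2; rewrite -!pmulrn; lra.
  nra.
(* Otherwise all coordinates are below n / (2 d) in modulus, and 4 |z|^2 < n^2 / d. *)
have [i iz] : exists i, n%:Z <= 2 * d%:Z * `|z 0 i|.
  apply: contrapT => none.
  have lt i : (2 * d%:Z) ^+ 2 * z 0 i ^+ 2 < n%:Z ^+ 2.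
    rewrite -exprMn -[ltLHS]real_normK ?num_real// ltr_pXn2r ?nnegrE//.
    rewrite normrM ltNge ger0_norm//; apply/negP => h; apply: none.
    by exists i.
  have : \sum_(i < d) (2 * d%:Z) ^+ 2 * z 0 i ^+ 2 < \sum_(i < d) n%:Z ^+ 2.
    rewrite (bigD1 (Ordinal d_gt0))//= [ltRHS](bigD1 (Ordinal d_gt0))//=.
    by apply: ltr_leD => //; apply: ler_sum => i _; exact: ltW.
  rewrite -mulr_sumr sumr_const card_ord -/(norm2 z) -mulr_natr.
  have dz : 0 < d%:Z by rewrite ltz_nat.
  rewrite natz => h.
  have : (2 * d%:Z) ^+ 2 * norm2 z = (d%:Z * d%:Z) * (4 * norm2 z) by ring.
  have nn : 0 <= n%:Z ^+ 2 by exact: sqr_ge0.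
  nia.
(* One more iteration preserves the subsolution property by monotonicity, and its value at z
   includes the inward neighbour, where [gap] is at least 2 |z_i| - 1. *)
exists (fun x => 1 + ball_step gap x).
  move=> x xV; rewrite lerD2l; apply: ball_step_le => y _; exact: ball_step_gap.
pose p := (i, z 0 i < 0).
have zi : 1 <= `|z 0 i|.
  rewrite -[1]add0r lezD1 normr_gt0; apply: contraTneq iz => ->.
  by rewrite normr0 mulr0 -ltNge ltz_nat.
have np : norm2 (neighbor z p) = norm2 z + 1 - 2 * `|z 0 i|.
  by rewrite norm2_neighbor /p /= /pm; case: ltP => zi0;
    [rewrite ltr0_norm|rewrite ger0_norm] => //; ring.
have pV : neighbor z p \in V by rewrite memV np; move: zV; rewrite memV; lia.
have gp : (2 * `|z 0 i| - 1)%:~R <= gap (neighbor z p).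
  by rewrite /gap ler_int np; move: zV; rewrite memV; lia.
rewrite /ball_step (bigD1 p)//= pV mul1r.
have rest : 0 <= \sum_(q | q != p) (2 * d)%:R^-1 *
    ((neighbor z q \in V)%:R * gap (neighbor z q)).
  apply: sumr_ge0 => q _; apply: mulr_ge0; first by rewrite invr_ge0 ltW// twod_gt0.
  by have [qV|_] := boolP (neighbor z q \in V); [rewrite mul1r gap_ge0|rewrite mul0r].
set rst := \sum_(q | _) _ in rest *.
have iz' : n%:R <= 2 * d%:R * (`|z 0 i|)%:~R :> R.
  by move: iz; rewrite -(ler_int R) !rmorphM /=.
rewrite rmorphB rmorphM /= in gp.
set a : R := (`|z 0 i|)%:~R in gp iz'.
apply: (@le_trans _ _ (1 + (2 * d)%:R^-1 * (2 * a - 1))); last first.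
  rewrite addrA -[leLHS]addr0; apply: lerD => //; rewrite lerD2l.
  by apply: ler_wpM2l => //; rewrite invr_ge0 ltW// twod_gt0.
rewrite ler_pdivrMr// natrM.
have -> : (1 + (2 * d%:R)^-1 * (2 * a - 1)) * (2 * d%:R ^+ 2) =
    2 * d%:R ^+ 2 + d%:R * (2 * a - 1) :> R.
  by field; rewrite gt_eqF// ltr0n.
by rewrite expr2; nra.
Qed.

End MeanExitTime.

(** * Superharmonic bounds on Green functions and hitting sums *)

Section Superharmonic.
Context {R : realType}.

(* s^(-1/4) *)
Definition quartic_inv (s : R) : R := (Num.sqrt (Num.sqrt s))^-1.

Lemma quartic_inv_gt0 s : 0 < s -> 0 < quartic_inv s.
Proof. by move=> s0; rewrite invr_gt0 !sqrtr_gt0. Qed.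

(** The second Taylor coefficient of (1 + x)^(-1/4) is 5/32; the larger 3/16 absorbs the higher
    orders, and it still cancels the terms of order 1/s in three dimensions. *)
Lemma taylor4 (x : R) : `|x| <= 1 / 20 ->
  1 <= (1 - x / 4 + 3 / 16 * x ^+ 2) ^+ 4 * (1 + x).
Proof.
rewrite ler_norml => /andP[x1 x2].
set y := - x / 4 + 3 / 16 * x ^+ 2.
have -> : 1 - x / 4 + 3 / 16 * x ^+ 2 = 1 + y by rewrite /y; ring.
have xx : 0 <= x ^+ 2 <= 1 / 400 by rewrite !expr2; nra.
have y1 : - (1 / 4) <= y by rewrite /y; lra.
have h1 : 1 + 4 * y + 5 * y ^+ 2 <= (1 + y) ^+ 4.
  have -> : (1 + y) ^+ 4 = 1 + 4 * y + y ^+ 2 * (6 + 4 * y + y ^+ 2) by ring.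
  have := sqr_ge0 y; nra.
have yE : y ^+ 2 = x ^+ 2 * (1 - 3 / 4 * x) ^+ 2 / 16 by rewrite /y; field.
have h2 : 1 - 3 / 2 * x <= (1 - 3 / 4 * x) ^+ 2.
  have -> : (1 - 3 / 4 * x) ^+ 2 = 1 - 3 / 2 * x + 9 / 16 * x ^+ 2 by field.
  by move: xx; lra.
have h3 : 1 - x + 3 / 4 * x ^+ 2 + 5 / 16 * (x ^+ 2 * (1 - 3 / 2 * x)) <= (1 + y) ^+ 4.
  apply: le_trans h1; rewrite yE.
  have : x ^+ 2 * (1 - 3 / 2 * x) <= x ^+ 2 * (1 - 3 / 4 * x) ^+ 2.
    by apply: ler_wpM2l => //; move/andP: xx => [].
  by rewrite /y; lra.
have x3 : 0 <= 1 + x by lra.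
apply: le_trans (ler_wpM2r x3 h3).
have -> : (1 - x + 3 / 4 * x ^+ 2 + 5 / 16 * (x ^+ 2 * (1 - 3 / 2 * x))) * (1 + x) =
  1 + x ^+ 2 * (1 / 16 + 19 / 32 * x - 15 / 32 * x ^+ 2) by field.
rewrite lerDl; apply: mulr_ge0; first by move/andP: xx => [].
by move: xx; lra.
Qed.

Lemma quartic_inv_le (s x : R) : 0 < s -> `|x| <= 1 / 20 ->
  quartic_inv (s * (1 + x)) <= quartic_inv s * (1 - x / 4 + 3 / 16 * x ^+ 2).
Proof.
move=> s0 x20; have t := taylor4 x20.
move: x20; rewrite ler_norml => /andP[x1 x2].
have x3 : 0 < 1 + x by lra.
have sx : 0 < s * (1 + x) by rewrite mulr_gt0.
set B := 1 - x / 4 + _ in t *.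
have B0 : 0 < B by have := sqr_ge0 x; rewrite /B; lra.
pose q (u : R) := Num.sqrt (Num.sqrt u).
have q0 u : 0 < u -> 0 < q u by move=> u0; rewrite !sqrtr_gt0.
have q4 u : 0 < u -> q u ^+ 4 = u.
  by move=> u0; rewrite (exprM _ 2 2) !sqr_sqrtr// ?sqrtr_ge0 ?ltW.
rewrite /quartic_inv -/(q s) -/(q (s * (1 + x))).
rewrite -[leLHS]mul1r ler_pdivrMr ?q0// -mulrA mulrC ler_pdivlMr ?q0// mul1r.
have [qs qt] := (ltW (q0 _ s0), ltW (q0 _ sx)).
rewrite -(@ler_pXn2r _ 4) ?nnegrE//; last by rewrite mulr_ge0// ltW.
rewrite exprMn !q4//; have : s * 1 <= s * (B ^+ 4 * (1 + x)) by rewrite ler_wpM2l// ltW.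
by rewrite mulr1 mulrCA.
Qed.

Lemma ln2_ge : 2^-1 <= ln (2 : R).
Proof.
rewrite -ler_expR lnK ?posrE//.
have := expR_ge1Dx (- (2^-1 : R)); rewrite expRN => h.
have e0 := expR_gt0 (2^-1 : R).
have := ler_wpM2r (ltW e0) h; rewrite mulVf ?gt_eqF//; lra.
Qed.

End Superharmonic.

Section BallHitting.
Context {R : realType} (d n : nat).
Implicit Types (x z : 'rV[int]_d) (m : pred 'I_d).

Local Notation V := (lattice_ball d n).

(** The squared distance in the coordinates selected by m: all of them if d = 2, the first three if
    d >= 3. *)
Definition mdist m z x : R := \sum_(i | m i) ((x 0 i - z 0 i)%:~R) ^+ 2.

Lemma mdist_ge0 m z x : 0 <= mdist m z x.
Proof. by apply: sumr_ge0 => i _; exact: sqr_ge0. Qed.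

Lemma mdistzz m z : mdist m z z = 0.
Proof. by rewrite /mdist big1// => i _; rewrite subrr expr0n. Qed.

Lemma mdist_neighbor m z x p : mdist m z (neighbor x p) = mdist m z x +
  (m p.1)%:R * (1 + 2 * (pm p.2 * (x 0 p.1 - z 0 p.1))%:~R).
Proof.
rewrite /mdist big_mkcond [in RHS]big_mkcond /= (bigD1 p.1)//=.
rewrite [in RHS](bigD1 p.1)//= mxE eqxx mul1r.
rewrite (eq_bigr (fun i => if m i then ((x 0 i - z 0 i)%:~R : R) ^+ 2 else 0)); last first.
  by move=> i /negPf ip; rewrite mxE ip mul0r addr0.
case: ifP => _; last by rewrite mul0r addr0.
rewrite mul1r; set S := \sum_(i | _) _.
case: p.2; rewrite /pm ?mul1r ?mulN1r ?rmorphN ?rmorphB ?rmorphD /=; ring.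
Qed.

Lemma mdist_le m z x : z \in V -> (x \in V \/ exists y p, y \in V /\ x = neighbor y p) ->
  mdist m z x <= d%:R * (2 * n%:R + 1) ^+ 2.
Proof.
move=> zV xV.
have xn i : `|x 0 i| <= n%:Z + 1.
  case: xV => [xV|[y [p [yV ->]]]].
    by apply: le_trans (coord_le i xV) _; rewrite lerDl.
  have := coord_le i yV; rewrite mxE /pm.
  by case: (i == p.1); case: p.2; rewrite /= ?mul1r ?mul0r; lia.
apply: (@le_trans _ _ (\sum_(i < d) (2 * n%:R + 1) ^+ 2)); last first.
  by rewrite sumr_const card_ord -[leLHS]mulr_natl.
rewrite /mdist big_mkcond /=; apply: ler_sum => i _; case: ifP => _; last exact: sqr_ge0.
rewrite -[leLHS]real_normK ?num_real// ler_pXn2r ?nnegrE ?addr_ge0 ?mulr_ge0//.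
rewrite -intr_norm; have : `|x 0 i - z 0 i| <= 2 * n%:Z + 1.
  by have := xn i; have := coord_le i zV; lia.
by rewrite -(ler_int R) rmorphD rmorphM /=.
Qed.

Lemma average_le (u : 'rV[int]_d -> R) x (b : R) : (0 < d)%N ->
  \sum_i (u (neighbor x (i, true)) + u (neighbor x (i, false))) <= (2 * d)%:R * b ->
  average u x <= b.
Proof.
move=> d_gt0 h; rewrite /average ler_pdivrMl ?(twod_gt0 d_gt0)//.
by rewrite sum_neighbors.
Qed.

End BallHitting.

Lemma ball_hit_ge_exit {R : realType} (d n : nat) (u : 'rV[int]_d -> R) (C : R)
    (z : lattice_ball d n) : (0 < d)%N -> (0 < n)%N ->
  (forall x, x \in lattice_ball d n -> 0 <= u x /\ forall p, 0 <= u (neighbor x p)) ->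
  (forall x, x \in lattice_ball d n -> average u x + (x == val z)%:R <= u x) ->
  u (val z) <= C ->
  n%:R / (2 * d%:R ^+ 2) / C <= \sum_y hit (@ball_srw R d n) z y.
Proof.
move=> d0 n0 u0 uA uC.
have [v vA vz] := @mean_exit_time_lower R d n d0 n0 _ (valP z).
have nd : 0 <= n%:R / (2 * d%:R ^+ 2) :> R by rewrite divr_ge0// mulr_ge0// exprn_ge0.
apply: le_trans (ball_hit_ge d0 u0 uA (le_trans nd vz) vA).
have uz1 : 1 <= u (val z).
  have := uA _ (valP z); rewrite eqxx; apply: le_trans; rewrite lerDr.
  rewrite /average mulr_ge0 ?invr_ge0//; apply: sumr_ge0 => p _.
  by have [_] := u0 _ (valP z).
have uz0 : 0 < u (val z) by apply: lt_le_trans uz1.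
apply: ler_pM => //; first by rewrite invr_ge0 (le_trans _ uC)// ltW.
by rewrite lef_pV2// posrE (lt_le_trans uz0).
Qed.

(** Here u and v are exact: the Green function and the mean exit time of the walk killed at the
    points M and - M. Their quotient at z is M = n + 1. *)
Lemma ball_hit_ge1 {R : realType} (n : nat) (z : lattice_ball 1 n) :
  n%:R <= \sum_y hit (@ball_srw R 1 n) z y.
Proof.
pose M : R := n%:R + 1.
pose c (x : 'rV[int]_1) : R := (x 0 0)%:~R.
pose u x := M - c (val z) * c x / M - `|c x - c (val z)|.
pose v x := M ^+ 2 - c x ^+ 2.
have M0 : 0 < M by rewrite ltr_wpDl.
have cn x : x \in lattice_ball 1 n -> `|c x| <= n%:R.
  by move=> xV; have := coord_le 0 xV; rewrite -(ler_int R) intr_norm.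
have cp x p : c (neighbor x p) = c x + (pm p.2)%:~R.
  by rewrite /c mxE [p.1]ord1 eqxx mul1r rmorphD.
have cpn x p : x \in lattice_ball 1 n -> `|c (neighbor x p)| <= M.
  move=> xV; rewrite cp; apply: le_trans (ler_normD _ _) _.
  by apply: lerD; [exact: cn|case: p.2; rewrite /pm /= ?rmorphN ?normrN normr1].
have zn := cn _ (valP z); have := zn; rewrite ler_norml => /andP[z1 z2].
have u_ge0 x : `|c x| <= M -> 0 <= u x.
  rewrite ler_norml => /andP[x1 x2]; rewrite -(pmulr_lge0 _ M0).
  have -> : u x * M = M ^+ 2 - c (val z) * c x - `|c x - c (val z)| * M.
    by rewrite /u; field; rewrite gt_eqF.
  have zM1 : c (val z) <= M by rewrite /M; lra.
  have zM2 : - M <= c (val z) by rewrite /M; lra.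
  case: (lerP (c (val z)) (c x)) => h.
    have -> : M ^+ 2 - c (val z) * c x - (c x - c (val z)) * M =
      (M - c x) * (M + c (val z)) by ring.
    by apply: mulr_ge0; lra.
  have -> : M ^+ 2 - c (val z) * c x - (c (val z) - c x) * M =
    (M + c x) * (M - c (val z)) by ring.
  by apply: mulr_ge0; lra.
apply: le_trans (@ball_hit_ge R 1 n isT u v z _ _ _ _).
- have zM : c (val z) ^+ 2 < M ^+ 2.
    rewrite -[ltLHS]real_normK ?num_real// ltr_pXn2r ?nnegrE//; last exact: ltW.
    by rewrite /M; lra.
  have -> : u (val z) = v (val z) / M.
    by rewrite /u /v subrr normr0; field; rewrite gt_eqF.
  rewrite invf_div mulrCA divff ?mulr1; first by rewrite /M; lra.
  by rewrite gt_eqF// subr_gt0.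
- move=> x xV; split; first by apply: u_ge0; have := cn x xV; rewrite /M; lra.
  by move=> p; apply: u_ge0; exact: cpn.
- move=> x xV; rewrite -lerBrDr; apply: average_le => //.
  rewrite big_ord1 /u !cp /pm /= rmorphN /=.
  have xz : `|c x - c (val z)| * 2 + (x == val z)%:R * 2 <=
      `|c x + 1 - c (val z)| + `|c x - 1 - c (val z)|.
    have -> : (x == val z) = (x 0 0 == val z 0 0).
      by apply/eqP/eqP => [->//|e]; apply/rowP => i; rewrite ord1.
    pose e := x 0 0 - val z 0 0.
    have h : (`|e| * 2 + (x 0 0 == val z 0 0)%:R * 2 <= `|e + 1| + `|e - 1|)%R.
      by rewrite /e; case: eqP => /=; lia.
    move: h; rewrite -(ler_int R) !rmorphD !rmorphM /= !intr_norm.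
    rewrite /e !rmorphD /= !rmorphN /= -/(c x) -/(c (val z)).
    have -> : c x - c (val z) + 1 = c x + 1 - c (val z) by ring.
    have -> : c x - c (val z) - 1 = c x - 1 - c (val z) by ring.
    by case: eqP => _ /=; rewrite ?mulr0z ?mulr1z.
  have -> : c (val z) * (c x + 1) / M = c (val z) * c x / M + c (val z) / M.
    by field; rewrite gt_eqF.
  have -> : c (val z) * (c x - 1) / M = c (val z) * c x / M - c (val z) / M.
    by field; rewrite gt_eqF.
  by lra.
- rewrite /v subr_ge0 -[leLHS]real_normK ?num_real//.
  have n0 : 0 <= n%:R :> R by [].
  by rewrite lerXn2r ?nnegrE// /M; lra.
move=> x xV; rewrite -mulr_sumr.
apply: (@le_trans _ _ (1 + (2 * 1)%:R^-1 * \sum_p v (neighbor x p))).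
  by rewrite sum_neighbors big_ord1 /v !cp /pm /= rmorphN /= muln1; lra.
rewrite lerD2l; apply: ler_wpM2l; first by rewrite invr_ge0.
apply: ler_sum => p _; have [pV|pV] := boolP (neighbor x p \in _); first by rewrite mul1r.
rewrite mul0r subr_le0 -[leRHS]real_normK ?num_real//.
rewrite lerXn2r ?nnegrE//; first exact: ltW.
have : (n%:Z + 1 <= `|neighbor x p 0 0|).
  rewrite lezD1 ltNge; apply: contra pV; rewrite memV /norm2 big_ord1 => h.
  by rewrite -[leLHS]real_normK ?num_real// lerXn2r ?nnegrE.
by rewrite -(ler_int R) rmorphD /= intr_norm.
Qed.

Lemma ball_hit_ge2 {R : realType} (n : nat) (z : lattice_ball 2 n) : (1 < n)%N ->
  n%:R / 8 / (12 * ln n%:R) <= \sum_y hit (@ball_srw R 2 n) z y.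
Proof.
move=> n1; pose s x : R := 1 + mdist predT (val z) x.
pose l : R := ln (1 + 2 * (2 * n%:R + 1) ^+ 2).
have n2 : 2 <= n%:R :> R by rewrite ler_nat.
have -> : n%:R / 8 / (12 * ln n%:R) = n%:R / (2 * 2 ^+ 2) / (12 * ln n%:R) :> R.
  by rewrite (_ : 2 * 2 ^+ 2 = 8 :> R)//; ring.
have n3 : 0 < 2 * n%:R + 1 :> R by lra.
have l0 : 0 < 1 + 2 * (2 * n%:R + 1) ^+ 2 :> R.
  by apply: addr_gt0 => //; apply: mulr_gt0 => //; exact: exprn_gt0.
have s1 x : 1 <= s x by rewrite lerDl mdist_ge0.
have s0 x : 0 < s x by exact: lt_le_trans (s1 x).
(* l bounds [ln s] on the ball and its outer neighbours, so that u >= 0. The factor 2 makes the drop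
   at z equal to 2 ln 2 >= 1. *)
pose u x : R := 2 * (l - ln (s x)).
have u_ge0 x : (x \in lattice_ball 2 n \/
    exists y p, y \in lattice_ball 2 n /\ x = neighbor y p) -> 0 <= u x.
  move=> xV; rewrite mulr_ge0// subr_ge0 ler_ln ?posrE ?s0//.
  by rewrite lerD2l; exact: (mdist_le predT (valP z) xV).
apply: (@ball_hit_ge_exit R 2 n u) => //; first exact: ltnW.
- move=> x xV; split; first by apply: u_ge0; left.
  by move=> p; apply: u_ge0; right; exists x, p.
- move=> x xV; rewrite -lerBrDr; apply: average_le => //.
  pose w i : R := (x 0 i - val z 0 i)%:~R.
  have sp p : s (neighbor x p) = s x + 1 + 2 * ((pm p.2)%:~R * w p.1).
    by rewrite /s mdist_neighbor /= mul1r rmorphM /= -/(w _); ring.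
  have spos i (e : R) : e = 1 \/ e = -1 -> 0 < s x + 1 + 2 * (e * w i).
    have := sqr_ge0 (w i + e); have : s x >= 1 + w i ^+ 2.
      rewrite lerD2l /mdist (bigD1 i)//= lerDl.
      by apply: sumr_ge0 => j _; exact: sqr_ge0.
    move=> h1 h2 [] ee; rewrite ee in h2 *; rewrite expr2 in h1; rewrite expr2 in h2; nra.
  rewrite big_ord_recl big_ord1 /u !sp /pm /= rmorphN /= !mulN1r !mul1r.
  set i0 : 'I_2 := ord0; set i1 : 'I_2 := lift ord0 ord0.
  have p1 : 0 < s x + 1 + 2 * w i0 by have := spos i0 1 (or_introl erefl); rewrite mul1r.
  have p2 : 0 < s x + 1 + 2 * - w i0 by have := spos i0 (-1) (or_intror erefl); rewrite mulN1r.
  have p3 : 0 < s x + 1 + 2 * w i1 by have := spos i1 1 (or_introl erefl); rewrite mul1r.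
  have p4 : 0 < s x + 1 + 2 * - w i1 by have := spos i1 (-1) (or_intror erefl); rewrite mulN1r.
  have sE : s x = 1 + w i0 ^+ 2 + w i1 ^+ 2.
    by rewrite /s /mdist big_ord_recl big_ord1 /=; ring.
  have [xz|xz] := eqVneq x (val z).
    have w0 i : w i = 0 by rewrite /w xz subrr.
    have sz : s x = 1 by rewrite sE !w0; ring.
    rewrite !w0 sz ln1 mulr0 oppr0 mulr0 !addr0.
    by have := ln2_ge (R := R); rewrite (_ : 1 + 1 = 2 :> R)//= natrM; lra.
  (* Subharmonicity of [ln s] says that the product of the four neighbouring values is at least s^4,
     a polynomial inequality. *)
  have key : ln (s x) *+ 4 <= ln (s x + 1 + 2 * w i0) + ln (s x + 1 + 2 * - w i0) +
      (ln (s x + 1 + 2 * w i1) + ln (s x + 1 + 2 * - w i1)).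
    rewrite -lnXn// -!lnM ?posrE ?mulr_gt0// ler_ln ?posrE ?exprn_gt0 ?mulr_gt0//.
    set t := s x in sE *.
    have -> : (t + 1 + 2 * w i0) * (t + 1 + 2 * - w i0) *
        ((t + 1 + 2 * w i1) * (t + 1 + 2 * - w i1)) =
        t ^+ 4 + (2 * t ^+ 2 + 8 * t + 5) + 16 * w i0 ^+ 2 * w i1 ^+ 2.
      by rewrite sE; ring.
    have t0 : 0 < t := s0 x.
    rewrite -addrA lerDl addr_ge0//.
      by rewrite !addr_ge0// mulr_ge0// ?exprn_ge0// ltW.
    by apply: mulr_ge0; [apply: mulr_ge0 => //|]; exact: sqr_ge0.
  by move: key; rewrite -mulr_natr /= natrM; lra.
rewrite /u /s mdistzz addr0 ln1 subr0.
(* 1 + 2 (2 n + 1)^2 <= 16 n^2 <= n^6 for n >= 2. *)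
have l6 : l <= ln (n%:R) *+ 6.
  rewrite -lnXn; last by lra.
  have n0 : 0 < n%:R :> R by lra.
  rewrite ler_ln ?posrE ?exprn_gt0//.
    have n4 : 4 <= n%:R ^+ 2 :> R by rewrite expr2; nra.
    have n6 : 4 ^+ 2 * n%:R ^+ 2 <= n%:R ^+ 6 :> R.
      have -> : n%:R ^+ 6 = (n%:R ^+ 2) ^+ 2 * n%:R ^+ 2 :> R by ring.
      apply: ler_wpM2r; first by rewrite exprn_ge0.
      by rewrite lerXn2r ?nnegrE// exprn_ge0.
    by apply: le_trans n6; rewrite !expr2 in n4 *; nra.
by rewrite -[_ *+ 6]mulr_natr in l6; lra.
Qed.

(** In three coordinates s^(-1/4), about |x - z|^(-1/2), decays more slowly than the Green function
    |x - z|^(-1), which leaves room for lattice errors. The other coordinates do not change it. The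
    terms of order 1/s cancel and the shift A gives the strict sign. *)
Lemma ball_hit_ge3 {R : realType} (B : R) (d n : nat) (z : lattice_ball d n) :
  (2 < d)%N -> (0 < n)%N -> 600 <= B ->
  n%:R / (2 * d%:R ^+ 2) / (B * d%:R) <= \sum_y hit (@ball_srw R d n) z y.
Proof.
move=> d3 n0 BE; have d0 : (0 < d)%N by exact: leq_trans d3.
(* 420 = 20 + 20^2: then 20 (1 + 2 |w|) <= A + w^2, as required for relative increments of at most
   1/20. *)
have [A AE] : exists A : R, A = 420 by exists 420.
have A0 : 0 < A by rewrite AE; lra.
have B0 : 0 < B by lra.
pose m (i : 'I_d) := (i < 3)%N.
pose s x : R := A + mdist m (val z) x.
have s420 x : A <= s x by rewrite lerDl mdist_ge0.
have s0 x : 0 < s x by exact: lt_le_trans (s420 x).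
pose q : R := quartic_inv A.
have q0 : 0 < q by exact: quartic_inv_gt0.
pose C : R := B * d%:R / q.
have dr : 0 < d%:R :> R by rewrite ltr0n.
have C0 : 0 < C by rewrite divr_gt0// mulr_gt0.
pose u x : R := C * quartic_inv (s x).
have u_ge0 x : 0 <= u x by rewrite ltW// mulr_gt0// quartic_inv_gt0.
apply: (@ball_hit_ge_exit R d n u) => //; last first.
  rewrite /u /s mdistzz addr0 -/q /C divfK// gt_eqF//.
move=> x xV; rewrite -lerBrDr; apply: average_le => //.
pose w i : R := (x 0 i - val z 0 i)%:~R.
have sp p : s (neighbor x p) = s x + (m p.1)%:R * (1 + 2 * ((pm p.2)%:~R * w p.1)).
  by rewrite /s mdist_neighbor /= rmorphM /= -/(w _); ring.
pose Q := quartic_inv (s x).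
have Q0 : 0 < Q by exact: quartic_inv_gt0.
have sw i : m i -> A + w i ^+ 2 <= s x.
  move=> mi; rewrite lerD2l /mdist (bigD1 i)//= lerDl.
  by apply: sumr_ge0 => j _; exact: sqr_ge0.
have step i (e : R) : m i -> e = 1 \/ e = -1 ->
    quartic_inv (s x + (1 + 2 * (e * w i))) <=
    Q * (1 - (1 + 2 * (e * w i)) / s x / 4 + 3 / 16 * ((1 + 2 * (e * w i)) / s x) ^+ 2).
  move=> mi ee; have h := sw i mi.
  have -> : s x + (1 + 2 * (e * w i)) = s x * (1 + (1 + 2 * (e * w i)) / s x).
    by field; rewrite gt_eqF.
  apply: quartic_inv_le => //.
  rewrite normf_div (gtr0_norm (s0 x)) ler_pdivrMr// ler_norml.
  have h1 := sqr_ge0 (w i - 20); have h2 := sqr_ge0 (w i + 20).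
  rewrite !expr2 in h h1 h2.
  rewrite AE in h.
  by apply/andP; case: ee => ->; split; nra.
have term i : u (neighbor x (i, true)) + u (neighbor x (i, false)) <=
    C * Q * (2 + (m i)%:R * (- (2 * s x)^-1 + 3 / 8 * (1 + 4 * w i ^+ 2) / s x ^+ 2)).
  rewrite /u !sp /pm /= rmorphN /=.
  case mi: (m i); last first.
    by rewrite /= !mul0r !addr0 -/Q; lra.
  rewrite !mul1r -mulrDr -mulrA; apply: ler_wpM2l; first exact: ltW.
  have e1 := step i 1 mi (or_introl erefl).
  have e2 := step i (-1) mi (or_intror erefl).
  rewrite !mul1r in e1; apply: le_trans (lerD e1 e2) _.
  rewrite le_eqVlt; apply/orP; left; apply/eqP.
  by field; rewrite gt_eqF.
apply: le_trans (ler_sum _ (fun i _ => term i)) _.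
rewrite -mulr_sumr big_split /= sumr_const card_ord.
have -> : \sum_(i < d) (m i)%:R * (- (2 * s x)^-1 + 3 / 8 * (1 + 4 * w i ^+ 2) / s x ^+ 2)
   = - (3 / 8) * (4 * A - 3) / s x ^+ 2.
  rewrite (eq_bigr (fun i => (m i)%:R * (- (2 * s x)^-1 + 3 / 8 / s x ^+ 2) +
     3 / 2 / s x ^+ 2 * ((m i)%:R * w i ^+ 2))); last first.
    by move=> i _; field; rewrite gt_eqF.
  rewrite big_split /= -mulr_suml -mulr_sumr.
  have -> : \sum_(i < d) (m i)%:R = 3 :> R.
    rewrite -natr_sum; congr (_%:R).
    rewrite (eq_bigr (fun i : 'I_d => if m i then 1%N else 0%N)); last by move=> i _; case: (m i).
    rewrite -big_mkcond /= (big_ord_narrow (F := fun=> 1%N) d3).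
    by rewrite sum1_card card_ord.
  have -> : \sum_(i < d) (m i)%:R * w i ^+ 2 = s x - A.
    rewrite /s addrAC subrr add0r /mdist [RHS]big_mkcond; apply: eq_bigr => i _.
    by case: (m i); rewrite ?mul1r ?mul0r.
  by field; rewrite gt_eqF.
rewrite -mulr_natr.
have CQ : 0 < C * Q by rewrite mulr_gt0.
have s2 : 0 < s x ^+ 2 by rewrite exprn_gt0.
have [xz|xz] := eqVneq x (val z); last first.
  rewrite subr0 natrM [leRHS]mulrC; apply: ler_wpM2l; first exact: ltW.
  have : 0 <= 3 / 8 * (4 * A - 3) / s x ^+ 2.
    by apply: divr_ge0; [rewrite AE; lra|exact: ltW].
  by lra.
have sz : s x = A by rewrite /s xz mdistzz addr0.
rewrite /u -/Q /Q sz -/q /C divfK ?gt_eqF// natrM /=.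
(* The unit mass at z requires B d k >= 2 d, with k the drop of the bracket; k >= 1/300 accounts for
   B >= 600. *)
have : 1 / 300 <= 3 / 8 * (4 * A - 3) / A ^+ 2.
  by rewrite ler_pdivlMr ?exprn_gt0// AE expr2; lra.
rewrite !mulNr; set k := _ / A ^+ 2 => k300.
have dk : d%:R * (1 / 300) <= d%:R * k by apply: ler_wpM2l; [exact: ltW|].
have dk0 : 0 <= d%:R * k by lra.
have := ler_wpM2r dk0 BE; lra.
Qed.

(** * Asymptotics *)

Section BallGeometry.
Context {R : realType} (d : nat).
Hypothesis d_gt0 : (0 < d)%N.

Local Notation card n := (#|{: lattice_ball d n}|%:R : R).

(** The order of the lower bound on |V| h_z. *)
Definition width n : R := n%:R ^+ d / gd d n.

Lemma ln_le_sqrt (n : nat) : (0 < n)%N -> ln (n%:R : R) <= 2 * Num.sqrt n%:R.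
Proof.
move=> n0; have s0 : 0 < Num.sqrt n%:R :> R by rewrite sqrtr_gt0 ltr0n.
rewrite -{1}(@sqr_sqrtr _ (n%:R : R))// lnXn// -[leLHS]mulr_natl ler_wpM2l//.
exact/ltW/ln_sublinear.
Qed.

Lemma gd_gt0 n : (1 < n)%N -> 0 < gd d n :> R.
Proof.
move=> n1; have n0 : 0 < n%:R :> R by rewrite ltr0n ltnW.
rewrite /gd; case: ifP => // _; case: ifP => _; last exact: exprn_gt0.
by rewrite mulr_gt0// ln_gt0// ltr1n.
Qed.

(** A crude bound, valid in all dimensions: the square root absorbs the logarithm of d = 2, and any
    power of n suffices against the polynomial |V|. *)
Lemma width_ge n : (1 < n)%N -> Num.sqrt n%:R / 2 <= width n.
Proof.
move=> n1; have n0 : 0 < n%:R :> R by rewrite ltr0n ltnW.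
have s1 : 1 <= Num.sqrt n%:R :> R by rewrite -[leLHS]sqrtr1 ler_sqrt// ler1n ltnW.
have ns : n%:R = Num.sqrt n%:R ^+ 2 :> R by rewrite sqr_sqrtr.
have sn : Num.sqrt n%:R / 2 <= n%:R :> R by rewrite {2}ns expr2; nra.
rewrite /width /gd; case: eqP => [->|d1]; first by rewrite expr1 divr1.
case: eqP => [->|d2].
  rewrite expr2 -mulf_div divff ?gt_eqF// mul1r.
  have l0 : 0 < ln n%:R :> R by rewrite ln_gt0// ltr1n.
  rewrite ler_pdivlMr// {3}ns expr2.
  have := @ln_le_sqrt n (ltnW n1).
  by set s := Num.sqrt _ in s1 *; nra.
rewrite -[X in _ ^+ X / _](prednK d_gt0) exprS mulfK//.
by rewrite gt_eqF// exprn_gt0.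
Qed.

Lemma width_gt0 n : (1 < n)%N -> 0 < width n.
Proof.
move=> n1; apply: lt_le_trans (width_ge n1).
by rewrite divr_gt0// sqrtr_gt0 ltr0n ltnW.
Qed.

Lemma ball_hit_lower : exists2 kappa : R, 0 < kappa & forall n (z : lattice_ball d n),
  (1 < n)%N -> kappa * width n <= \sum_y hit (@ball_srw R d n) z y.
Proof.
rewrite /width /gd; case: (eqVneq d 1%N) => [d1|d1].
  exists 1 => //; move: d_gt0; rewrite d1 => _ n z n1.
  by rewrite mul1r expr1 divr1; exact: ball_hit_ge1.
case: (eqVneq d 2%N) => [d2|d2].
  exists (8 * 12)^-1; first by rewrite invr_gt0 mulr_gt0.
  move: d_gt0; rewrite d2 => _ n z n1; apply: le_trans (ball_hit_ge2 z n1).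
  have l0 : 0 < ln n%:R :> R by rewrite ln_gt0// ltr1n.
  have n0 : 0 < n%:R :> R by rewrite ltr0n ltnW.
  rewrite le_eqVlt; apply/orP; left; apply/eqP.
  by field; rewrite !gt_eqF.
have d3 : (2 < d)%N by case: d d_gt0 d1 d2 => [|[|[|]]].
have [B BE] : exists B : R, 600 <= B by exists 600.
have dr : 0 < d%:R :> R by rewrite ltr0n.
have B0 : 0 < B by apply: lt_le_trans BE; rewrite ltr0n.
exists ((2 * d%:R ^+ 2) * (B * d%:R))^-1.
  by rewrite invr_gt0 !mulr_gt0// exprn_gt0.
move=> n z n1; apply: le_trans (ball_hit_ge3 z d3 (ltnW n1) BE).
have n0 : 0 < n%:R :> R by rewrite ltr0n ltnW.
have nd : n%:R ^+ d = n%:R * n%:R ^+ d.-1 :> R by rewrite -exprS prednK.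
rewrite /= nd mulfK; last by rewrite gt_eqF// exprn_gt0.
by rewrite invfM mulrC mulrA.
Qed.

Lemma card_ball_le n : (#|{: lattice_ball d n}| <= n.*2.+1 ^ d)%N.
Proof.
pose f (x : lattice_ball d n) : {ffun 'I_d -> 'I_n.*2.+1} :=
  [ffun i => inord `|(val x 0 i + n%:Z)%R|%N].
rewrite -[X in (_ ^ X)%N](card_ord d) -[X in (X ^ _)%N](card_ord n.*2.+1) -card_ffun.
apply: (leq_card f) => x y /ffunP e; apply/val_inj/rowP => i.
have := e i; rewrite !ffunE => /(congr1 (@nat_of_ord _)).
move: (coord_le i (valP x)) (coord_le i (valP y)).
by move: (val x 0 i) (val y 0 i) => a b ha hb; rewrite !inordK; lia.
Qed.

Lemma card_ball_ge n : (n < #|{: lattice_ball d n}|)%N.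
Proof.
pose g (k : 'I_n.+1) : 'rV[int]_d := \row_i (if i == Ordinal d_gt0 then k%:Z else 0).
have gV k : g k \in lattice_ball d n.
  rewrite memV /norm2 (bigD1 (Ordinal d_gt0))//= mxE eqxx big1.
    by rewrite addr0 lerXn2r ?nnegrE// lez_nat -ltnS.
  by move=> i /negPf i0; rewrite mxE i0 expr0n.
have : injective (fun k => [` gV k]%fset).
  move=> j k /(congr1 val) /= /rowP/(_ (Ordinal d_gt0)); rewrite !mxE eqxx => -[].
  exact: val_inj.
by move=> /leq_card; rewrite card_ord.
Qed.

Lemma card_ball_le_pow n : (0 < n)%N -> card n <= 3 ^+ d * n%:R ^+ d.
Proof.
move=> n0; apply: (@le_trans _ _ ((n.*2.+1)%:R ^+ d)).
  by rewrite -natrX ler_nat card_ball_le.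
rewrite -exprMn lerXn2r ?nnegrE ?mulr_ge0// -natrM ler_nat; lia.
Qed.

Lemma card_exp_small (k e : R) : 0 < k -> 0 < e ->
  \forall n \near \oo, card n * expR (- (k * width n)) <= e.
Proof.
move=> k0 e0.
(* In exp(- y) <= (m + 1)! / y^(m + 1) with y of order sqrt n, m + 1 = 2 (d + 1) yields n^(- d - 1),
   one power more than |V| needs. *)
pose m := (d.*2.+1)%N.
pose M : R := 3 ^+ d * ((m.+1)`!%:R / (k / 2) ^+ m.+1).
have k2 : 0 < k / 2 by rewrite divr_gt0.
have f0 : 0 < (m.+1)`!%:R :> R by rewrite ltr0n fact_gt0.
exists (Num.truncn (M / e)).+2 => // n /= Mn.
have n1 : (1 < n)%N by apply: leq_trans Mn.
have n0 : 0 < n%:R :> R by rewrite ltr0n ltnW.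
have s0 : 0 < Num.sqrt n%:R :> R by rewrite sqrtr_gt0.
pose y := k / 2 * Num.sqrt n%:R.
have y0 : 0 < y by rewrite mulr_gt0.
have yw : y <= k * width n.
  by rewrite /y mulrAC -mulrA; apply: ler_wpM2l; [exact: ltW|exact: width_ge].
have ym : y ^+ m.+1 = (k / 2) ^+ m.+1 * n%:R ^+ d.+1.
  have mE : m.+1 = (2 * d.+1)%N by rewrite /m; lia.
  rewrite /y [LHS]exprMn; congr (_ * _).
  by rewrite mE exprM sqr_sqrtr// ltW.
have ey : expR (- y) <= (m.+1)`!%:R / y ^+ m.+1.
  rewrite expRN -[leRHS]invf_div lef_pV2 ?posrE ?expR_gt0 ?divr_gt0 ?exprn_gt0//.
  apply: le_trans (expR_ge1Dxn m (ltW y0)); rewrite lerDr//.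
apply: (@le_trans _ _ (3 ^+ d * n%:R ^+ d * ((m.+1)`!%:R / y ^+ m.+1))).
  apply: ler_pM => //.
    exact/card_ball_le_pow/ltnW.
  by apply: le_trans ey; rewrite ler_expR lerN2.
have -> : 3 ^+ d * n%:R ^+ d * ((m.+1)`!%:R / y ^+ m.+1) = M / n%:R.
  rewrite ym /M [n%:R ^+ d.+1]exprS.
  have X0 : (k / 2) ^+ m.+1 != 0 by rewrite gt_eqF// exprn_gt0.
  have Y0 : n%:R ^+ d != 0 :> R by rewrite gt_eqF// exprn_gt0.
  move: {ym} ((k / 2) ^+ m.+1) (n%:R ^+ d) X0 Y0 => X Y X0 Y0.
  by field; rewrite X0 Y0 gt_eqF.
rewrite ler_pdivrMr// mulrC -ler_pdivrMr//.
apply: le_trans (ltW (truncnS_gt _)) _; rewrite ler_nat.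
by apply: leq_trans Mn; exact: leqnSn.
Qed.

End BallGeometry.

Theorem corollary4 (R : realType) (d : nat) (lambda : nat -> R) :
  (1 <= d)%N ->
  (forall n, (1 <= n)%N -> 0 < lambda n) ->
  let P n := ball_ARW d n (lambda n) in
  let card_V n : R := #|{: lattice_ball d n}|%:R in
  [/\ (fun n => t_rel (P n)) =O_\oo (fun n => gd d n),
      (fun n => t_sep (P n) 2^-1) = card_V +o_\oo card_V &
      separation_cutoff_window P (fun n => Num.sqrt (n%:R ^+ d * gd d n))].
Proof.
move=> d1 lambda0 P card_V.
have [k k0 hitk] := @ball_hit_lower R d d1.
pose c n : R := k * width d n / card_V n.
have walk n := @ball_walk R d n d1.
have card_gt0 n : (0 < #|{: lattice_ball d n}|)%N.
  exact: leq_ltn_trans (card_ball_ge d1 n).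
have N0 n : 0 < card_V n by rewrite ltr0n.
(* For d = 2 and n = 1, [gd] is 0 and so is c, whence n >= 2. *)
have c0 n : (1 < n)%N -> 0 < c n.
  by move=> n1; rewrite divr_gt0// mulr_gt0// width_gt0.
have cN n : c n * card_V n = k * width d n by rewrite divfK// gt_eqF.
have lam n : (1 < n)%N -> 0 < lambda n by move=> n1; exact/lambda0/ltnW.
have cle n (z : lattice_ball d n) : (1 < n)%N ->
    c n <= mean_hit (@ball_srw R d n) (@uniform_law R _) z.
  move=> n1; rewrite ler_pdivrMr// [leRHS]mulrC.
  by have := hitk n z n1; rewrite (mean_hit_uniform _ (card_gt0 n)).
have trel n (n1 : (1 < n)%N) :=
  t_rel_bound (walk n) (lam n n1) (card_gt0 n) (c0 n n1) (fun z => cle n z n1).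
have tsepP n (n1 : (1 < n)%N) :=
  t_sepP (walk n) (lam n n1) (card_gt0 n) (c0 n n1) (fun z => cle n z n1).
have tsep_ge n (n1 : (1 < n)%N) :=
  t_sep_ge (walk n) (lam n n1) (card_gt0 n) (c0 n n1) (fun z => cle n z n1).
have tsep_le n (n1 : (1 < n)%N) :=
  t_sep_le (walk n) (lam n n1) (card_gt0 n) (c0 n n1) (fun z => cle n z n1).
have window n (n1 : (1 < n)%N) :=
  t_sep_window (walk n) (lam n n1) (card_gt0 n) (c0 n n1) (fun z => cle n z n1).
have dsepE n (n1 : (1 < n)%N) t : d_sep (P n) t =
    survival (@ball_srw R d n) (@uniform_law R _) t finset.set0.
  exact: (d_sepE (walk n) (lam n n1) (@uniform_law_ge0 R _)
    (uniform_law_sum (card_gt0 n)) (c0 n n1) (fun z => cle n z n1)).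
have small (delta e : R) : 0 < delta -> 0 < e -> \forall n \near \oo,
    card_V n * expR (- (delta ^+ 2 / 8 * (c n * card_V n))) <= e.
  move=> delta0 e0.
  have kd : 0 < delta ^+ 2 / 8 * k by rewrite mulr_gt0// divr_gt0// exprn_gt0.
  have := card_exp_small d1 kd e0; apply: filterS => n.
  by rewrite cN mulrA.
have big (M : R) : \forall n \near \oo, M <= card_V n.
  exists (Num.truncn M).+1 => // n /= Mn.
  apply: le_trans (ltW (truncnS_gt M)) _; rewrite ler_nat.
  by apply: leq_trans Mn _; exact: ltnW (card_ball_ge d1 n).
have n2 : \forall n \near \oo, (1 < n)%N by exists 2%N.
have half : 0 < (2^-1 : R) < 1 by rewrite invr_gt0 ltr0n invf_lt1 ?ltr1n.
have [h0 h1] := andP half.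
have tsep_small (delta : R) : 0 < delta <= 1 -> \forall n \near \oo,
    t_sep (P n) 2^-1 <= (1 + delta) * card_V n + 1.
  move=> d01; have [delta0 _] := andP d01.
  near=> n; apply: tsep_le => //; first by near: n; exact: n2.
  by near: n; exact: small.
pose C : R := 3 ^+ d / k.
have C0 : 0 < C by rewrite divr_gt0// exprn_gt0.
have invc n : (1 < n)%N -> (c n)^-1 <= C * gd d n.
  move=> n1; have w0 := @width_gt0 R d d1 n n1.
  have kw0 : 0 < k * width d n by apply: mulr_gt0.
  rewrite /c invf_div ler_pdivrMr//.
  have g0 : 0 < gd d n :> R by exact: gd_gt0.
  have -> : C * gd d n * (k * width d n) = 3 ^+ d * n%:R ^+ d.
    by rewrite /C /width; field; rewrite !gt_eqF.
  exact/card_ball_le_pow/ltnW.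
split.
- apply/eqO_exP; exists (2 * C); first by rewrite mulr_gt0.
  near=> n; have n1 : (1 < n)%N by near: n; exact: n2.
  have /andP[t0 t1] := trel n n1; rewrite ger0_norm//.
  rewrite ger0_norm; last exact/ltW/gd_gt0.
  by apply: le_trans t1 _; rewrite -mulrA ler_wpM2l// invc.
- apply/eqaddoP => e e0.
  pose delta : R := Num.min 1 (e / 2).
  have delta01 : 0 < delta <= 1.
    by rewrite lt_min ltr01 divr_gt0//= ge_min lexx.
  have de : delta <= e / 2 by rewrite ge_min lexx orbT.
  near=> n; have n1 : (1 < n)%N by near: n; exact: n2.
  rewrite -[(_ - _) n]/(t_sep (P n) 2^-1 - card_V n).
  have tge : card_V n <= t_sep (P n) 2^-1 by exact: tsep_ge.
  rewrite ger0_norm ?subr_ge0// (ger0_norm (ltW (N0 n))).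
  have tle : t_sep (P n) 2^-1 <= (1 + delta) * card_V n + 1.
    by near: n; exact: tsep_small.
  have : 1 <= e / 2 * card_V n.
    rewrite -ler_pdivrMl ?divr_gt0// mulr1.
    by near: n; exact: big.
  have := ler_wpM2r (ltW (N0 n)) de; lra.
split.
  move=> alpha alpha0; split=> alpha1.
    pose delta : R := (1 - alpha) / 2.
    have delta0 : 0 < delta by rewrite /delta; lra.
    have delta01 : 0 < delta <= 1 by rewrite /delta; lra.
    (* The distance is exactly 1 eventually: fewer than |V| particles cannot fill V. *)
    apply: cvg_near_cst; near=> n; have n1 : (1 < n)%N by near: n; exact: n2.
    rewrite dsepE//; apply: (survival_eq1 (walk n) (@uniform_law_ge0 R _)
      (uniform_law_sum (card_gt0 n))).
    rewrite cards0 add0n -(ltr_nat R).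
    have tge : card_V n <= t_sep (P n) 2^-1 by exact: tsep_ge.
    have t0 : 0 <= t_sep (P n) 2^-1 by rewrite (le_trans (ltW (N0 n))).
    apply: (@le_lt_trans _ _ (alpha * t_sep (P n) 2^-1)).
      by rewrite truncn_le mulr_ge0.
    have tle : t_sep (P n) 2^-1 <= (1 + delta) * card_V n + 1.
      by near: n; exact: tsep_small.
    have : 2 / delta <= card_V n by near: n; exact: big.
    rewrite ler_pdivrMr// -/(card_V n) => h.
    have := ler_wpM2l alpha0 tle.
    have aE : alpha = 1 - 2 * delta by rewrite /delta; field.
    have := N0 n; have : 0 < delta * card_V n by rewrite mulr_gt0.
    by move: h; set N := card_V n; rewrite aE; nra.
  pose delta : R := Num.min 1 ((alpha - 1) / 2).
  have delta0 : 0 < delta by rewrite lt_min ltr01 divr_gt0// subr_gt0.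
  have delta1 : delta <= 1 by rewrite ge_min lexx.
  have da : delta <= (alpha - 1) / 2 by rewrite ge_min lexx orbT.
  apply/cvgr0Pnorm_le => e e0.
  near=> n; have n1 : (1 < n)%N by near: n; exact: n2.
  rewrite dsepE// ger0_norm; last first.
    exact: (survival_ge0 (walk n) (@uniform_law_ge0 R _)
      (uniform_law_sum (card_gt0 n))).
  apply: (@le_trans _ _
    (card_V n * expR (- (delta ^+ 2 / 8 * (c n * card_V n))))); last first.
    by near: n; exact: small.
  apply: (survival_bound (walk n) (card_gt0 n) (c0 n n1) (fun z => cle n z n1)).
    by rewrite delta0.
  rewrite -[X in X <= _]/((1 + delta) * card_V n).
  have tge : card_V n <= t_sep (P n) 2^-1 by exact: tsep_ge.
  (* One half of alpha - 1 pays for delta, the other half for the rounding. *)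
  have : 1 / ((alpha - 1) / 2) <= card_V n by near: n; exact: big.
  rewrite ler_pdivrMr; last by lra.
  have := truncnS_gt (alpha * t_sep (P n) 2^-1); rewrite -[ltRHS]natr1.
  have := ler_wpM2l alpha0 tge; have := ler_wpM2r (ltW (N0 n)) da.
  by set N := card_V n; lra.
move=> eps eps0 eps1.
(* The bracket bounds (2 m + 2 / c) / n^d, by m <= 2 |V| + 1 and 1 / c <= C g_d <= 2 C n^d; the
   remaining 1 / c is at most C g_d. *)
pose C2 : R := (4 * 3 ^+ d + 2 + 2 * (C * 2)) * C / eps.
apply/eqO_exP; exists (2 * Num.sqrt C2 + 1).
  by rewrite ltr_wpDl// mulr_ge0// sqrtr_ge0.
near=> n; have n1 : (1 < n)%N by near: n; exact: n2.
have g0 : 0 < gd d n :> R by exact: gd_gt0.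
have nd1 : 1 <= n%:R ^+ d :> R by rewrite exprn_ege1// ler1n ltnW.
have [m [mE Sm _]] := tsepP n n1 _ h0.
have eps01 : 0 < eps < 2^-1 by rewrite eps0.
have /andP[w0 w1] := window n n1 eps m eps01 Sm.
have tle : t_sep (P n) 2^-1 <= (1 + 1) * card_V n + 1.
  by near: n; apply: tsep_small; rewrite ltr01 lexx.
rewrite ger0_norm// (ger0_norm (sqrtr_ge0 _)).
apply: le_trans w1 _.
set X : R := n%:R ^+ d * gd d n.
have sn1 : 1 <= Num.sqrt n%:R :> R by rewrite -[leLHS]sqrtr1 ler_sqrt// ler1n ltnW.
have gdn : gd d n <= 2 * n%:R ^+ d :> R.
  have := @width_ge R d d1 n n1; rewrite /width ler_pdivlMr// => wn.
  by nra.
(* This absorbs the additive 1 of [t_sep_window] into the window. *)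
have X1 : 1 <= X.
  rewrite /X /gd; case: eqP => [->|_]; first by rewrite expr1 mulr1 ler1n ltnW.
  have n22 : 2 <= n%:R :> R by rewrite ler_nat.
  case: eqP => [->|_]; last by rewrite mulr_ege1 ?exprn_ege1// ler1n ltnW.
  have ln2n : 2^-1 <= ln n%:R :> R.
    by apply: le_trans ln2_ge _; rewrite ler_ln ?posrE// (lt_le_trans _ n22).
  by rewrite mulr_ege1 ?exprn_ege1//; nra.
have X0 : 0 < X by exact: lt_le_trans X1.
rewrite [leRHS]mulrDl [1 * _]mul1r; apply: lerD; last first.
  by rewrite -[leLHS]sqrtr1 ler_sqrt// ltW.
have C20 : 0 <= C2.
  have d30 : 0 < 3 ^+ d :> R by rewrite exprn_gt0.
  apply: divr_ge0; last exact: ltW.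
  by apply: mulr_ge0; [lra|exact: ltW].
rewrite -[leRHS]mulrA; apply: ler_wpM2l => //.
rewrite -sqrtrM// ler_sqrt; last by apply: mulr_ge0 => //; exact: ltW.
have ic := invc n n1.
have ic0 : 0 < (c n)^-1 by rewrite invr_gt0 c0.
have Nn : card_V n <= 3 ^+ d * n%:R ^+ d by exact/card_ball_le_pow/ltnW.
rewrite mE in tle.
have num : 2 * m%:R + 2 / c n <= (4 * 3 ^+ d + 2 + 2 * (C * 2)) * n%:R ^+ d.
  have : (c n)^-1 <= C * (2 * n%:R ^+ d).
    by apply: le_trans ic _; apply: ler_wpM2l => //; exact: ltW.
  by lra.
rewrite [leLHS](_ : _ = (2 * m%:R + 2 / c n) / c n / eps); last first.
  by rewrite -mulrA -invfM.
rewrite [leRHS](_ : _ = (4 * 3 ^+ d + 2 + 2 * (C * 2)) * n%:R ^+ d * (C * gd d n) / eps).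
  apply: ler_wpM2r; first by rewrite invr_ge0 ltW.
  apply: ler_pM => //; last exact: ltW.
  by apply: addr_ge0; apply: mulr_ge0 => //; exact: ltW.
rewrite /X /C2; move: (n%:R ^+ d) (gd d n) (4 * 3 ^+ d + 2 + 2 * (C * 2)) => Y g q.
by field; rewrite gt_eqF.
Unshelve. all: by end_near. Qed.
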